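(* Consider the model $Y_i=g(Z_i)+\varepsilon_i$, $i\ge1$, where $(Z_i)_{i\ge1}$ is a stationary sequence of random variables, $g:\mathbb{R}^\ell\to\mathbb{R}^d$, and $(\varepsilon_i)_{i\ge1}$ are i.i.d. with distribution $P$ on $\mathbb{R}^d$, independent of $(Z_i)_{i\ge1}$. Assume that the distribution of $g(Z_1)$ is in $\mathcal{M}_\rho$ for some $\rho<2$, and that the distribution $R$ of $(g(Z_1),g(Z_2))$ satisfies: for any $z_0\in\mathbb{C}^d$, $z\mapsto\Phi_R(z_0,z)$ is not the null function on $\mathbb{C}^d$ or $z\mapsto\Phi_R(z,z_0)$ is not the null function on $\mathbb{C}^d$. Then the map that associates to $(R,P)$ (with $R$ satisfying these conditions for some $\rho<2$, and $P$ the distribution of the noise) the distribution of $(Y_1,Y_2)$ is one-to-one up to translation.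
   Context: For $\rho>0$, $\mathcal{M}_\rho$ is the set of finite measures $\mu$ on $\mathbb{R}^d$ such that there exist $A,B>0$ with $\int\exp(u^Tx)\,d\mu(x)\le A\exp(B\|u\|^\rho)$ for all $u\in\mathbb{R}^d$. For a probability distribution $R$ on $\mathbb{R}^d\times\mathbb{R}^d$ with marginals in $\mathcal{M}_\rho$, $\Phi_R(z_1,z_2)=\int\exp(z_1^Tx_1+z_2^Tx_2)\,dR(x_1,x_2)$ for $(z_1,z_2)\in\mathbb{C}^d\times\mathbb{C}^d$. ''One-to-one up to translation'' means: if $(R,P)$ and $(\widetilde R,\widetilde P)$ are two such pairs yielding the same distribution of $(Y_1,Y_2)$, then there exists $m\in\mathbb{R}^d$ such that if $(X_1,X_2)$ has distribution $R$ and $(\varepsilon_1,\varepsilon_2)$ has distribution $P\otimes P$, then $(X_1-m,X_2-m)$ has distribution $\widetilde R$ and $(\varepsilon_1+m,\varepsilon_2+m)$ has distribution $\widetilde P\otimes\widetilde P$. *)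

(* Defs.v *)
From HB Require Import structures.
From mathcomp Require Import all_boot all_order all_algebra.
From mathcomp Require Import complex.
From mathcomp Require Import all_classical all_reals all_analysis.

Set Implicit Arguments.
Unset Strict Implicit.
Unset Printing Implicit Defensive.

Import Order.TTheory GRing.Theory Num.Theory.
Import numFieldNormedType.Exports.

Local Open Scope classical_set_scope.
Local Open Scope ring_scope.
Local Open Scope complex_scope.

(** R^n is [n.-tuple R]: the library equips it with the sigma-algebra generated
    by the coordinates, i.e. the Borel sigma-algebra.  C^n is [n.-tuple R[i]]. *)

Section EuclideanSpace.
Context {R : realType} {n : nat}.
Implicit Types (x y u : n.-tuple R) (z : n.-tuple R[i]).

Definition vadd x y : n.-tuple R := [tuple tnth x i + tnth y i | i < n].
Definition vsub x y : n.-tuple R := [tuple tnth x i - tnth y i | i < n].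
Definition vdot u x : R := \sum_(i < n) tnth u i * tnth x i.
Definition vnorm u : R := Num.sqrt (\sum_(i < n) tnth u i ^+ 2).

(** z^T x without conjugation. *)
Definition cdot z x : R[i] := \sum_(i < n) tnth z i * (tnth x i)%:C.

Lemma measurable_vadd d (T : measurableType d) (f g : T -> n.-tuple R) :
  measurable_fun setT f -> measurable_fun setT g ->
  measurable_fun setT (fun w => vadd (f w) (g w)).
Proof.
move=> mf mg; apply/measurable_fun_tnthP => i.
rewrite (_ : _ \o _ = fun w => tnth (f w) i + tnth (g w) i); last first.
  by apply/funext => w /=; rewrite tnth_mktuple.
by apply: measurable_realfun.measurable_funD; [move/measurable_fun_tnthP : mf|
  move/measurable_fun_tnthP : mg]; exact.
Qed.

End EuclideanSpace.

Section CombiningRandomVectors.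
Context {d d1 d2 : measure_display} {T : measurableType d}
  {T1 : measurableType d1} {T2 : measurableType d2} {R : realType} {n : nat}.

Definition mpair (X : {mfun T >-> T1}) (Y : {mfun T >-> T2}) : T -> T1 * T2 :=
  fun w => (X w, Y w).

Let measurable_mpair X Y : measurable_fun setT (mpair X Y).
Proof. exact: measurable_fun_pair. Qed.

HB.instance Definition _ X Y :=
  isMeasurableFun.Build _ _ _ _ (mpair X Y) (@measurable_mpair X Y).

Definition madd (X Y : {mfun T >-> n.-tuple R}) : T -> n.-tuple R :=
  fun w => vadd (X w) (Y w).

Let measurable_madd X Y : measurable_fun setT (madd X Y).
Proof. exact: measurable_vadd. Qed.

HB.instance Definition _ X Y :=
  isMeasurableFun.Build _ _ _ _ (madd X Y) (@measurable_madd X Y).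

End CombiningRandomVectors.

(** Distributions are compared on measurable sets only: the value of a measure
    outside the sigma-algebra carries no information. *)
Definition same_law d (T : measurableType d) (R : realType)
    (mu nu : set T -> \bar R) : Prop :=
  forall A, measurable A -> mu A = nu A.

Section Processes.
Context {d d1 d2 : measure_display} {Omega : measurableType d}
  {T1 : measurableType d1} {T2 : measurableType d2} {R : realType}
  (Pr : probability Omega R).

(** Time starts at 0, so that [X 0], [X 1] are the first two variables. *)
Definition stationary (X : nat -> {RV Pr >-> T1}) : Prop :=
  forall n k : nat,
    same_law (pushforward Pr (fun w => [tuple X (k + i)%N w | i < n]))
             (pushforward Pr (fun w => [tuple X i w | i < n])).

Definition mutually_independent (X : nat -> {RV Pr >-> T1}) : Prop :=
  forall (I : seq nat) (A : nat -> set T1),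
    uniq I -> (forall i, measurable (A i)) ->
    Pr (\bigcap_(i in [set` I]) X i @^-1` A i)
      = (\prod_(i <- I) Pr (X i @^-1` A i))%E.

Definition iid (X : nat -> {RV Pr >-> T1}) (P : probability T1 R) : Prop :=
  mutually_independent X /\ forall i, same_law (distribution Pr (X i)) P.

Definition sigma_process d' (T : measurableType d') (X : nat -> {RV Pr >-> T}) :
    set (set Omega) :=
  <<s \bigcup_i preimage_set_system setT (X i) measurable >>.

Definition independent_processes
    (X : nat -> {RV Pr >-> T1}) (Y : nat -> {RV Pr >-> T2}) : Prop :=
  forall A B, sigma_process X A -> sigma_process Y B ->
    Pr (A `&` B) = (Pr A * Pr B)%E.

End Processes.

(** Only the law [P] of the noise is recorded: the observations
    Y_i = g(Z_i) + eps_i are functions of [Z], [g] and [eps]. *)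
Record noisy_stationary_model (R : realType) (l n : nat) (d : measure_display)
    (Omega : measurableType d) (Pr : probability Omega R)
    (Z : nat -> {RV Pr >-> l.-tuple R}) (eps : nat -> {RV Pr >-> n.-tuple R})
    (P : probability (n.-tuple R) R) : Prop := {
  hidden_stationary : stationary Z ;
  noise_iid : iid eps P ;
  noise_independent : independent_processes eps Z
}.

Section ModelLaws.
Context {R : realType} {l n : nat} {d : measure_display}
  {Omega : measurableType d} (Pr : probability Omega R)
  (Z : nat -> {RV Pr >-> l.-tuple R}) (g : {mfun l.-tuple R >-> n.-tuple R})
  (eps : nat -> {RV Pr >-> n.-tuple R}).

Definition signal (i : nat) : {mfun Omega >-> n.-tuple R} := g \o Z i.

Definition observation (i : nat) : {mfun Omega >-> n.-tuple R} :=
  madd (signal i) (eps i).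

Definition signal_law1 : probability (n.-tuple R) R :=
  distribution Pr (signal 0).

Definition signal_law2 : probability (n.-tuple R * n.-tuple R)%type R :=
  distribution Pr (mpair (signal 0) (signal 1)).

Definition observation_law2 : probability (n.-tuple R * n.-tuple R)%type R :=
  distribution Pr (mpair (observation 0) (observation 1)).

End ModelLaws.

Section LaplaceTransform.
Context {R : realType} {n : nat}.

(** The class M_rho; the integral is extended-real valued, so the bound includes
    finiteness.  [`^] is the real power, with [0 `^ rho = 0] for [rho > 0]. *)
Definition Mclass (rho : R) : set {finite_measure set (n.-tuple R) -> \bar R} :=
  [set mu | exists A B : R, [/\ 0 < A, 0 < B &
    forall u : n.-tuple R,
      (\int[mu]_x (expR (vdot u x))%:E
         <= (A * expR (B * vnorm u `^ rho))%:E)%E]].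

Definition cexp (w : R[i]) : R[i] :=
  (expR (complex.Re w) * cos (complex.Im w)) +i*
  (expR (complex.Re w) * sin (complex.Im w)).

Definition cintegral d (T : measurableType d) (mu : {measure set T -> \bar R})
    (f : T -> R[i]) : R[i] :=
  (\int[mu]_x complex.Re (f x)) +i* (\int[mu]_x complex.Im (f x)).

Definition Phi (Q : probability (n.-tuple R * n.-tuple R)%type R)
    (z1 z2 : n.-tuple R[i]) : R[i] :=
  cintegral Q (fun x => cexp (cdot z1 x.1 + cdot z2 x.2)).

Definition nowhere_null_sections (Q : probability (n.-tuple R * n.-tuple R)%type R) :
    Prop :=
  forall z0 : n.-tuple R[i],
    (fun z => Phi Q z0 z) <> (fun=> 0) \/ (fun z => Phi Q z z0) <> (fun=> 0).

End LaplaceTransform.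

(** The image of ([Q], [P]) under the shift of the signals by -m and of the
    noises by +m is ([Q'], [P']). *)
Definition equal_up_to_translation (R : realType) (n : nat)
    (Q : probability (n.-tuple R * n.-tuple R)%type R)
    (P : probability (n.-tuple R) R)
    (Q' : probability (n.-tuple R * n.-tuple R)%type R)
    (P' : probability (n.-tuple R) R) : Prop :=
  exists m : n.-tuple R,
    same_law (pushforward Q (fun x => (vsub x.1 m, vsub x.2 m))) Q' /\
    same_law (pushforward (P \x P)%E (fun e => (vadd e.1 m, vadd e.2 m)))
             (P' \x P')%E.

(* Main.v *)
(** Multiplying the characteristic functions of the observations crosswise, so
    that the noise cancels, and continuing analytically from a neighbourhood of 0
    gives, with F = Phi_R(., 0), G = Phi_R'(., 0),
      Phi_R(z1, z2) G(z1) G(z2) = Phi_R'(z1, z2) F(z1) F(z2).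
    A zero of F exceeding in multiplicity that of G on a complex line would make
    a whole section of Phi_R vanish; hence F and G have the same zeros on every
    line through 0 with real direction.  Both have order less than 2, so F / G is
    the exponential of an affine function there: reflecting the zeros across
    large circles leaves ln |F / G| unchanged and makes ln |F| and ln |G|
    harmonic, and the Borel-Caratheodory inequality applies.  The coefficient is
    found at 0 to be the difference m of the means of R and R', so that F / G =
    exp(m . z), and Phi_R and the characteristic function of P differ from those
    of R' and P' by the phases of a translation by m. *)

Require Import Defs.
From HB Require Import structures.
From mathcomp Require Import all_boot all_order all_algebra.
From mathcomp Require Import complex.
From mathcomp Require Import all_classical all_reals all_analysis.
From mathcomp Require Import measurable_realfun.
From mathcomp Require Import ring lra zify.

Set Implicit Arguments.
Unset Strict Implicit.
Unset Printing Implicit Defensive.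

Import Order.TTheory GRing.Theory Num.Theory.
Import numFieldNormedType.Exports.
Import Normc.

Local Open Scope classical_set_scope.
Local Open Scope ring_scope.
Local Open Scope complex_scope.

(** * Complex numbers and polynomials *)

(** The characteristic function of the noise is in general only continuous and may vanish. Every
    continuation therefore takes place in [Phi] alone, along one-parameter complex lines, where a
    factor that is nonzero at 0 can be cancelled. Entire functions are limits of polynomials, whose
    coefficients are averages over roots of unity, so that the growth estimates reduce to finite
    sums. Order below 2 enters because, on a disk of radius r, the remainder of the linear
    approximation of [ln |F / G|] is of the size of (|z| / r)^2 times the logarithm of the maximum,
    and that logarithm is o(r^2). On the real axis F and G are positive: there the modulus
    determines the quotient, and no branch of the logarithm has to be chosen. The exponent found on
    a line depends on its direction, with no linearity known in advance; identifying it with a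
    difference of means lets one vector m serve all lines. Recovering the noise requires a division
    by [Phi] on imaginary vectors, where it may vanish; continuity of characteristic functions
    covers the points that this division misses. *)

Section Modulus.
Context {R : realType}.
Implicit Types (z w : R[i]) (x : R).

Definition modc z : R := normc z.

Lemma modcE z : modc z = Num.sqrt (complex.Re z ^+ 2 + complex.Im z ^+ 2).
Proof. by case: z. Qed.

Lemma modc_ge0 z : 0 <= modc z.
Proof. by rewrite modcE sqrtr_ge0. Qed.

Lemma modcM z w : modc (z * w) = modc z * modc w.
Proof. exact: normcM. Qed.

Lemma modcD z w : modc (z + w) <= modc z + modc w.
Proof. exact: le_normcD. Qed.

Lemma modcN z : modc (- z) = modc z.
Proof. exact: normcN. Qed.

Lemma modcB z w : modc (z - w) <= modc z + modc w.
Proof. by rewrite -(modcN w) modcD. Qed.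

Lemma modcC z w : modc (z - w) = modc (w - z).
Proof. by rewrite -modcN opprB. Qed.

Lemma modcV z : modc z^-1 = (modc z)^-1.
Proof. exact: normcV. Qed.

Lemma modc0 : modc 0 = 0.
Proof. exact: normc0. Qed.

Lemma modc1 : modc 1 = 1.
Proof. exact: normc1. Qed.

Lemma modc_eq0 z : (modc z == 0) = (z == 0).
Proof. by apply/eqP/eqP => [/eq0_normc|->] //; rewrite modc0. Qed.

Lemma modc_gt0 z : (0 < modc z) = (z != 0).
Proof. by rewrite lt_def modc_ge0 modc_eq0 andbT. Qed.

Lemma modcX z n : modc (z ^+ n) = modc z ^+ n.
Proof. by elim: n => [|n ih]; rewrite ?expr0 ?modc1 // !exprS modcM ih. Qed.

Lemma modc_real x : modc x%:C = `|x|.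
Proof. by rewrite modcE /= expr0n addr0 sqrtr_sqr. Qed.

Lemma modc_nat n : modc (n%:R) = n%:R.
Proof. by rewrite -(rmorph_nat (real_complex R)) modc_real normr_nat. Qed.

Lemma modc_sum (I : Type) (r : seq I) (P : pred I) (F : I -> R[i]) :
  modc (\sum_(i <- r | P i) F i) <= \sum_(i <- r | P i) modc (F i).
Proof.
elim/big_ind2: _ => [|a b c d ab cd|//]; first by rewrite modc0.
by rewrite (le_trans (modcD _ _))// lerD.
Qed.

Lemma modc_tri z w : modc z - modc w <= modc (z - w).
Proof. by rewrite lerBlDr (le_trans _ (modcD _ _))// subrK. Qed.

Lemma Re_modc z : `|complex.Re z| <= modc z.
Proof.
by rewrite modcE -sqrtr_sqr ler_wsqrtr// lerDl sqr_ge0.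
Qed.

Lemma Im_modc z : `|complex.Im z| <= modc z.
Proof.
by rewrite modcE -sqrtr_sqr ler_wsqrtr// lerDr sqr_ge0.
Qed.

Lemma modc_ReIm z : modc z <= `|complex.Re z| + `|complex.Im z|.
Proof.
rewrite modcE -[leRHS]ger0_norm ?addr_ge0// -[leRHS]sqrtr_sqr ler_wsqrtr//.
rewrite sqrrD !real_normK ?num_real// addrAC lerDl mulrn_wge0// mulr_ge0//.
Qed.

Lemma ReD z w : complex.Re (z + w) = complex.Re z + complex.Re w.
Proof. by case: z w => [a b] [c d]. Qed.

Lemma ReB z w : complex.Re (z - w) = complex.Re z - complex.Re w.
Proof. by case: z w => [a b] [c d]. Qed.

Lemma Re_sum (I : Type) (r : seq I) (P : pred I) (F : I -> R[i]) :
  complex.Re (\sum_(i <- r | P i) F i) = \sum_(i <- r | P i) complex.Re (F i).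
Proof. by elim/big_ind2: _ => // a b c d <- <-; rewrite ReD. Qed.

Lemma ImD z w : complex.Im (z + w) = complex.Im z + complex.Im w.
Proof. by case: z w => [a b] [c d]. Qed.

Lemma Im_sum (I : Type) (r : seq I) (P : pred I) (F : I -> R[i]) :
  complex.Im (\sum_(i <- r | P i) F i) = \sum_(i <- r | P i) complex.Im (F i).
Proof. by elim/big_ind2: _ => // a b c d <- <-; rewrite ImD. Qed.

Lemma modc_conj z : modc (conjc z) = modc z.
Proof. by case: z => a b; rewrite !modcE /= sqrrN. Qed.

Lemma modc_sqr z : (modc z ^+ 2)%:C = z * conjc z.
Proof.
case: z => a b; rewrite modcE /= sqr_sqrtr ?addr_ge0 ?sqr_ge0//.
by apply/eqP; rewrite eq_complex /= !expr2; apply/andP; split; apply/eqP; ring.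
Qed.

Lemma modc_small_eq0 z : (forall e : R, 0 < e -> modc z <= e) -> z = 0.
Proof.
move=> h; apply/eqP; rewrite -modc_eq0; apply/negPn/negP => z0.
have m0 : 0 < modc z by rewrite lt_def z0 modc_ge0.
by have := h _ (divr_gt0 m0 (ltr0n _ 2)); lra.
Qed.

End Modulus.

(** * Discrete Fourier analysis at roots of unity *)

Section RootsOfUnity.
Context {R : realType}.
Local Notation C := R[i].

(** A root of [X^(2^k) + 1] has an order that divides 2^(k+1) but not 2^k. Powers of two suffice
    because only arbitrarily large orders are used. *)
Lemma prim_root_pow2 k : exists w : C, (2 ^ k)%N.-primitive_root w.
Proof.
case: k => [|k].
  by exists 1; apply/andP; split => //; apply/forallP => -[[|//] i]; rewrite unity_rootE expr1n !eqxx.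
have [w wk] : exists w : C, w ^+ (2 ^ k) = -1.
  have : size ('X^(2 ^ k) + 1 : {poly C}) != 1%N.
    by rewrite size_XnaddC ?expn_gt0// -addn1 -[X in _ != X]add0n eqn_add2r expn_eq0.
  move/closed_rootP => [w]; rewrite rootE !hornerE addr_eq0 => /eqP wE.
  by exists w.
exists w.
have w2k : w ^+ (2 ^ k.+1) = 1 by rewrite expnS mulnC exprM wk sqrrN expr1n.
have [|m pm] := prim_order_exists _ w2k; first by rewrite expn_gt0.
move=> /(@dvdn_pfactor 2 _ _ isT)[j jk mE]; move: jk.
rewrite leq_eqVlt ltnS => /orP[/eqP <-|jk]; first by rewrite -mE.
exfalso; have : w ^+ (2 ^ k) = 1.
  rewrite -(subnK jk) expnD mulnC exprM -mE (prim_expr_order pm) expr1n //.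
rewrite wk => /eqP; rewrite eq_sym -addr_eq0 -(natrD _ 1 1) pnatr_eq0 //.
Qed.

Variables (N : nat) (w : C).
Hypothesis wN : N.-primitive_root w.

Let N_gt0 : (0 < N)%N. Proof. exact: prim_order_gt0 wN. Qed.

Lemma modc_prim : modc w = 1.
Proof.
apply/eqP; rewrite -(@pexpr_eq1 _ _ N)// ?modc_ge0//.
by rewrite -modcX (prim_expr_order wN) modc1.
Qed.

Lemma prim_conj : conjc w = w^-1.
Proof.
have w0 : w != 0 by rewrite -modc_gt0 modc_prim ltr01.
apply: (mulfI w0); rewrite divff// -modc_sqr modc_prim expr1n //.
Qed.

Lemma sum_prim_expr n : ~~ (N %| n)%N -> \sum_(k < N) (w ^+ n) ^+ k = 0.
Proof.
move=> Nn; have wn1 : w ^+ n - 1 != 0.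
  by rewrite subr_eq0; apply: contra Nn; rewrite -(prim_order_dvd wN).
apply: (mulfI wn1); rewrite -subrX1 mulr0 -exprM mulnC exprM.
by rewrite (prim_expr_order wN) expr1n subrr.
Qed.

(** A discrete Cauchy formula, exact as soon as [N] exceeds the degree, since no two frequencies are
    then congruent modulo [N]. The exponent [N - n] plays the role of -n. *)
Lemma poly_mean_coef (p : {poly C}) (z : C) n : (size p <= N)%N -> (n < N)%N ->
  \sum_(k < N) p.[z * w ^+ k] * w ^+ (k * (N - n)) = N%:R * (p`_n * z ^+ n).
Proof.
move=> pN nN.
under eq_bigr => k _ do rewrite (horner_coef_wide _ pN) big_distrl /=.
rewrite exchange_big /= (bigD1 (Ordinal nN)) //= [X in _ + X]big1 ?addr0.
  rewrite (eq_bigr (fun=> p`_n * z ^+ n)); last first.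
    move=> k _; rewrite exprMn -!mulrA -exprM -exprD -mulnDr subnKC ?(ltnW nN)//.
    by rewrite mulnC exprM (prim_expr_order wN) expr1n mulr1.
  by rewrite sumr_const card_ord mulr_natl.
move=> i inn; rewrite (eq_bigr (fun k : 'I_N => p`_i * z ^+ i * (w ^+ (i + (N - n))) ^+ k)).
  rewrite -big_distrr /= sum_prim_expr ?mulr0//.
  apply: contra inn => /dvdnP[q qE]; apply/eqP/val_inj => /=.
  have iN := ltn_ord i.
  case: q qE => [|[|q]] qE; lia.
by move=> k _; rewrite exprMn -!mulrA -!exprM -exprD (mulnC k i) (mulnC k) -mulnDl.
Qed.

End RootsOfUnity.

(** * Cauchy and Borel-Caratheodory estimates for polynomials *)

Section PolynomialEstimates.
Context {R : realType}.
Local Notation C := R[i].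
Implicit Types (p : {poly C}) (z : C) (r M : R).

Lemma prim_root_large n : exists (N : nat) (w : C), (n <= N)%N /\ N.-primitive_root w.
Proof.
have [w wP] := @prim_root_pow2 R n.
by exists (2 ^ n)%N, w; split => //; exact/ltnW/ltn_expl.
Qed.

Lemma cauchy_coef p r M n : 0 <= r -> (forall z, modc z = r -> modc p.[z] <= M) ->
  modc p`_n * r ^+ n <= M.
Proof.
move=> r0 pM.
have [N [w [nN wN]]] := prim_root_large (maxn (size p) n.+1).
have [pN {}nN] : (size p <= N)%N /\ (n < N)%N by move: nN; rewrite geq_max => /andP.
have N0 : 0 < N%:R :> R by rewrite ltr0n (leq_trans _ nN).
have := @poly_mean_coef R N w wN p r%:C n pN nN.
move=> /(congr1 modc); rewrite modcM modc_nat modcM modcX modc_real ger0_norm// => mE.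
rewrite -(ler_pM2l N0) -mE (le_trans (modc_sum _ _ _))//.
rewrite mulr_natl -[N in leRHS]card_ord -sumr_const ler_sum// => k _.
rewrite modcM modcX (modc_prim wN) expr1n mulr1 pM// modcM modcX (modc_prim wN).
by rewrite expr1n mulr1 modc_real ger0_norm.
Qed.

Lemma geo_half_le (t : R) n : 0 <= t <= 2^-1 -> \sum_(i < n) t ^+ i <= 2.
Proof.
move=> /andP[t0 t1]; have := subrX1 t n.
have : 0 <= t ^+ n by rewrite exprn_ge0.
have : 0 <= \sum_(i < n) t ^+ i by apply: sumr_ge0 => i _; rewrite exprn_ge0.
by nra.
Qed.

(** A weak maximum principle: Cauchy's estimates on the circle of radius [2 * r] dominate the terms
    by a geometric series of ratio at most 1/2, whose sum is the factor 2. *)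
Lemma poly_half_disk p r M z : 0 < r -> (forall z, modc z = 2 * r -> modc p.[z] <= M) ->
  modc z <= r -> modc p.[z] <= 2 * M.
Proof.
move=> r0 pM zr; rewrite horner_coef (le_trans (modc_sum _ _ _))//.
have r20 : 0 < 2 * r by rewrite mulr_gt0.
have M0 : 0 <= M.
  by rewrite (le_trans (modc_ge0 _) (pM (2 * r)%:C _))// modc_real gtr0_norm.
apply: (@le_trans _ _ (\sum_(i < size p) M * (modc z / (2 * r)) ^+ i)).
  apply: ler_sum => i _; rewrite modcM modcX expr_div_n mulrA ler_pdivlMr ?exprn_gt0//.
  rewrite mulrAC ler_wpM2r ?exprn_ge0 ?modc_ge0//.
  exact: (cauchy_coef _ (ltW r20) pM).
rewrite -big_distrr /= mulrC ler_wpM2r// geo_half_le// divr_ge0 ?modc_ge0 ?(ltW r20)//=.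
by rewrite ler_pdivrMr// mulrA mulVf ?mul1r// pnatr_eq0.
Qed.

(* [A - Re p] is nonnegative on the circle, and its Fourier coefficients are
   bounded by its mean. *)
Lemma borel_caratheodory_coef p r (A : R) n : 0 <= r -> (0 < n)%N ->
  (forall z, modc z = r -> complex.Re p.[z] <= A) ->
  modc p`_n * r ^+ n <= 2 * (A - complex.Re p`_0).
Proof.
move=> r0 n0 pA.
(* With this many points, the conjugate of [p] contributes nothing at frequency [n]: its share is
   the conjugate of the coefficient of index [N - n], past the degree of [p]. *)
have [N [w [nN wN]]] := prim_root_large (size p + n.+1).
have pN : (size p <= N)%N by lia.
have snN : (size p <= N - n)%N by lia.
have {}nN : (n < N)%N by lia.
have N0 : 0 < N%:R :> R by rewrite ltr0n (leq_trans _ nN).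
pose x k := r%:C * w ^+ k.
have xr k : modc (x k) = r.
  by rewrite modcM modcX (modc_prim wN) expr1n mulr1 modc_real ger0_norm.
have mean0 : \sum_(k < N) complex.Re p.[x k] = N%:R * complex.Re p`_0.
  have := @poly_mean_coef R N w wN p r%:C 0 pN (ltn_trans n0 nN).
  rewrite expr0 mulr1 subn0 => /(congr1 (@complex.Re R)).
  rewrite Re_sum => mE.
  transitivity (complex.Re (N%:R * p`_0)); last first.
    by rewrite mulr_natl; case: (p`_0) => a b; rewrite mulr_natl; elim: (N) => [|m ih];
      rewrite ?mulr0n// !mulrSr ReD ih.
  rewrite -mE; apply: eq_bigr => k _.
  by rewrite mulnC exprM (prim_expr_order wN) expr1n mulr1.
have w0 : w != 0 by rewrite -modc_gt0 (modc_prim wN).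
have conj0 : \sum_(k < N) conjc p.[x k] * w ^+ (k * (N - n)) = 0.
  rewrite -[LHS]conjcK rmorph_sum /= (eq_bigr (fun k : 'I_N => p.[r%:C * w ^+ k] * w ^+ (k * (N - (N - n))))).
    rewrite (poly_mean_coef wN _ pN); last by lia.
    by rewrite nth_default ?mul0r ?mulr0 ?conjc0//; lia.
  move=> k _; rewrite rmorphM /= conjcK rmorphXn /= (prim_conj wN) subKn ?(ltnW nN)//.
  congr (_ * _); rewrite exprVn; apply: (mulIf (expf_neq0 (k * (N - n)) w0)).
  rewrite mulVf ?expf_neq0// -exprD -mulnDr subnKC ?(ltnW nN)//.
  by rewrite mulnC exprM (prim_expr_order wN) expr1n.
have const0 : \sum_(k < N) w ^+ (k * (N - n)) = 0.
  have Nn : ~~ (N %| N - n)%N by apply/negP => /dvdn_leq; lia.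
  by rewrite -[RHS](sum_prim_expr wN Nn); apply: eq_bigr => k _; rewrite mulnC exprM.
(* The real part is half the sum of [p] and its conjugate, so only half of the coefficient survives;
   hence the factor 2 of the bound. *)
have coefE : \sum_(k < N) (A - complex.Re p.[x k])%:C * w ^+ (k * (N - n)) =
    - (N%:R * (p`_n * r%:C ^+ n)) / 2.
  rewrite -(poly_mean_coef wN _ pN nN) mulNr mulr_suml.
  rewrite (eq_bigr (fun k : 'I_N => A%:C * w ^+ (k * (N - n)) -
     (p.[x k] * w ^+ (k * (N - n)) / 2 + conjc p.[x k] * w ^+ (k * (N - n)) / 2))); last first.
    by move=> k _; rewrite rmorphB /= ReJ_add; ring.
  rewrite sumrB -mulr_sumr const0 mulr0 sub0r big_split /= -(mulr_suml _ _ _ 2^-1).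
  by rewrite -(mulr_suml _ _ _ 2^-1) conj0 mul0r addr0 mulr_suml.
have : modc (\sum_(k < N) (A - complex.Re p.[x k])%:C * w ^+ (k * (N - n)))
    <= \sum_(k < N) (A - complex.Re p.[x k]).
  rewrite (le_trans (modc_sum _ _ _))// ler_sum// => k _.
  rewrite modcM modcX (modc_prim wN) expr1n mulr1 modc_real ger0_norm//.
  by rewrite subr_ge0 pA.
rewrite coefE mulNr modcN modcM modcM modcM modcX modcV !modc_nat modc_real ger0_norm//.
rewrite sumrB mean0 sumr_const card_ord -[A *+ N]mulr_natl -mulrBr -[leLHS]mulrA ler_pM2l//.
by rewrite ler_pdivrMr// [_ * 2]mulrC.
Qed.

(** The terms of degree at least 2 obey the previous coefficient bounds and form a geometric series
    of ratio at most 1/2. The square of [modc z / r] is what later beats growth of order below 2. *)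
Lemma borel_caratheodory_linear p r (A : R) z : 0 < r ->
  (forall z, modc z = r -> complex.Re p.[z] <= A) -> modc z <= r / 2 ->
  `|complex.Re p.[z] - complex.Re p`_0 - complex.Re (p`_1 * z)| <=
    4 * (A - complex.Re p`_0) * (modc z / r) ^+ 2.
Proof.
move=> r0 pA zr; set D := A - complex.Re p`_0; set t := modc z / r.
have D0 : 0 <= D.
  have := borel_caratheodory_coef (ltW r0) (ltn0Sn 0) pA.
  by move/(le_trans (mulr_ge0 (modc_ge0 _) (exprn_ge0 _ (ltW r0)))); rewrite -/D; lra.
have t01 : 0 <= t <= 2^-1.
  by rewrite divr_ge0 ?modc_ge0 ?(ltW r0)//= ler_pdivrMr// mulrC.
rewrite (@horner_coef_wide _ (size p).+2)//; last by rewrite leqW.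
rewrite 2!big_ord_recl /= expr0 mulr1 expr1 !ReD.
rewrite -[p`_(bump 0 0)]/(p`_1); set S := \sum_(i < _) _.
have -> : complex.Re p`_0 + (complex.Re (p`_1 * z) + complex.Re S) -
   complex.Re p`_0 - complex.Re (p`_1 * z) = complex.Re S by ring.
apply: (le_trans (Re_modc _)); rewrite (le_trans (modc_sum _ _ _))//.
apply: (@le_trans _ _ (\sum_(i < size p) (2 * D * t ^+ 2) * t ^+ i)).
  apply: ler_sum => i _; rewrite -[bump 0 (bump 0 i)]/(i.+2) modcM modcX.
  have -> : 2 * D * t ^+ 2 * t ^+ i = 2 * D * modc z ^+ i.+2 / r ^+ i.+2.
    by rewrite -[LHS]mulrA -exprD expr_div_n mulrA.
  rewrite ler_pdivlMr ?exprn_gt0// mulrAC ler_wpM2r ?exprn_ge0 ?modc_ge0//.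
  exact: (borel_caratheodory_coef (ltW r0)).
rewrite -big_distrr /= (_ : 4 * D * t ^+ 2 = 2 * D * t ^+ 2 * 2); last by ring.
by rewrite ler_wpM2l ?geo_half_le// mulr_ge0 ?sqr_ge0// mulr_ge0.
Qed.

End PolynomialEstimates.

(** * Entire functions *)

Section EntireFunctions.
Context {R : realType}.
Local Notation C := R[i].
Implicit Types (f g : C -> C) (p : {poly C}) (z a : C) (r e M : R).

(* Entire functions as locally uniform limits of polynomials, a form that needs
   neither complex derivatives nor power series. *)
Definition entire f := forall r e : R, 0 < e ->
  exists p : {poly C}, forall z, modc z <= r -> modc (f z - p.[z]) <= e.

Lemma poly_disk_bounded p r : exists2 M, 0 < M &
  forall z, modc z <= r -> modc p.[z] <= M.
Proof.
exists (1 + \sum_(i < size p) modc p`_i * `|r| ^+ i).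
  by rewrite ltr_wpDr// sumr_ge0// => i _; rewrite mulr_ge0 ?exprn_ge0 ?modc_ge0.
move=> z zr; rewrite horner_coef (le_trans (modc_sum _ _ _))//.
rewrite ler_wpDl// ler_sum// => i _; rewrite modcM modcX ler_wpM2l ?modc_ge0//.
by rewrite lerXn2r ?nnegrE ?modc_ge0// (le_trans zr)// ler_norm.
Qed.

Lemma entire_cst a : entire (fun=> a).
Proof.
by move=> r e e0; exists a%:P => z _; rewrite hornerC subrr modc0 ltW.
Qed.

Lemma entire_id : entire id.
Proof. by move=> r e e0; exists 'X => z _; rewrite hornerX subrr modc0 ltW. Qed.

Lemma entire_bounded f r : entire f -> exists2 M, 0 < M &
  forall z, modc z <= r -> modc (f z) <= M.
Proof.
move=> /(_ r 1 ltr01)[p fp]; have [M M0 pM] := poly_disk_bounded p r.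
exists (1 + M); first by rewrite addr_gt0.
move=> z zr; rewrite -(subrK p.[z] (f z)) (le_trans (modcD _ _))//.
by rewrite lerD ?fp ?pM.
Qed.

Lemma entireD f g : entire f -> entire g -> entire (fun z => f z + g z).
Proof.
move=> ef eg r e e0; have e20 : 0 < e / 2 by rewrite divr_gt0.
have [p fp] := ef r _ e20; have [q gq] := eg r _ e20.
exists (p + q) => z zr; rewrite hornerD opprD addrACA (le_trans (modcD _ _))//.
by rewrite (splitr e) lerD ?fp ?gq.
Qed.

Lemma entireM f g : entire f -> entire g -> entire (fun z => f z * g z).
Proof.
move=> ef eg r e e0.
have [M M0 fM] := entire_bounded r ef.
have [K K0 gK] := entire_bounded r eg.
have [q gq] := eg r (e / 2 / M) (divr_gt0 (divr_gt0 e0 (ltr0n _ 2)) M0).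
have [L L0 qL] := poly_disk_bounded q r.
have [p fp] := ef r (e / 2 / L) (divr_gt0 (divr_gt0 e0 (ltr0n _ 2)) L0).
exists (p * q) => z zr; rewrite hornerM.
have -> : f z * g z - p.[z] * q.[z] = f z * (g z - q.[z]) + (f z - p.[z]) * q.[z] by ring.
rewrite (le_trans (modcD _ _))// !modcM (splitr e); apply: lerD.
  rewrite (le_trans (ler_pM (modc_ge0 _) (modc_ge0 _) (fM _ zr) (gq _ zr)))//.
  by rewrite mulrC divfK ?gt_eqF.
rewrite (le_trans (ler_pM (modc_ge0 _) (modc_ge0 _) (fp _ zr) (qL _ zr)))//.
by rewrite divfK ?gt_eqF.
Qed.

Lemma entireB f g : entire f -> entire g -> entire (fun z => f z - g z).
Proof.
move=> ef eg; rewrite (_ : (fun _ => _) = fun z => f z + (-1) * g z).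
  by apply: entireD => //; apply: entireM => //; exact: entire_cst.
by apply/funext => z; rewrite mulN1r.
Qed.

Lemma entire_prod (I : Type) (s : seq I) (F : I -> C -> C) :
  (forall i, entire (F i)) -> entire (fun z => \prod_(i <- s) F i z).
Proof.
move=> eF; elim: s => [|i s ih].
  by rewrite (_ : (fun _ => _) = fun=> 1); [exact: entire_cst|apply/funext => z; rewrite big_nil].
rewrite (_ : (fun _ => _) = fun z => F i z * \prod_(i <- s) F i z).
  exact: entireM.
by apply/funext => z; rewrite big_cons.
Qed.

Lemma entire_shift f a : entire f -> entire (fun z => f (z + a)).
Proof.
move=> ef r e e0; have [p fp] := ef (r + modc a) e e0.
exists (p \Po ('X + a%:P)) => z zr; rewrite horner_comp !hornerE fp//.
by rewrite (le_trans (modcD _ _))// lerD2r.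
Qed.

Lemma entire_half_disk f r M z : entire f -> 0 < r ->
  (forall z, modc z = 2 * r -> modc (f z) <= M) -> modc z <= r -> modc (f z) <= 2 * M.
Proof.
move=> ef r0 fM zr; apply/ler_addgt0Pr => e e0.
have e30 : 0 < e / 3 by rewrite divr_gt0.
have [p fp] := ef (2 * r) _ e30.
have pM w : modc w = 2 * r -> modc p.[w] <= M + e / 3.
  move=> wr; rewrite -(subrK (f w) p.[w]) (le_trans (modcD _ _))// addrC.
  by rewrite lerD ?fM// modcC fp ?wr.
have := poly_half_disk r0 pM zr => pz.
have zr2 : modc z <= 2 * r by rewrite (le_trans zr)// ler_peMl ?(ltW r0)// ler1n.
rewrite -(subrK p.[z] (f z)) (le_trans (modcD _ _))// (le_trans (lerD (fp _ zr2) pz))//.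
by lra.
Qed.

(** For each component the limit is the supremum of the lower bounds [v j - e j], all of which lie
    below every [v k + e k]. The factor 2 adds the two components. *)
Lemma cauchy_limit (u : nat -> C) (e : nat -> R) :
  (forall j k, modc (u j - u k) <= e j + e k) ->
  exists L, forall j, modc (u j - L) <= 2 * e j.
Proof.
move=> ue.
have real_limit (v : nat -> R) : (forall j k, `|v j - v k| <= e j + e k) ->
    exists L, forall j, `|v j - L| <= e j.
  move=> ve; have vle j k : v j - e j <= v k + e k.
    by have := ve j k; rewrite ler_norml => /andP[]; lra.
  have [ne ub] : has_sup (range (fun j => v j - e j)).
    split; first by exists (v 0%N - e 0%N), 0%N.
    by exists (v 0%N + e 0%N) => _ [j _ <-].
  exists (sup (range (fun j => v j - e j))) => j.
  have h1 : v j - e j <= sup (range (fun j => v j - e j)).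
    by apply: ub_le_sup => //; exists j.
  have h2 : sup (range (fun j => v j - e j)) <= v j + e j.
    by apply: ge_sup => // _ [k _ <-].
  by rewrite ler_norml; apply/andP; split; lra.
have [L1 L1P] : exists L, forall j, `|complex.Re (u j) - L| <= e j.
  apply: real_limit => j k; rewrite -ReB; exact: le_trans (Re_modc _) (ue j k).
have [L2 L2P] : exists L, forall j, `|complex.Im (u j) - L| <= e j.
  apply: real_limit => j k; apply: le_trans (ue j k).
  by have := Im_modc (u j - u k); case: (u j) (u k) => [a b] [c d].
exists (L1 +i* L2) => j; rewrite (le_trans (modc_ReIm _))// mulr_natl mulr2n.
by move: (L1P j) (L2P j); case: (u j) => a b /= ? ?; rewrite lerD.
Qed.

Lemma exp_half_small e : 0 < e -> exists k, forall n, (k <= n)%N -> 2^-1 ^+ n <= e.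
Proof.
move=> e0; exists (Num.truncn e^-1).+1 => n kn.
rewrite exprVn -[leRHS]invrK lef_pV2 ?posrE ?exprn_gt0 ?invr_gt0//.
rewrite (le_trans (ltW (truncnS_gt _)))// -natrX ler_nat.
by rewrite (leq_trans (ltnW (ltn_expl _ (ltnSn 1))))// leq_exp2l.
Qed.

(* The difference quotients of approximating polynomials converge by the
   maximum principle. *)
Lemma entire_deflate f a : entire f -> f a = 0 ->
  exists2 g, entire g & forall z, f z = (z - a) * g z.
Proof.
move=> ef fa0.
(* These radii exhaust the plane, and on the circle of radius [2 * rad n] the distance to [a] is at
   least 1, so that dividing by [z - a] there does not enlarge errors. *)
pose rad n : R := n%:R + modc a + 1.
pose e n : R := 2^-1 ^+ n.
have e0 n : 0 < e n by rewrite exprn_gt0// invr_gt0.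
have rad0 n : 0 < rad n by rewrite ltr_wpDl// addr_ge0 ?modc_ge0.
have /choice[q qP] : forall n, exists q : {poly C},
    forall z, modc z <= 2 * rad n -> modc ((z - a) * q.[z] - f z) <= 2 * e n.
  move=> n; have [p fp] := ef (2 * rad n) _ (e0 n).
  have /factor_theorem[q qE] : root (p - p.[a]%:P) a by rewrite rootE !hornerE subrr.
  exists q => z zr.
  have -> : (z - a) * q.[z] = p.[z] - p.[a].
    by rewrite -(hornerC p.[a] z) -hornerN -hornerD qE !hornerE mulrC.
  have -> : p.[z] - p.[a] - f z = (p.[z] - f z) + (f a - p.[a]) by rewrite fa0; ring.
  rewrite (le_trans (modcD _ _))// mulr_natl mulr2n lerD ?fp//; first by rewrite modcC fp.
  have := rad0 n; rewrite /rad; have : 0 <= n%:R :> R by []. have := modc_ge0 a.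
  by lra.
have qq m j k z : (m <= j)%N -> (m <= k)%N -> modc z <= rad m ->
    modc ((q j).[z] - (q k).[z]) <= 4 * e j + 4 * e k.
  move=> mj mk zr; rewrite -hornerN -hornerD.
  have -> : 4 * e j + 4 * e k = 2 * (2 * e j + 2 * e k) by ring.
  apply: (@poly_half_disk _ _ (rad m)) zr => //{}z zr.
  have za : 1 <= modc (z - a).
    apply: le_trans (modc_tri _ _); rewrite zr /rad.
    by have : 0 <= m%:R :> R by []; have := modc_ge0 a; lra.
  rewrite -[leLHS]mul1r (le_trans (ler_wpM2r (modc_ge0 _) za))// -modcM.
  rewrite hornerD hornerN.
  have -> : (z - a) * ((q j).[z] - (q k).[z]) =
    ((z - a) * (q j).[z] - f z) - ((z - a) * (q k).[z] - f z) by ring.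
  have mono n : (m <= n)%N -> modc z <= 2 * rad n.
    by move=> mn; rewrite zr ler_pM2l// /rad !lerD2r ler_nat.
  by rewrite (le_trans (modcB _ _))// lerD// qP// mono.
have /choice[g gP] : forall z, exists L, forall n, modc z <= rad n -> modc ((q n).[z] - L) <= 8 * e n.
  move=> z; have [m zm] : exists m, modc z <= rad m.
    exists (Num.truncn (modc z)).+1; rewrite /rad -addrA ler_wpDr ?addr_ge0 ?modc_ge0//.
    by rewrite ltW// truncnS_gt.
  have [|L LP] := @cauchy_limit (fun k => (q (m + k)%N).[z]) (fun k => 4 * e (m + k)%N).
    by move=> j k; apply: (qq m) => //; rewrite leq_addr.
  (* The limit is taken along the indices from [m] on; the index [n], possibly below [m], is
     compared with it through a far index [m + k]. *)
  exists L => n zn; apply/ler_addgt0Pr => d d0.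
  have [k /(_ (m + k)%N (leq_addl _ _)) kd] := exp_half_small (divr_gt0 d0 (ltr0n _ 12)).
  have := LP k; have := qq (minn n (m + k)) n (m + k)%N z (geq_minl _ _) (geq_minr _ _).
  have -> : modc z <= rad (minn n (m + k)).
    rewrite /minn; case: ifP => // _; rewrite (le_trans zm)// /rad !lerD2r ler_nat leq_addr//.
  move=> /(_ isT) h1 h2.
  have -> : (q n).[z] - L = ((q n).[z] - (q (m + k)%N).[z]) + ((q (m + k)%N).[z] - L) by ring.
  rewrite (le_trans (modcD _ _))// (le_trans (lerD h1 h2))//.
  by move: kd; rewrite -/(e (m + k)%N); have := e0 n; lra.
have small d : 0 < d -> forall r, exists n, 8 * e n <= d /\ r <= rad n.
  move=> d0 r.
  have : r <= (Num.truncn `|r|).+1%:R by rewrite (le_trans (ler_norm _))// ltW// truncnS_gt.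
  set m := (Num.truncn _).+1 => rm.
  have [k /(_ (k + m)%N (leq_addr _ _)) kd] := exp_half_small (divr_gt0 d0 (ltr0n _ 8)).
  exists (k + m)%N; split; first by move: kd; rewrite -/(e _); lra.
  by rewrite /rad natrD; have : 0 <= k%:R :> R by []; have := modc_ge0 a; lra.
exists g.
  move=> r d d0; have [n [nd rn]] := small _ d0 r.
  exists (q n) => z zr; rewrite modcC (le_trans (gP z n _))//.
  exact: le_trans zr rn.
move=> z; apply/eqP; rewrite -subr_eq0; apply/eqP/modc_small_eq0 => d d0.
have D0 : 0 < d / (1 + modc (z - a)).
  by rewrite divr_gt0// ltr_wpDr ?modc_ge0.
have [n [nd rn]] := small _ D0 (modc z).
have zr2 : modc z <= 2 * rad n by rewrite (le_trans rn)// ler_peMl ?(ltW (rad0 _))// ler1n.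
have h1 := qP n z zr2; have h2 := gP z n rn.
have -> : f z - (z - a) * g z = - ((z - a) * (q n).[z] - f z) + (z - a) * ((q n).[z] - g z) by ring.
rewrite (le_trans (modcD _ _))// modcN modcM.
have := ler_wpM2l (modc_ge0 (z - a)) h2.
move: nd; rewrite ler_pdivlMr ?ltr_wpDr ?modc_ge0//.
have := e0 n; have := modc_ge0 (z - a); move: h1.
set x := modc (z - a); set y := modc (_ - f z); set w := x * _; set v := e n.
by move=> ? ? ? ? ?; nra.
Qed.

End EntireFunctions.

(** * Zeros of entire functions: counting, division, identity theorem *)

Section Zeros.
Context {R : realType}.
Local Notation C := R[i].
Implicit Types (f g : C -> C) (l : seq C) (z a : C) (r e M : R).

Definition zpoly l z : C := \prod_(a <- l) (z - a).

(* The factor of [a] is [z - a] times a Blaschke factor of the disk of radius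
   [2 * r]: it has modulus [|z - a|] on the boundary circle and no zero inside. *)
Definition blaschke r l z : C :=
  \prod_(a <- l) ((2 * r)%:C - conjc a * z / (2 * r)%:C).

Lemma zpoly_cons a l z : zpoly (a :: l) z = (z - a) * zpoly l z.
Proof. by rewrite /zpoly big_cons. Qed.

Lemma blaschke_cons r a l z :
  blaschke r (a :: l) z = ((2 * r)%:C - conjc a * z / (2 * r)%:C) * blaschke r l z.
Proof. by rewrite /blaschke big_cons. Qed.

Lemma entire_zpoly l : entire (zpoly l).
Proof.
apply: entire_prod => a; apply: entireB; [exact: entire_id|exact: entire_cst].
Qed.

Lemma entire_blaschke r l : entire (blaschke r l).
Proof.
apply: entire_prod => a; apply: entireB; first exact: entire_cst.
apply: entireM; last exact: entire_cst.
by apply: entireM; [exact: entire_cst|exact: entire_id].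
Qed.

(** On this circle [z * conjc z] is the square of [2 * r], so each factor equals [z / (2 * r)] times
    the conjugate of [z - a]. *)
Lemma blaschke_circle r l z : 0 < r -> modc z = 2 * r ->
  modc (blaschke r l z) = modc (zpoly l z).
Proof.
move=> r0 zr; have r20 : 0 < 2 * r by rewrite mulr_gt0.
have r2N0 : (2 * r)%:C != 0 :> C by rewrite -modc_gt0 modc_real normr_gt0 gt_eqF.
elim: l => [|a l ih]; first by rewrite /blaschke /zpoly !big_nil.
rewrite blaschke_cons zpoly_cons !modcM ih; congr (_ * _).
apply: (mulIf (lt0r_neq0 r20)).
rewrite -[X in _ = _ * X]zr -(modc_conj (z - a)) -modcM rmorphB /= mulrBl.
rewrite [conjc z * z]mulrC -modc_sqr zr expr2 (rmorphM _ (2 * r) (2 * r)).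
rewrite -[in RHS](divfK r2N0 (conjc a * z)) -mulrBl [in RHS]modcM modc_real.
by rewrite ger0_norm ?(ltW r20).
Qed.

Lemma blaschke_neq0 r l z : 0 < r -> (forall a, a \in l -> modc a <= r) ->
  modc z <= r -> blaschke r l z != 0.
Proof.
move=> r0 lr zr; have r20 : 0 < 2 * r by rewrite mulr_gt0.
rewrite /blaschke prodf_seq_neq0; apply/allP => a /lr ar /=.
rewrite -modc_gt0 (lt_le_trans _ (modc_tri _ _))//.
rewrite !modcM modcV modc_conj !modc_real gtr0_norm// subr_gt0 ltr_pdivrMr//.
rewrite (le_lt_trans (ler_pM (modc_ge0 _) (modc_ge0 _) ar zr))//.
by nra.
Qed.

(** At 0 each factor is [2 * r], at least twice [modc a]. This gain of 2 per zero is the source of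
    the counting bound. *)
Lemma blaschke_at0 r l : 0 < r -> (forall a, a \in l -> modc a <= r) ->
  modc (zpoly l 0) * 2 ^+ size l <= modc (blaschke r l 0).
Proof.
move=> r0; elim: l => [|a l ih] lr; first by rewrite /zpoly /blaschke !big_nil mulr1.
rewrite zpoly_cons blaschke_cons !modcM sub0r modcN mulr0 mul0r subr0 exprS.
rewrite mulrACA ler_pM ?mulr_ge0 ?modc_ge0 ?exprn_ge0//.
  rewrite modc_real gtr0_norm ?mulr_gt0// mulrC ler_pM2l// lr// mem_head//.
by apply: ih => b bl; rewrite lr// in_cons bl orbT.
Qed.

(** Exchanging [zpoly] for [blaschke] preserves the modulus on the circle of radius [2 * r], so the
    bound of [f] passes to the smaller disk by the weak maximum principle, while the modulus at 0
    can only grow. *)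
Lemma deflated_bounds f f1 l r M : entire f1 -> 0 < r ->
  (forall a, a \in l -> modc a <= r) -> (forall z, f z = zpoly l z * f1 z) ->
  (forall z, modc z <= 2 * r -> modc (f z) <= M) ->
  (forall z, modc z <= r -> modc (f1 z * blaschke r l z) <= 2 * M) /\
  modc (f 0) * 2 ^+ size l <= modc (f1 0 * blaschke r l 0).
Proof.
move=> ef1 r0 lr fE fM; split.
  move=> z zr; apply: (@entire_half_disk _ (fun z => f1 z * blaschke r l z) r) => //.
    by apply: entireM => //; exact: entire_blaschke.
  move=> w wr; rewrite modcM blaschke_circle// -modcM mulrC -fE fM// wr//.
by rewrite fE !modcM mulrAC mulrC ler_wpM2l ?modc_ge0// blaschke_at0.
Qed.

(** Both estimates of the reflected function, read at 0, give a weak form of Jensen's inequality. *)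
Lemma zero_count f f1 l r M : entire f1 -> 0 < r ->
  (forall a, a \in l -> modc a <= r) -> (forall z, f z = zpoly l z * f1 z) ->
  (forall z, modc z <= 2 * r -> modc (f z) <= M) ->
  modc (f 0) * 2 ^+ size l <= 2 * M.
Proof.
move=> ef1 r0 lr fE fM; have [h1 h2] := deflated_bounds ef1 r0 lr fE fM.
by rewrite (le_trans h2)// h1// modc0 ltW.
Qed.

(** The bound is uniform over all factorizations, with multiplicities. It makes the extraction of
    zeros terminate, and it is what infinitely many zeros contradict in the identity theorem. *)
Lemma zero_count_bound f r : entire f -> f 0 != 0 -> 0 < r ->
  exists n, forall l f1, entire f1 -> (forall a, a \in l -> modc a <= r) ->
    (forall z, f z = zpoly l z * f1 z) -> (size l < n)%N.
Proof.
move=> ef f0 r0; have [M M0 fM] := entire_bounded (2 * r) ef.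
rewrite -modc_gt0 in f0.
have M20 : 0 < modc (f 0) / (4 * M) by rewrite divr_gt0// mulr_gt0.
have [n nP] := exp_half_small M20.
exists n => l f1 ef1 lr fE; rewrite ltnNge; apply/negP => nl.
have := zero_count ef1 r0 lr fE fM; have := nP _ nl.
rewrite exprVn ler_pdivlMr ?mulr_gt0// mulrC ler_pdivrMr ?exprn_gt0//.
by nra.
Qed.

(* Each zero of [f] is a zero of [g] of at least the same multiplicity. *)
Definition zeros_below f g := forall l f1 g1, entire f1 -> entire g1 ->
  (forall z, f z = zpoly l z * f1 z) -> (forall z, g z = zpoly l z * g1 z) ->
  forall a, f1 a = 0 -> g1 a = 0.

(** Common zeros are divided out one at a time: by [zeros_below], each remaining zero of [f1] is
    also one of [g1]. The uniform bound on the number of zeros is the fuel of the induction. *)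
Lemma deflate_pair f g r : entire f -> entire g -> f 0 != 0 -> 0 < r ->
  zeros_below f g ->
  exists l f1 g1, [/\ entire f1, entire g1, forall a, a \in l -> modc a <= r,
    forall z, f z = zpoly l z * f1 z & forall z, g z = zpoly l z * g1 z] /\
    forall z, modc z <= r -> f1 z != 0.
Proof.
move=> ef eg f0 r0 fg; have [N NP] := zero_count_bound ef f0 r0.
suff : forall n l f1 g1, (N <= size l + n)%N -> entire f1 -> entire g1 ->
    (forall a, a \in l -> modc a <= r) ->
    (forall z, f z = zpoly l z * f1 z) -> (forall z, g z = zpoly l z * g1 z) ->
    exists l f1 g1, [/\ entire f1, entire g1, forall a, a \in l -> modc a <= r,
      forall z, f z = zpoly l z * f1 z & forall z, g z = zpoly l z * g1 z] /\
      forall z, modc z <= r -> f1 z != 0.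
  by move=> /(_ N [::] f g); apply => // z; rewrite /zpoly big_nil mul1r.
elim=> [|n ih] l f1 g1.
  by rewrite addn0 leqNgt => /negP Nl ef1 eg1 lr fE gE; exfalso; apply/Nl/(NP _ f1).
rewrite addnS -addSn => Nl ef1 eg1 lr fE gE.
have [[a ar fa0]|nz] := pselect (exists2 a, modc a <= r & f1 a = 0); last first.
  exists l, f1, g1; split => // z zr; apply/eqP => fz0; apply: nz; by exists z.
have ga0 := fg _ _ _ ef1 eg1 fE gE _ fa0.
have [f2 ef2 f2E] := entire_deflate ef1 fa0.
have [g2 eg2 g2E] := entire_deflate eg1 ga0.
apply: (ih (a :: l) f2 g2) => //.
- by move=> b; rewrite in_cons => /predU1P[->//|]; exact: lr.
- by move=> z; rewrite zpoly_cons fE f2E; ring.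
- by move=> z; rewrite zpoly_cons gE g2E; ring.
Qed.

Lemma deflate_zeros f l : entire f -> uniq l -> (forall a, a \in l -> f a = 0) ->
  exists2 f1, entire f1 & forall z, f z = zpoly l z * f1 z.
Proof.
move=> ef; elim: l => [|a l ih] /=.
  by move=> _ _; exists f => // z; rewrite /zpoly big_nil mul1r.
move=> /andP[al ul] fl; have [|f1 ef1 fE] := ih ul.
  by move=> b bl; rewrite fl// in_cons bl orbT.
have /entire_deflate[//|f2 ef2 f2E] : f1 a = 0.
  have : f a = 0 by rewrite fl// mem_head.
  rewrite fE => /eqP; rewrite mulf_eq0 => /orP[|/eqP//].
  rewrite /zpoly prodf_seq_eq0 => /hasP[b bl] /=.
  by rewrite subr_eq0 => /eqP ab; rewrite ab bl in al.
by exists f2 => // z; rewrite zpoly_cons fE f2E; ring.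
Qed.

(** Recentred at a point [z0] with [f z0 != 0], the function is nonzero at 0 and yet has arbitrarily
    many zeros in a fixed disk, against [zero_count_bound]. A short real interval is the form in
    which later continuations provide zeros. *)
Lemma identity_theorem f (d : R) : entire f -> 0 < d ->
  (forall x : R, 0 < x < d -> f x%:C = 0) -> forall z, f z = 0.
Proof.
move=> ef d0 fd z0; apply/eqP/negPn/negP => fz0.
pose h z := f (z + z0).
have eh : entire h by exact: entire_shift.
have h0 : h 0 != 0 by rewrite /h add0r.
have r0 : 0 < d + modc z0 by rewrite ltr_wpDr ?modc_ge0.
have [n nP] := zero_count_bound eh h0 r0.
pose s k : R := d / k.+2%:R.
have s0 k : 0 < s k < d.
  rewrite divr_gt0//= ltr_pdivrMr// ltr_pMr// ltr1n//.
pose l := [seq (s k)%:C - z0 | k <- iota 0 n].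
have ul : uniq l.
  rewrite map_inj_uniq ?iota_uniq// => i j /addIr /complexI /(mulfI (lt0r_neq0 d0)) /invr_inj /eqP.
  by rewrite eqr_nat => /eqP[].
have [|f1 ef1 fE] := deflate_zeros eh ul.
  by move=> a /mapP[k _ ->]; rewrite /h subrK fd.
have : (size l < n)%N.
  apply: (nP l f1 ef1 _ fE) => a /mapP[k _ ->].
  rewrite (le_trans (modcB _ _))// lerD2r modc_real gtr0_norm; have /andP[] := s0 k => // _.
  exact: ltW.
by rewrite size_map size_iota ltnn.
Qed.

End Zeros.

(** * The logarithm of the modulus as a harmonic function *)

Section LogModulus.
Context {R : realType}.
Local Notation C := R[i].
Implicit Types (f g : C -> C) (p : {poly C}) (z w x : C) (r e M : R).

Lemma poly_lipschitz p r : exists2 K, 0 < K & forall z w, modc z <= r -> modc w <= r ->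
  modc (p.[z] - p.[w]) <= K * modc (z - w).
Proof.
elim/poly_ind: p => [|p c [K K0 pK]].
  by exists 1 => // z w _ _; rewrite !horner0 subrr modc0 mul1r modc_ge0.
have [M M0 pM] := poly_disk_bounded p r.
exists (M + K * `|r|); first by rewrite ltr_pwDl// mulr_ge0// ltW.
move=> z w zr wr; rewrite !hornerE.
have -> : p.[z] * z + c - (p.[w] * w + c) = p.[z] * (z - w) + (p.[z] - p.[w]) * w by ring.
rewrite (le_trans (modcD _ _))// !modcM mulrDl lerD//.
  by rewrite ler_wpM2r ?modc_ge0// pM.
rewrite mulrAC ler_pM ?modc_ge0//; first exact: pK.
by rewrite (le_trans wr)// ler_norm.
Qed.

Lemma entire_continuous f z e : entire f -> 0 < e ->
  exists2 d, 0 < d & forall w, modc (w - z) <= d -> modc (f w - f z) <= e.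
Proof.
move=> ef e0; have e30 : 0 < e / 3 by rewrite divr_gt0.
have [p fp] := ef (modc z + 1) _ e30.
have [K K0 pK] := poly_lipschitz p (modc z + 1).
exists (Num.min 1 (e / 3 / K)); first by rewrite lt_min ltr01 divr_gt0.
move=> w; rewrite le_min => /andP[wz1 wzK].
have zr : modc z <= modc z + 1 by rewrite lerDl.
have wr : modc w <= modc z + 1 by rewrite -(subrK z w) (le_trans (modcD _ _))// addrC lerD2l.
have -> : f w - f z = (f w - p.[w]) + (p.[w] - p.[z]) - (f z - p.[z]) by ring.
rewrite (le_trans (modcB _ _))// (_ : e = e / 3 + e / 3 + e / 3); last by field.
rewrite lerD ?fp// (le_trans (modcD _ _))// lerD ?fp// (le_trans (pK _ _ wr zr))//.
by rewrite mulrC -ler_pdivlMr.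
Qed.

(** The minimum is taken over the square of half-side [r], compact as a product of segments. This
    square contains the disk of radius [r] and lies in that of radius [2 * r], where [f] does not
    vanish. *)
Lemma entire_min f r : entire f -> 0 < r -> (forall z, modc z <= 2 * r -> f z != 0) ->
  exists2 d, 0 < d & forall z, modc z <= r -> d <= modc (f z).
Proof.
move=> ef r0 fN0; pose F (v : R * R) : R := modc (f (v.1 +i* v.2)).
pose K : set (R * R) := `[(- r), r]%classic `*` `[(- r), r]%classic.
have K0 : K !=set0.
  by exists (0, 0); split; rewrite /= in_itv/= oppr_le0 ltW.
have cK : compact K by apply: compact_setX; exact: segment_compact.
have cF : continuous F.
  move=> [x y]; apply/cvgrPdist_le => e e0.
  have [d d0 fd] := entire_continuous (x +i* y) ef e0.
  have d20 : 0 < d / 2 by rewrite divr_gt0.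
  exists (ball x (d / 2), ball y (d / 2)) => /=.
    by split; exact: nbhsx_ballx.
  move=> [u v] [/= /ltW xu /ltW yv]; rewrite /F /=.
  have fuv : modc (f (u +i* v) - f (x +i* y)) <= e.
    apply: fd; rewrite (le_trans (modc_ReIm _))//= (splitr d) lerD//.
      by rewrite distrC.
    by rewrite distrC.
  rewrite ler_norml; apply/andP; split.
    rewrite lerNl opprB (le_trans (modc_tri _ _))//.
  by rewrite (le_trans (modc_tri _ _))// modcC.
have [[x y]] := compact_EVT_min K0 cK (continuous_subspaceT cF).
rewrite inE => -[xK yK] Fmin.
exists (F (x, y)).
  rewrite /F modc_gt0 fN0// (le_trans (modc_ReIm _))//= mulr_natl mulr2n lerD//.
    by move: xK; rewrite /= in_itv/= ler_norml.
  by move: yK; rewrite /= in_itv/= ler_norml.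
move=> [u v] zr; have := Fmin (u, v); apply; rewrite inE; split => /=; rewrite in_itv/= -ler_norml.
  exact: le_trans (Re_modc (u +i* v)) zr.
exact: le_trans (Im_modc (u +i* v)) zr.
Qed.

Lemma ln_le_sub1 (y : R) : 0 < y -> ln y <= y - 1.
Proof. by move=> y0; rewrite -{1}(subrK 1 y) addrC le_ln1Dx//; lra. Qed.

Lemma ln_modc_close z w e : 0 <= e <= 2^-1 -> z != 0 -> modc (w - z) <= e * modc z ->
  `|ln (modc z) - ln (modc w)| <= 2 * e.
Proof.
move=> /andP[e0 e1] z0 zw; have mz : 0 < modc z by rewrite modc_gt0.
have h1 : modc w <= (1 + e) * modc z.
  by rewrite -(subrK z w) (le_trans (modcD _ _))//; lra.
have h2 : (1 - e) * modc z <= modc w.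
  have := modc_tri z w; rewrite modcC; lra.
have mw : 0 < modc w by apply: lt_le_trans h2; rewrite mulr_gt0//; lra.
have l1 := @ln_le_sub1 (modc w / modc z) (divr_gt0 mw mz).
have l2 := @ln_le_sub1 (modc z / modc w) (divr_gt0 mz mw).
rewrite !ln_div// in l1 l2.
have h3 : modc w / modc z <= 1 + e by rewrite ler_pdivrMr.
have h4 : modc z / modc w <= 1 + 2 * e by rewrite ler_pdivrMr//; nra.
by rewrite ler_norml; apply/andP; split; lra.
Qed.

(* The mean value theorem along the segment from 0 to [x] replaces the complex
   logarithm. *)
Lemma ln_modc_1B x (k : R) n : modc x <= k -> k < 1 ->
  `|ln (modc (1 - x)) + complex.Re (\sum_(m < n) x ^+ m.+1 / m.+1%:R)| <= k ^+ n.+1 / (1 - k).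
Proof.
move=> xk k1; have k0 : 0 <= k := le_trans (modc_ge0 _) xk.
set a := complex.Re x; set b := complex.Im x.
have xE : x = a +i* b by rewrite /a /b; case: (x).
(* [Q] is the squared modulus of [1 - t * x], and [S] the real part of the partial sum of the series
   of -ln(1 - t x). As real polynomials in [t], both can be differentiated directly. *)
pose Q : {poly R} := (1 - a *: 'X) ^+ 2 + (b *: 'X) ^+ 2.
pose S : {poly R} := \sum_(m < n) (complex.Re (x ^+ m.+1) / m.+1%:R) *: 'X^(m.+1).
have QE (t : R) : Q.[t] = modc (1 - t%:C * x) ^+ 2.
  rewrite /Q !hornerE modcE sqr_sqrtr ?addr_ge0 ?sqr_ge0// xE /=; ring.
have tx (t : R) : 0 <= t <= 1 -> modc (t%:C * x) <= k.
  move=> /andP[t0 t1]; rewrite modcM modc_real ger0_norm//.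
  by rewrite (le_trans _ xk)// ler_piMl ?modc_ge0.
have m1 (t : R) : 0 <= t <= 1 -> 1 - k <= modc (1 - t%:C * x).
  by move=> /tx h; apply: le_trans (modc_tri _ _); rewrite modc1 lerB.
have Q0 (t : R) : 0 <= t <= 1 -> 0 < Q.[t].
  by move=> /m1 h; rewrite QE exprn_gt0// (lt_le_trans _ h)// subr_gt0.
pose D (t : R) := 2^-1 * ln Q.[t] + S.[t].
pose dD (t : R) := 2^-1 * (Q.[t]^-1 * (Q^`()).[t]) + (S^`()).[t].
have derD (t : R) : 0 <= t <= 1 -> is_derive t 1 D (dD t).
  move=> t01; have := Q0 _ t01 => Qt.
  have dl : is_derive t 1 (@ln R \o horner Q) (Q.[t]^-1 * (Q^`()).[t]).
    exact: (@is_derive1_comp _ _ _ _ _ _ (is_derive1_ln Qt) (is_derive_poly Q t)).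
  have := is_deriveD (is_deriveZ 2^-1 dl) (is_derive_poly S t).
  by [].
(* The derivative of [S] is a geometric sum; it cancels the logarithmic derivative up to the
   remainder of the geometric series. *)
have dDE (t : R) : 0 <= t <= 1 ->
    dD t = - complex.Re (x * (t%:C * x) ^+ n / (1 - t%:C * x)).
  move=> t01.
  have N0 : 1 - t%:C * x != 0.
    by rewrite -modc_gt0 (lt_le_trans _ (m1 _ t01))// subr_gt0.
  have S'E : (S^`()).[t] = complex.Re (x * \sum_(m < n) (t%:C * x) ^+ m).
    rewrite raddf_sum horner_sum big_distrr /= Re_sum; apply: eq_bigr => m _.
    rewrite derivZ derivXn hornerZ hornerMn hornerXn /= -[t ^+ m *+ m.+1]mulr_natr.
    rewrite mulrACA mulVf ?pnatr_eq0// mulr1.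
    rewrite exprMn -rmorphXn mulrCA -exprS /=.
    by case: (x ^+ m.+1) => u v /=; rewrite mul0r subr0 mulrC.
  have geo : \sum_(m < n) (t%:C * x) ^+ m = (1 - (t%:C * x) ^+ n) / (1 - t%:C * x).
    by apply: (mulIf N0); rewrite divfK// -[RHS]opprB subrX1 -[RHS]mulNr opprB mulrC.
  have Q'E : 2^-1 * (Q.[t]^-1 * (Q^`()).[t]) = - complex.Re (x / (1 - t%:C * x)).
    have Q'h : (Q^`()).[t] = 2 * (b ^+ 2 * t - a * (1 - t * a)).
      rewrite /Q !derivCE /= !hornerE.
      by rewrite /=; ring.
    have := Q0 _ t01; rewrite Q'h => /lt0r_neq0.
    have -> : Q.[t] = (1 - t * a) ^+ 2 + (t * b) ^+ 2 by rewrite /Q !hornerE; ring.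
    rewrite xE /= !mul0r !subr0 !addr0 !sub0r !sqrrN.
    by set q := (_ + (t * b) ^+ 2) => QN0; field.
  rewrite /dD S'E geo Q'E.
  have -> : x * ((1 - (t%:C * x) ^+ n) / (1 - t%:C * x)) =
    x / (1 - t%:C * x) - x * (t%:C * x) ^+ n / (1 - t%:C * x) by ring.
  by rewrite ReB; ring.
have Dc : {within `[0, 1]%classic, continuous D}.
  apply: derivable_within_continuous => t; rewrite in_itv /= => t01.
  by apply: ex_derive; exact: derD.
have [|c] := @MVT_segment R D dD 0 1 ler01 _ Dc.
  by move=> t; rewrite in_itv /= => /andP[t0 t1]; apply: derD; rewrite !ltW.
rewrite in_itv /= => c01; rewrite subr0 mulr1 dDE//.
have -> : D 0 = 0.
  by rewrite /D QE mul0r subr0 modc1 expr1n ln1 mulr0 add0r /S horner_sum big1// => m _; rewrite !hornerE expr0n mulr0.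
have -> : D 1 = ln (modc (1 - x)) + complex.Re (\sum_(m < n) x ^+ m.+1 / m.+1%:R).
  rewrite /D QE mul1r lnXn; last by have := m1 1; rewrite mul1r lexx ler01 => /(_ isT); lra.
  rewrite -[ln _ *+ 2]mulr_natl mulrA mulVf ?pnatr_eq0// mul1r; congr (_ + _).
  rewrite /S horner_sum Re_sum; apply: eq_bigr => m _; rewrite !hornerE expr1n mulr1.
  rewrite -(rmorph_nat (real_complex R)) -rmorphV ?unitfE ?pnatr_eq0//=.
  by case: (x ^+ m.+1) => u v /=; rewrite mulr0 subr0.
rewrite subr0 => ->; rewrite normrN (le_trans (Re_modc _))// !modcM modcV modcX exprS.
have kk : 0 < 1 - k by rewrite subr_gt0.
rewrite ler_pM ?mulr_ge0 ?invr_ge0 ?modc_ge0 ?exprn_ge0 ?modc_ge0//.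
  by rewrite ler_pM ?exprn_ge0 ?modc_ge0// lerXn2r ?nnegrE ?modc_ge0 ?tx.
by rewrite lef_pV2 ?posrE ?m1// (lt_le_trans kk (m1 _ c01)).
Qed.

(** This stands for harmonicity of [ln |f|] on the disk: instead of a holomorphic logarithm it
    supplies polynomials, to which the Borel-Caratheodory bounds apply. *)
Definition log_approx f r := forall e : R, 0 < e -> exists H : {poly C},
  forall z, modc z <= r -> `|ln (modc (f z)) - complex.Re H.[z]| <= e.

Lemma log_approxM f g r : (forall z, modc z <= r -> f z != 0) ->
  (forall z, modc z <= r -> g z != 0) ->
  log_approx f r -> log_approx g r -> log_approx (fun z => f z * g z) r.
Proof.
move=> f0 g0 lf lg e e0; have e20 : 0 < e / 2 by rewrite divr_gt0.
have [H fH] := lf _ e20; have [K gK] := lg _ e20.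
exists (H + K) => z zr; rewrite modcM lnM ?posrE ?modc_gt0 ?f0 ?g0// hornerD ReD.
rewrite opprD addrACA (le_trans (ler_normD _ _))// (splitr e) lerD ?fH ?gK//.
Qed.

Lemma log_approx_cst (c : C) r : log_approx (fun=> c) r.
Proof.
move=> e e0; exists (ln (modc c))%:C%:P => z _.
by rewrite hornerC /= subrr normr0 ltW.
Qed.

(** Up to the constant [ln |b|] this is [ln |1 - z / b|], and [|z / b|] is at most [r / |b| < 1], so
    the logarithmic series converges uniformly on the disk. *)
Lemma log_approx_linear (b : C) r : 0 <= r -> r < modc b -> log_approx (fun z => z - b) r.
Proof.
move=> r0 rb e e0; have b0 : 0 < modc b := le_lt_trans r0 rb.
have bN0 : b != 0 by rewrite -modc_gt0.
set k := r / modc b; have k0 : 0 <= k by rewrite divr_ge0// ltW.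
have k1 : k < 1 by rewrite ltr_pdivrMr// mul1r.
have [n kn] : exists n, k ^+ n.+1 / (1 - k) <= e.
  have : k ^+ n @[n --> \oo] --> (0 : R) by apply: cvg_expr; rewrite ger0_norm.
  move/cvgrPdist_le => /(_ (e * (1 - k))) [|n _ /(_ n.+1 (leqnSn n))].
    by rewrite mulr_gt0// subr_gt0.
  rewrite /= sub0r normrN ger0_norm ?exprn_ge0// => h.
  by exists n; rewrite ler_pdivrMr// subr_gt0.
exists ((ln (modc b))%:C%:P - \sum_(m < n) (b^-1 ^+ m.+1 / m.+1%:R) *: 'X^(m.+1)) => z zr.
have zb : modc (z / b) <= k by rewrite modcM modcV ler_wpM2r// invr_ge0 ltW.
have := ln_modc_1B n zb k1.
have -> : ln (modc (1 - z / b)) = ln (modc (z - b)) - ln (modc b).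
  have -> : 1 - z / b = - (z - b) / b by field.
  rewrite modcM modcN modcV lnM ?lnV ?posrE ?invr_gt0// modc_gt0 subr_eq0.
  by apply: contraTneq rb => <-; rewrite -leNgt.
rewrite hornerD hornerN hornerC ReB /= horner_sum.
under eq_bigr do rewrite exprMn -mulrA mulrC.
under [X in _ - (_ - complex.Re X)]eq_bigr do rewrite hornerZ hornerXn.
by rewrite opprB addrA addrAC => /le_trans; apply.
Qed.

Lemma log_approx_poly p r : 0 <= r -> (forall z, modc z <= r -> p.[z] != 0) ->
  log_approx (horner p) r.
Proof.
move=> r0 pN0; have [s pE] := closed_field_poly_normal p.
have c0 : lead_coef p != 0.
  rewrite lead_coef_eq0; have := pN0 0; rewrite modc0 => /(_ r0).
  by apply: contra => /eqP ->; rewrite horner0.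
have s0 b : b \in s -> r < modc b.
  move=> bs; rewrite ltNge; apply/negP => /pN0/negP; apply.
  by rewrite -/(root p b) pE rootZ// root_prod_XsubC.
rewrite pE.
rewrite (_ : horner _ = fun z => lead_coef p * zpoly s z); last first.
  apply/funext => z; rewrite hornerZ horner_prod; congr (_ * _).
  by apply: eq_bigr => b _; rewrite !hornerE.
have sN0 t z : (forall b, b \in t -> r < modc b) -> modc z <= r -> zpoly t z != 0.
  move=> tr zr; rewrite /zpoly prodf_seq_neq0; apply/allP => b /tr rb /=.
  by rewrite subr_eq0; apply: contraTneq rb => <-; rewrite -leNgt.
apply: log_approxM => //; first by move=> z; exact: sN0.
  exact: log_approx_cst.
move: s0; clear pE; elim: s => [|b s ih] sr.
  by rewrite (_ : zpoly _ = fun=> 1); [exact: log_approx_cst|apply/funext => z; rewrite /zpoly big_nil].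
rewrite (_ : zpoly _ = fun z => (z - b) * zpoly s z); last by apply/funext => z; rewrite zpoly_cons.
have sr' c : c \in s -> r < modc c by move=> cs; rewrite sr// in_cons cs orbT.
apply: log_approxM.
- move=> z zr; have := sr b (mem_head _ _); rewrite subr_eq0.
  by apply: contraTneq => <-; rewrite -leNgt.
- by move=> z; exact: sN0.
- by apply: log_approx_linear => //; rewrite sr// mem_head.
- exact: ih.
Qed.

(** On the disk [|f|] has a positive lower bound, so a polynomial that is uniformly close to [f] is
    also close in relative error. It then has no zero there either, and its logarithm of modulus is
    close to that of [f]. *)
Lemma log_approx_entire f r : entire f -> 0 < r ->
  (forall z, modc z <= 2 * r -> f z != 0) -> log_approx f r.
Proof.
move=> ef r0 fN0 e e0; have [d d0 fd] := entire_min ef r0 fN0.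
(* A relative error [t] of at most 1/2 costs [2 * t] in the logarithm, here at most half of [e]. *)
pose t := Num.min (2^-1) (e / 4).
have t0 : 0 < t by rewrite lt_min invr_gt0 ltr0n divr_gt0.
have [t1 te] : t <= 2^-1 /\ t <= e / 4.
  by split; rewrite /t ge_min lexx ?orbT.
have [p fp] := ef r (t * d) (mulr_gt0 t0 d0).
have r2 z : modc z <= r -> modc z <= 2 * r.
  by move/le_trans; apply; rewrite ler_peMl ?(ltW r0)// ler1n.
have fpr z : modc z <= r -> modc (p.[z] - f z) <= t * modc (f z).
  by move=> zr; rewrite modcC (le_trans (fp _ zr))// ler_pM2l// fd.
have pN0 z : modc z <= r -> p.[z] != 0.
  move=> zr; have := fpr _ zr; apply: contraTneq => ->.
  have := fd _ zr; rewrite sub0r modcN -ltNge; nra.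
have e20 : 0 < e / 2 by rewrite divr_gt0.
have [H pH] := log_approx_poly (ltW r0) pN0 e20.
exists H => z zr.
rewrite -(subrK (ln (modc p.[z])) (ln (modc (f z)))) -addrA (le_trans (ler_normD _ _))//.
rewrite (splitr e) lerD ?pH// (le_trans (@ln_modc_close _ _ t _ _ (fpr _ zr)))//.
- by rewrite ltW.
- by rewrite fN0// r2.
- by move: te; lra.
Qed.

(** Borel-Caratheodory for the polynomial whose real part approximates [ln |f|]; [c] is its linear
    coefficient. The condition [1 <= modc (f 0)] keeps the real part at 0 above [- e], whence
    [ln M + 2 * e]. *)
Lemma log_modulus_linear f r M e : entire f -> 0 < r ->
  (forall z, modc z <= 2 * r -> f z != 0) -> (forall z, modc z <= r -> modc (f z) <= M) ->
  1 <= modc (f 0) -> 0 < e ->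
  exists c : C, forall z, modc z <= r / 2 ->
    `|ln (modc (f z)) - ln (modc (f 0)) - complex.Re (c * z)| <=
      4 * (ln M + 2 * e) * (modc z / r) ^+ 2 + 2 * e.
Proof.
move=> ef r0 fN0 fM f01 e0; have [H fH] := log_approx_entire ef r0 fN0 e0.
exists H`_1 => z zr.
have zr1 : modc z <= r by rewrite (le_trans zr)// ler_pdivrMr// ler_peMr ?(ltW r0)// ler1n.
have f0r : modc (0 : C) <= r by rewrite modc0 ltW.
have HA w : modc w = r -> complex.Re H.[w] <= ln M + e.
  move=> wr; have wr1 : modc w <= r by rewrite wr.
  have := fH _ wr1; rewrite ler_norml => /andP[h _].
  have : ln (modc (f w)) <= ln M.
    rewrite ler_ln ?posrE ?fM//; last by rewrite (lt_le_trans ltr01)// (le_trans f01)// fM.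
    by rewrite modc_gt0 fN0// wr ler_peMl ?(ltW r0)// ler1n.
  lra.
have := borel_caratheodory_linear r0 HA zr.
have h0 : 0 <= ln (modc (f 0)) by rewrite ln_ge0.
have := fH _ f0r; rewrite horner_coef0 ler_norml => /andP[H1 H2].
have := fH _ zr1; rewrite ler_norml => /andP[H3 H4].
rewrite ler_norml => /andP[H5 H6].
have t0 : 0 <= (modc z / r) ^+ 2 by rewrite sqr_ge0.
have : 4 * (ln M + e - complex.Re H`_0) * (modc z / r) ^+ 2 <= 4 * (ln M + 2 * e) * (modc z / r) ^+ 2.
  by rewrite ler_wpM2r// ler_pM2l//; lra.
by move=> h; rewrite ler_norml; apply/andP; split; lra.
Qed.

End LogModulus.

(** * Quotients of entire functions with the same zeros *)

Section EntireRatio.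
Context {R : realType}.
Local Notation C := R[i].
Implicit Types (f g : C -> C) (z : C) (r e M : R).

(* Replacing each zero by its reflection across a circle does not change
   [f / g], and turns [ln |f|] and [ln |g|] into harmonic functions on the disk. *)
Lemma ratio_almost_linear f g r M e : entire f -> entire g -> 0 < r -> 0 < e ->
  f 0 = 1 -> g 0 = 1 -> zeros_below f g -> zeros_below g f ->
  (forall z, modc z <= 4 * r -> modc (f z) <= M) ->
  (forall z, modc z <= 4 * r -> modc (g z) <= M) ->
  exists c : C, forall z, modc z <= r / 2 -> f z != 0 -> g z != 0 ->
    `|ln (modc (f z)) - ln (modc (g z)) - complex.Re (c * z)| <=
      8 * (ln (2 * M) + 2 * e) * (modc z / r) ^+ 2 + 4 * e.
Proof.
move=> ef eg r0 e0 f0 g0 fg gf fM gM.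
have r20 : 0 < 2 * r by rewrite mulr_gt0.
have f0N : f 0 != 0 by rewrite f0 oner_eq0.
(* The linear estimate on radius [r] requires nonvanishing up to [2 * r], so zeros are removed
   there. They are reflected across the circle of radius [4 * r], which is why [M] bounds both
   functions up to that radius. *)
have [l [f1 [g1 [[ef1 eg1 lr fE gE] f1N0]]]] := deflate_pair ef eg f0N r20 fg.
have g1N0 z : modc z <= 2 * r -> g1 z != 0.
  by move=> /f1N0; apply: contra => /eqP gz0; apply/eqP/(gf _ _ _ eg1 ef1 gE fE).
have r4 : 2 * (2 * r) = 4 * r by ring.
rewrite -r4 in fM gM.
have [F2M F01] := deflated_bounds ef1 r20 lr fE fM.
have [G2M G01] := deflated_bounds eg1 r20 lr gE gM.
pose B := blaschke (2 * r) l.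
have BN0 z : modc z <= 2 * r -> B z != 0 by move=> zr; exact: blaschke_neq0.
have r2 z : modc z <= r -> modc z <= 2 * r.
  by move/le_trans; apply; rewrite ler_peMl ?(ltW r0)// ler1n.
have pow1 : (1 : R) <= 2 ^+ size l by rewrite exprn_ege1// ler1n.
have eB := @entire_blaschke R (2 * r) l.
have [|||c cP] := @log_modulus_linear R (fun z => f1 z * B z) r (2 * M) e (entireM ef1 eB) r0 _ _ _ e0.
- by move=> z zr; rewrite mulf_neq0 ?f1N0 ?BN0.
- by move=> z /r2; exact: F2M.
- by rewrite (le_trans _ F01)// f0 modc1 mul1r.
have [|||d dP] := @log_modulus_linear R (fun z => g1 z * B z) r (2 * M) e (entireM eg1 eB) r0 _ _ _ e0.
- by move=> z zr; rewrite mulf_neq0 ?g1N0 ?BN0.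
- by move=> z /r2; exact: G2M.
- by rewrite (le_trans _ G01)// g0 modc1 mul1r.
exists (c - d) => z zr fz gz.
have zr2 : modc z <= 2 * r.
  by apply: r2; rewrite (le_trans zr)// ler_pdivrMr// ler_peMr ?(ltW r0)// ler1n.
have lnE w : modc w <= 2 * r -> f w != 0 -> g w != 0 ->
    ln (modc (f1 w * B w)) - ln (modc (g1 w * B w)) = ln (modc (f w)) - ln (modc (g w)).
  move=> wr fw gw; have Pw : zpoly l w != 0.
    by apply: contraNneq fw => Pw; rewrite fE Pw mul0r.
  rewrite fE gE !modcM !lnM ?posrE ?modc_gt0 ?f1N0 ?g1N0 ?BN0//.
  by ring.
have E0 := lnE 0 _ f0N; rewrite f0 g0 modc0 oner_eq0 subrr in E0.
have {}E0 := E0 (ltW r20) isT.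
have Ez := lnE z zr2 fz gz.
rewrite -Ez mulrBl ReB.
have := cP z zr; have := dP z zr; rewrite !ler_norml => /andP[? ?] /andP[? ?].
by apply/andP; split; lra.
Qed.

(** Encoded as [ln |f| = o(r^2)], a consequence of order below 2 and the form in which the growth
    meets the quadratic remainder. *)
Definition order_below_two f := forall e : R, 0 < e -> exists r0 : R,
  forall r, r0 <= r -> forall z, modc z <= r -> modc (f z) <= expR (e * r ^+ 2).

(** As [r] grows and [e] shrinks, the quadratic remainder disappears. The slope obtained on a disk
    varies with the disk, so it is eliminated by comparing the points [x] and 1. Positivity of [u]
    and [v] allows both values to be recovered from their moduli. *)
Lemma entire_ratio_expR f g (u v : R -> R) : entire f -> entire g ->
  f 0 = 1 -> g 0 = 1 -> zeros_below f g -> zeros_below g f ->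
  order_below_two f -> order_below_two g ->
  (forall x, 0 < u x) -> (forall x, 0 < v x) ->
  (forall x : R, f x%:C = (u x)%:C) -> (forall x : R, g x%:C = (v x)%:C) ->
  exists c : R, forall x, u x = expR (c * x) * v x.
Proof.
move=> ef eg f0 g0 fg gf fo go u0 v0 fu gv.
pose k x := ln (u x) - ln (v x).
suff kE x : k x = k 1 * x.
  exists (k 1) => x; rewrite -kE /k expRD expRN !lnK ?posrE//.
  by rewrite divfK ?gt_eqF.
suff : forall e, 0 < e < 1 ->
    `|k x - k 1 * x| <= e * (200 * (x ^+ 2 + 1) + `|x| * 400).
  set K := (_ + `|x| * 400) => h; have K0 : 0 < K.
    by rewrite /K; have := normr_ge0 x; have := sqr_ge0 x; lra.
  apply/eqP; rewrite -subr_eq0 -normr_eq0 eq_le normr_ge0 andbT.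
  rewrite leNgt; apply/negP => k0.
  set y := `|_| in k0 h.
  have yK : 0 < Num.min (2^-1) (y / (2 * K)) by rewrite lt_min invr_gt0 ltr0n divr_gt0// mulr_gt0.
  have := h (Num.min (2^-1) (y / (2 * K))).
  rewrite yK (le_lt_trans (_ : _ <= 2^-1))/=; last 2 first.
    by rewrite ge_min lexx.
    by rewrite invf_lt1// ltr1n.
  move=> /(_ isT); apply/negP; rewrite -ltNge.
  apply: (@le_lt_trans _ _ (y / (2 * K) * K)); first by rewrite ler_pM2r// ge_min lexx orbT.
  rewrite invfM mulrA divfK ?gt_eqF//; lra.
move=> e /andP[e0 e1].
have [rf rfP] := fo e e0; have [rg rgP] := go e e0.
(* [rf] and [rg] make the growth bounds available, [e^-1] makes [(y / r)^2] at most [e * y^2], and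
   the last entry puts both [x] and 1 in the half disk. *)
pose r := Num.max (Num.max rf rg) (Num.max (e^-1) (2 * `|x| + 2)).
have [rrf rrg er xr] : [/\ rf <= r, rg <= r, e^-1 <= r & 2 * `|x| + 2 <= r].
  by rewrite /r !le_max !lexx ?orbT.
have r0 : 0 < r by apply: lt_le_trans er; rewrite invr_gt0.
have r1 : 1 <= r by apply: le_trans er; rewrite invf_ge1// ltW.
have r4 h : h <= r -> h <= 4 * r by move/le_trans; apply; lra.
have [|c cP] := ratio_almost_linear ef eg r0 e0 f0 g0 fg gf (rfP _ (r4 _ rrf)).
  exact: (rgP _ (r4 _ rrg)).
have main y : `|y| <= r / 2 -> `|k y - complex.Re c * y| <= 200 * e * (y ^+ 2 + 1).
  move=> yr; have := cP y%:C; rewrite modc_real fu gv => /(_ yr).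
  rewrite -!modc_gt0 !modc_real (gtr0_norm (u0 y)) (gtr0_norm (v0 y)) => /(_ (u0 y) (v0 y)).
  have -> : complex.Re (c * y%:C) = complex.Re c * y by case: (c) => a b /=; ring.
  rewrite -/(k y) => /le_trans; apply.
  rewrite lnM ?posrE ?expR_gt0// expRK.
  have l2 : ln 2 <= 1 :> R by rewrite (le_trans (ln_le_sub1 _))//; lra.
  rewrite expr_div_n real_normK ?num_real//.
  have y2 : 0 <= y ^+ 2 by rewrite sqr_ge0.
  have r2i : y ^+ 2 / r ^+ 2 <= e * y ^+ 2.
    rewrite mulrC ler_wpM2r// -[leRHS]invrK lef_pV2 ?posrE ?invr_gt0 ?exprn_gt0//.
    by rewrite (le_trans er)// expr2 ler_peMl// ltW.
  (* 128 is [8 * 4^2], from the growth bound at radius [4 * r], and 3 bounds [ln 2 + 2 * e]. The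
     total fits under 200. *)
  apply: (@le_trans _ _ (8 * (3 * (y ^+ 2 / r ^+ 2)) + 128 * e * y ^+ 2 + 4 * e)).
    have -> : 8 * (ln 2 + e * (4 * r) ^+ 2 + 2 * e) * (y ^+ 2 / r ^+ 2) =
      8 * ((ln 2 + 2 * e) * (y ^+ 2 / r ^+ 2)) + 128 * e * y ^+ 2.
      by field; rewrite gt_eqF.
    rewrite lerD2r lerD2r ler_pM2l// ler_wpM2r ?divr_ge0 ?sqr_ge0//.
    by lra.
  by have := mulr_ge0 (ltW e0) y2; lra.
have hx : `|x| <= r / 2 by rewrite ler_pdivlMr//; have := normr_ge0 x; lra.
have h1 : `|1 : R| <= r / 2 by rewrite normr1 ler_pdivlMr//; have := normr_ge0 x; lra.
have := main x hx; have := main 1 h1; rewrite mulr1 expr1n => m1 mx.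
have -> : k x - k 1 * x = (k x - complex.Re c * x) - (k 1 - complex.Re c) * x by ring.
rewrite (le_trans (ler_normB _ _))// normrM.
have := ler_wpM2r (normr_ge0 x) m1; move: mx; lra.
Qed.

End EntireRatio.

(** * Uniqueness of Fourier transforms *)

Section BoundedIntegrals.
Context d (T : measurableType d) (R : realType) (mu : {measure set T -> \bar R}).
Hypothesis mu_fin : (mu setT < +oo)%E.
Implicit Types (f g : T -> R) (M : R).

Lemma bounded_integrable f M : measurable_fun setT f -> (forall x, `|f x| <= M) ->
  mu.-integrable setT (EFin \o f).
Proof.
move=> mf fM; apply: measurable_bounded_integrable => //.
exists M; split; first exact: num_real.
by move=> y My x _ /=; exact: le_trans (fM x) (ltW My).
Qed.

Lemma dominated_cvg_Rintegral (f_ : nat -> T -> R) f g :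
  (forall n, measurable_fun setT (f_ n)) -> (forall n x, `|f_ n x| <= g x) ->
  mu.-integrable setT (EFin \o g) -> (forall x, f_ n x @[n --> \oo] --> f x) ->
  (\int[mu]_x f_ n x) @[n --> \oo] --> \int[mu]_x f x.
Proof.
move=> mf fg ig ff.
have mlim : measurable_fun setT f by apply: measurable_fun_cvg => // x _; exact: ff.
have cvgE : \forall x \ae mu, setT x -> (EFin \o f_ n) x @[n --> \oo] --> (EFin \o f) x.
  by apply: aeW => x _; apply: cvg_EFin; [near=> n|exact: ff].
have domE : \forall x \ae mu, forall n, setT x -> (`|(EFin \o f_ n) x| <= (EFin \o g) x)%E.
  by apply: aeW => x n _; rewrite /= lee_fin.
have mfE n : measurable_fun setT (EFin \o f_ n) by exact/measurable_EFinP.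
have mlE : measurable_fun setT (EFin \o f) by exact/measurable_EFinP.
have [ilim _ cvgI] := dominated_convergence measurableT mfE mlE cvgE ig domE.
have fin : (\int[mu]_x (f x)%:E)%E \is a fin_num by exact: integrable_fin_num.
apply: (@fine_cvg R nat \oo _ (fun n => \int[mu]_x (f_ n x)%:E)%E).
by rewrite fineK.
Unshelve. all: by end_near.
Qed.

Lemma bounded_cvg_Rintegral (f_ : nat -> T -> R) f M :
  (forall n, measurable_fun setT (f_ n)) -> (forall n x, `|f_ n x| <= M) ->
  (forall x, f_ n x @[n --> \oo] --> f x) ->
  (\int[mu]_x f_ n x) @[n --> \oo] --> \int[mu]_x f x.
Proof.
move=> mf fM; apply: (@dominated_cvg_Rintegral _ _ (cst M)) => //.
apply: (@bounded_integrable _ `|M|); first exact: measurable_cst.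
by [].
Qed.

End BoundedIntegrals.

Section FourierUniqueness.
Context d (T : measurableType d) (R : realType) (J : finType) (xi : J -> T -> R).
Variables mu nu : {measure set T -> \bar R}.
Hypothesis mxi : forall j, measurable_fun setT (xi j).
Hypothesis mu_fin : (mu setT < +oo)%E.
Hypothesis nu_fin : (nu setT < +oo)%E.
Implicit Types (f g u v : T -> R) (t : J -> R) (a c e s y M N : R).

Definition phase t x : R := \sum_j t j * xi j x.

Lemma measurable_phase t c : measurable_fun setT (fun x => phase t x + c).
Proof.
apply: measurable_funD => //.
rewrite /phase; apply: measurable_sum => j.
by apply: measurable_funM.
Qed.

Lemma measurable_cos_phase t c : measurable_fun setT (fun x => cos (phase t x + c)).
Proof.
apply: (measurableT_comp (f := cos)); last exact: measurable_phase.
by apply: continuous_measurable_fun; exact: continuous_cos.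
Qed.

Lemma phaseD t (s : J -> R) x : phase (fun j => t j + s j) x = phase t x + phase s x.
Proof. by rewrite /phase -big_split /=; apply: eq_bigr => j _; rewrite mulrDl. Qed.

Lemma phase1 j (s : R) x : phase (fun i => if i == j then s else 0) x = s * xi j x.
Proof.
rewrite /phase (bigD1 j)//= eqxx big1 ?addr0// => i /negPf ->.
by rewrite mul0r.
Qed.

(** The signed measures of densities [f] with respect to [mu] and [nu] have the same Fourier
    transform. An arbitrary shift [c] covers cosine and sine at once and keeps the integrals
    real. *)
Definition fourier_agree f := [/\ measurable_fun setT f, exists M, forall x, `|f x| <= M &
  forall t c, \int[mu]_x (f x * cos (phase t x + c)) = \int[nu]_x (f x * cos (phase t x + c))].

(* These multipliers form an algebra, closed under bounded pointwise limits. *)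
Definition agree_multiplier u := forall f, fourier_agree f -> fourier_agree (fun x => f x * u x).

Lemma integrable_agree (m : {measure set T -> \bar R}) f t c : (m setT < +oo)%E ->
  fourier_agree f -> m.-integrable setT (EFin \o (fun x => f x * cos (phase t x + c))).
Proof.
move=> mfin [mf [M fM] _]; apply: (bounded_integrable mfin (M := M)).
  by apply: measurable_funM => //; exact: measurable_cos_phase.
move=> x; rewrite normrM (le_trans _ (fM x))// ler_piMr// ler_norml.
by rewrite cos_geN1 cos_le1.
Qed.

Lemma fourier_agreeD f g : fourier_agree f -> fourier_agree g -> fourier_agree (fun x => f x + g x).
Proof.
move=> ff fg; have [mf [M fM] fE] := ff; have [mg [N gN] gE] := fg; split.
- exact: measurable_funD.
- by exists (M + N) => x; rewrite (le_trans (ler_normD _ _))// lerD.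
- move=> t c; under eq_Rintegral do rewrite mulrDl.
  under [RHS]eq_Rintegral do rewrite mulrDl.
  by rewrite !RintegralD ?fE ?gE//; exact: integrable_agree.
Qed.

Lemma fourier_agreeZ f (k : R) : fourier_agree f -> fourier_agree (fun x => f x * k).
Proof.
move=> ff; have [mf [M fM] fE] := ff; split.
- by apply: measurable_funM.
- by exists (M * `|k|) => x; rewrite normrM ler_wpM2r.
- move=> t c; under eq_Rintegral do rewrite mulrAC.
  under [RHS]eq_Rintegral do rewrite mulrAC.
  by rewrite !RintegralZr ?fE//; exact: integrable_agree.
Qed.

Lemma agree_multiplier_cst (k : R) : agree_multiplier (fun=> k).
Proof. by move=> f; exact: fourier_agreeZ. Qed.

Lemma agree_multiplierD u v : agree_multiplier u -> agree_multiplier v ->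
  agree_multiplier (fun x => u x + v x).
Proof.
move=> mu_ mv f ff; under eq_fun do rewrite mulrDr.
by apply: fourier_agreeD; [exact: mu_|exact: mv].
Qed.

Lemma agree_multiplierM u v : agree_multiplier u -> agree_multiplier v ->
  agree_multiplier (fun x => u x * v x).
Proof. by move=> mu_ mv f ff; under eq_fun do rewrite mulrA; exact/mv/mu_. Qed.

(** The product formula rewrites sine times cosine as two shifted cosines whose frequencies differ
    from [t] in coordinate [j] only; agreement at all frequencies then applies. *)
Lemma agree_multiplier_sin j (s e : R) : agree_multiplier (fun x => sin (s * xi j x + e)).
Proof.
move=> f ff; have [mf [M fM] fE] := ff.
have msin : measurable_fun setT (fun x => sin (s * xi j x + e)).
  under eq_fun do rewrite -phase1 -cosBpihalf -addrA.
  exact: measurable_cos_phase.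
have b1 (y : R) : `|sin y| <= 1 by rewrite ler_norml sin_geN1 sin_le1.
split.
- exact: measurable_funM.
- by exists M => x; rewrite normrM (le_trans _ (fM x))// ler_piMr.
move=> t c; pose tp i := t i + (if i == j then s else 0).
pose tm i := t i + (if i == j then - s else 0).
have E x : f x * sin (s * xi j x + e) * cos (phase t x + c) =
    f x * cos (phase tp x + (c + e - pi / 2)) * 2^-1 +
    f x * cos (phase tm x + (c - e + pi / 2)) * 2^-1.
  rewrite !phaseD !phase1 -cosBpihalf.
  set a := phase t x + c; set b := s * xi j x + e - pi / 2.
  rewrite (_ : phase t x + s * xi j x + (c + e - pi / 2) = a + b); last by rewrite /a /b; ring.
  rewrite (_ : phase t x + - s * xi j x + (c - e + pi / 2) = a - b); last by rewrite /a /b; ring.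
  by rewrite cosD cosB; field.
under eq_Rintegral do rewrite E.
under [RHS]eq_Rintegral do rewrite E.
have iZ (m : {measure set T -> \bar R}) t' (c' : R) : (m setT < +oo)%E ->
    m.-integrable setT (EFin \o (fun x => f x * cos (phase t' x + c') * 2^-1)).
  move=> mfin; apply: (bounded_integrable mfin (M := M)).
    apply: measurable_funM => //.
    by apply: measurable_funM => //; exact: measurable_cos_phase.
  move=> x; rewrite !normrM (le_trans _ (fM x))// -mulrA ler_piMr// mulr_ile1//.
    by rewrite ler_norml cos_geN1 cos_le1.
  by rewrite gtr0_norm ?invr_gt0// invf_le1// ler1n.
rewrite !RintegralD//; try exact: iZ.
by rewrite !RintegralZr ?fE//; exact: integrable_agree.
Qed.

Lemma agree_multiplier_cvg (u : nat -> T -> R) v M :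
  (forall n, agree_multiplier (u n)) -> (forall n x, `|u n x| <= M) ->
  (forall x, u n x @[n --> \oo] --> v x) -> agree_multiplier v.
Proof.
move=> mu_ uM uv f ff; have [mf [N fN] fE] := ff.
have fu x : f x * u n x @[n --> \oo] --> f x * v x by apply: cvgMr; exact: uv.
have mfu n : measurable_fun setT (fun x => f x * u n x) by have [] := mu_ n f ff.
have N0 : 0 <= N by rewrite (le_trans _ (fN point)).
have bfu n x : `|f x * u n x| <= N * M by rewrite normrM ler_pM.
split.
- by apply: (@measurable_fun_cvg _ _ _ _ (fun n x => f x * u n x)) => // x _; exact: fu.
- exists (N * M) => x.
  have : `|f x * u n x| @[n --> \oo] --> `|f x * v x| by apply: cvg_norm; exact: fu.
  move=> h; apply: (cvgr_to_le h); near=> n; exact: bfu.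
move=> t c.
have lim (m : {measure set T -> \bar R}) : (m setT < +oo)%E ->
    (\int[m]_x (f x * u n x * cos (phase t x + c))) @[n --> \oo] -->
    \int[m]_x (f x * v x * cos (phase t x + c)).
  move=> mfin; apply: (bounded_cvg_Rintegral mfin (M := N * M)).
  - by move=> n; apply: measurable_funM => //; exact: measurable_cos_phase.
  - move=> n x; rewrite normrM (le_trans _ (bfu n x))// ler_piMr// ler_norml.
    by rewrite cos_geN1 cos_le1.
  - by move=> x; apply: cvgMl; exact: fu.
have h1 := lim _ mu_fin; have h2 := lim _ nu_fin.
apply: (cvg_unique _ h1) => //.
rewrite (_ : (fun n => _) = fun n => \int[nu]_x (f x * u n x * cos (phase t x + c)))//.
by apply/funext => n; have [_ _ ->] := mu_ n f ff.
Unshelve. all: by end_near.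
Qed.

(* Polynomials in [y] that map [-1, 1] to itself and converge there pointwise to
   the sign. *)
Fixpoint sign_iter (k : nat) (y : R) : R :=
  if k is k'.+1 then (3 * sign_iter k' y - sign_iter k' y ^+ 3) / 2 else y.

Lemma sign_iterN k y : sign_iter k (- y) = - sign_iter k y.
Proof. by elim: k => //= k ->; field. Qed.

(** One step takes [1 - s] to [(1 - s)^2 * (2 + s) / 2]. The iterates stay above [y], so the
    distance to 1 shrinks each time by a factor of at most [1 - y / 2]. *)
Lemma sign_iter_ge k y : 0 < y <= 1 ->
  y <= sign_iter k y <= 1 /\ 1 - sign_iter k y <= (1 - y / 2) ^+ k.
Proof.
move=> /andP[y0 y1]; elim: k => [|k [/andP[yk k1] kp]] /=.
  by rewrite lexx y1 expr0; split=> //; lra.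
set s := sign_iter k y in yk k1 kp *.
have -> : (3 * s - s ^+ 3) / 2 = s + s * (1 - s) * (1 + s) / 2 by field.
have h0 : 0 <= s * (1 - s) * (1 + s) / 2.
  by rewrite divr_ge0// mulr_ge0 ?mulr_ge0//; lra.
split; first apply/andP; first split; first lra.
  have : 0 <= (1 - s) ^+ 2 * (2 + s) by rewrite mulr_ge0 ?sqr_ge0//; lra.
  by lra.
rewrite exprS.
have -> : 1 - (s + s * (1 - s) * (1 + s) / 2) = ((1 - s) * (2 + s) / 2) * (1 - s) by field.
rewrite ler_pM//; try lra.
  by rewrite divr_ge0// mulr_ge0//; lra.
have : 0 <= s ^+ 2 by rewrite sqr_ge0.
by lra.
Qed.

Lemma sign_iter_cvg y : `|y| <= 1 ->
  (forall k, `|sign_iter k y| <= 1) /\ sign_iter k y @[k --> \oo] --> Num.sg y.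
Proof.
have pos (z : R) : 0 < z <= 1 ->
    (forall k, `|sign_iter k z| <= 1) /\ sign_iter k z @[k --> \oo] --> (1 : R).
  move=> z01; have /andP[z0 z1] := z01; split.
    move=> k; have [/andP[h1 h2] _] := sign_iter_ge k z01.
    by rewrite ler_norml h2 andbT; lra.
  apply: (@squeeze_cvgr _ _ _ _ (fun k => 1 - (1 - z / 2) ^+ k) (fun=> 1)).
  - near=> k; have [/andP[h1 h2] h3] := sign_iter_ge k z01.
    by rewrite h2 andbT; lra.
  - rewrite -[X in _ --> X]subr0; apply: cvgB; first exact: cvg_cst.
    by apply: cvg_expr; rewrite ger0_norm; lra.
  - exact: cvg_cst.
rewrite ler_norml => /andP[yN1 y1].
have [y0|y0|->] := ltrgt0P y.
- by rewrite gtr0_sg//; apply: pos; rewrite y0.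
- have [|h1 h2] := pos (- y); first by rewrite oppr_gt0 y0 lerNl.
  split; first by move=> k; have := h1 k; rewrite sign_iterN normrN.
  rewrite ltr0_sg// (_ : sign_iter ^~ y = fun k => - sign_iter k (- y)); first exact: cvgN.
  by apply/funext => k; rewrite sign_iterN opprK.
- have E k : sign_iter k 0 = 0 by elim: k => //= k ->; rewrite expr0n mulr0 subrr mul0r.
  split; first by move=> k; rewrite E normr0.
  by under eq_fun do rewrite E; rewrite sgr0; exact: cvg_cst.
Unshelve. all: by end_near.
Qed.

Lemma agree_multiplier_sign_sin j s e :
  agree_multiplier (fun x => Num.sg (sin (s * xi j x + e))).
Proof.
have b1 (y : R) : `|sin y| <= 1 by rewrite ler_norml sin_geN1 sin_le1.
apply: (@agree_multiplier_cvg (fun k x => sign_iter k (sin (s * xi j x + e))) _ 1).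
- elim=> [|k ih] /=; first exact: agree_multiplier_sin.
  apply: agree_multiplierM; last exact: agree_multiplier_cst.
  apply: agree_multiplierD.
    by apply: agree_multiplierM => //; exact: agree_multiplier_cst.
  under eq_fun do rewrite -mulN1r !exprS expr0 mulr1.
  apply: agree_multiplierM; first exact: agree_multiplier_cst.
  by do 2! apply: agree_multiplierM => //.
- by move=> k x; have [] := sign_iter_cvg (b1 (s * xi j x + e)).
- by move=> x; have [] := sign_iter_cvg (b1 (s * xi j x + e)).
Qed.

(** Stretching removes the periodicity: once [n + 1] exceeds [|xi j x - a|], the argument of the
    sine lies in (-pi, pi), where the sine has the sign of its argument. *)
Lemma agree_multiplier_sign j a : agree_multiplier (fun x => Num.sg (xi j x - a)).
Proof.
apply: (@agree_multiplier_cvg (fun n x => Num.sg (sin (n.+1%:R^-1 * xi j x + (- (n.+1%:R^-1 * a))))) _ 1).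
- by move=> n; exact: agree_multiplier_sign_sin.
- by move=> n x; rewrite normr_sg; case: (_ != 0); rewrite ?ler01.
move=> x; apply: cvg_near_cst; exists (Num.truncn `|xi j x - a|) => // n /= nx.
rewrite -mulrBr; set y := xi j x - a in nx *.
have yn : `|y| < n.+1%:R by rewrite (lt_le_trans (truncnS_gt _))// ler_nat ltnS.
have n0 : 0 < n.+1%:R^-1 :> R by rewrite invr_gt0.
have ypi (z : R) : 0 < z -> `|z| < n.+1%:R -> 0 < sin (n.+1%:R^-1 * z).
  move=> z0; rewrite gtr0_norm// => zn; apply: sin_gt0_pi; rewrite mulr_gt0//=.
  rewrite mulrC ltr_pdivrMr// (lt_le_trans zn)// ler_peMl//.
  by rewrite (le_trans _ (pi_ge2 R))// ler1n.
have [y0|y0|y0] := ltrgt0P y.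
- by rewrite !gtr0_sg// ypi.
- rewrite !ltr0_sg// -oppr_gt0 -sinN -mulrN ypi ?oppr_gt0 ?normrN//.
- by rewrite y0 mulr0 sin0 sgr0.
Qed.

(** Lists of constraints make these sets closed under intersection by concatenation, and the empty
    list gives the whole space. *)
Definition upper_box (l : seq (J * R)) : set T :=
  [set x | forall p, p \in l -> p.2 < xi p.1 x].

Lemma agree_multiplier_upper_box l : agree_multiplier (\1_(upper_box l)).
Proof.
have half j (a : R) : agree_multiplier (fun x => (a < xi j x)%R%:R).
  (* For [s] in {-1, 0, 1}, [(s + s^2) / 2] is the indicator of [s = 1]. *)
  rewrite (_ : (fun _ => _) = fun x => (Num.sg (xi j x - a) + Num.sg (xi j x - a) * Num.sg (xi j x - a)) * 2^-1).
    apply: agree_multiplierM; last exact: agree_multiplier_cst.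
    apply: agree_multiplierD; first exact: agree_multiplier_sign.
    by apply: agree_multiplierM; exact: agree_multiplier_sign.
  apply/funext => x; rewrite -(subr_gt0 a); have [y0|y0|->] := ltrgt0P (xi j x - a).
  - by rewrite gtr0_sg//=; field.
  - by rewrite ltr0_sg//=; field.
  - by rewrite sgr0 /=; field.
elim: l => [|[j a] l ih].
  rewrite (_ : \1_ _ = fun=> 1); first exact: agree_multiplier_cst.
  by apply/funext => x; rewrite indicE mem_set.
rewrite (_ : \1_ _ = fun x => (a < xi j x)%R%:R * \1_(upper_box l) x).
  exact: agree_multiplierM.
apply/funext => x; rewrite !indicE -natrM mulnb; congr (_%:R); congr nat_of_bool.
apply/idP/andP => [|[ax]]; rewrite !inE.
  move=> h; split; first exact: (h (j, a) (mem_head _ _)).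
  by move=> p pl; apply: h; rewrite in_cons pl orbT.
by move=> h p; rewrite in_cons => /predU1P[->|/h].
Qed.

(** A box indicator is a multiplier, and agreement at frequency 0 and shift 0 equates its two
    masses. The boxes form a generating pi-system. *)
Lemma fourier_unique :
  (forall A, measurable A -> <<s range upper_box >> A) ->
  (forall t c, \int[mu]_x cos (phase t x + c) = \int[nu]_x cos (phase t x + c)) ->
  forall A, measurable A -> mu A = nu A.
Proof.
move=> gen cosE A mA.
have agree1 : fourier_agree (fun=> 1).
  split; [exact: measurable_cst|by exists 1 => x; rewrite normr1|].
  move=> t c; under eq_Rintegral do rewrite mul1r.
  by under [RHS]eq_Rintegral do rewrite mul1r.
have mbox l : measurable (upper_box l).
  have [mf _ _] := agree_multiplier_upper_box l agree1.
  have -> : upper_box l = (fun x => 1 * \1_(upper_box l) x) @^-1` [set (1 : R)].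
    apply/seteqP; split => x /=; rewrite mul1r indicE; first by move=> h; rewrite mem_set.
    by case: (boolP (x \in _)); [rewrite inE|move=> _ /eqP; rewrite eq_sym oner_eq0].
  by rewrite -[X in measurable X]setTI; apply: mf => //; exact: measurable_set1.
apply: (@g_sigma_algebra_measure_unique _ _ _ (range upper_box) _ (fun=> setT)).
- by move=> _ [l _ <-]; exact: mbox.
- by move=> _; exists [::] => //; apply/seteqP; split.
- by apply/seteqP; split => // x _; exists 0%N.
- move=> _ _ [l1 _ <-] [l2 _ <-]; exists (l1 ++ l2) => //.
  apply/seteqP; split => x /=.
    by move=> h; split=> p pl; apply: h; rewrite mem_cat pl ?orbT.
  by move=> [h1 h2] p; rewrite mem_cat => /orP[/h1|/h2].
- move=> _ [l _ <-]; have [_ _ /(_ (fun=> 0) 0)] := agree_multiplier_upper_box l agree1.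
  have E (m : {measure set T -> \bar R}) : (m setT < +oo)%E ->
      \int[m]_x (1 * \1_(upper_box l) x * cos (phase (fun=> 0) x + 0)) = fine (m (upper_box l)).
    move=> mfin; under eq_Rintegral => x _.
      rewrite mul1r addr0 [phase _ _]big1 ?cos0 ?mulr1; last by move=> j _; rewrite mul0r.
      over.
    by rewrite /Rintegral integral_indic// setIT.
  have fin (m : {measure set T -> \bar R}) : (m setT < +oo)%E ->
      m (upper_box l) \is a fin_num.
    by move=> mfin; rewrite ge0_fin_numE// (le_lt_trans _ mfin)// le_measure ?inE.
  by rewrite !E// => h; rewrite -(fineK (fin _ mu_fin)) -(fineK (fin _ nu_fin)) h.
- by [].
- exact: gen.
Qed.

End FourierUniqueness.

Lemma finite_measure_setT d (T : measurableType d) (R : realType)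
  (mu : {finite_measure set T -> \bar R}) : (mu setT < +oo)%E.
Proof. by rewrite -ge0_fin_numE// fin_num_measure. Qed.

(** * Product measures, independence and characteristic functions *)

Section ProductIntegrals.
Context d1 d2 (T1 : measurableType d1) (T2 : measurableType d2) (R : realType).
Variables (mu : probability T1 R) (nu : probability T2 R).
Implicit Types (f : T1 -> R) (g : T2 -> R) (M N : R).

Lemma prod_measure_setT : ((mu \x nu)%E setT < +oo)%E.
Proof.
rewrite -setXTT product_measure1E//.
by rewrite -ge0_fin_numE ?mule_ge0// fin_numM// fin_num_measure.
Qed.

Lemma integrable_prod_bounded f g M N : measurable_fun setT f -> measurable_fun setT g ->
  (forall x, `|f x| <= M) -> (forall y, `|g y| <= N) ->
  (mu \x nu)%E.-integrable setT (EFin \o (fun z : T1 * T2 => f z.1 * g z.2)).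
Proof.
move=> mf mg fM gN; apply: (bounded_integrable _ (M := M * N)).
- exact: prod_measure_setT.
- by apply: measurable_funM; [exact: measurableT_comp mf _|exact: measurableT_comp mg _].
- by move=> z; rewrite normrM ler_pM.
Qed.

Lemma Rintegral_prod f g M N : measurable_fun setT f -> measurable_fun setT g ->
  (forall x, `|f x| <= M) -> (forall y, `|g y| <= N) ->
  \int[(mu \x nu)%E]_z (f z.1 * g z.2) = (\int[mu]_x f x) * \int[nu]_y g y.
Proof.
move=> mf mg fM gN.
have ig : nu.-integrable setT (EFin \o g).
  by apply: (bounded_integrable _ (M := N)) => //; exact: finite_measure_setT.
have if_ : mu.-integrable setT (EFin \o f).
  by apply: (bounded_integrable _ (M := M)) => //; exact: finite_measure_setT.
rewrite /Rintegral -(integral12_prod_meas1 (integrable_prod_bounded mf mg fM gN)) /fubini_F.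
rewrite -[RHS]/(_ * Rintegral nu setT g) -RintegralZr// /Rintegral; congr fine.
apply: eq_integral => x _ /=.
under eq_integral do rewrite EFinM.
rewrite integralZl// /Rintegral EFinM fineK//.
exact: integrable_fin_num.
Qed.

End ProductIntegrals.

Section IndependentIntegrals.
Context d d1 d2 (Omega : measurableType d) (T1 : measurableType d1)
  (T2 : measurableType d2) (R : realType) (Pr : probability Omega R).
Variables (X : {mfun Omega >-> T1}) (Y : {mfun Omega >-> T2}).
Variables (mu : probability T1 R) (nu : probability T2 R).

(** By uniqueness of the product measure, the condition on rectangles makes [mu \x nu] the law of
    the pair; Fubini's theorem then separates the factors. *)
Lemma indep_Rintegral (f : T1 -> R) (g : T2 -> R) (M N : R) :
  (forall A B, measurable A -> measurable B ->
    Pr (X @^-1` A `&` Y @^-1` B) = (mu A * nu B)%E) ->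
  measurable_fun setT f -> measurable_fun setT g ->
  (forall x, `|f x| <= M) -> (forall y, `|g y| <= N) ->
  \int[Pr]_w (f (X w) * g (Y w)) = (\int[mu]_x f x) * \int[nu]_y g y.
Proof.
move=> XY mf mg fM gN; rewrite -(Rintegral_prod mu nu mf mg fM gN).
have mfg : measurable_fun setT (EFin \o (fun z : T1 * T2 => f z.1 * g z.2)).
  have [_] := integrableP _ _ _ (integrable_prod_bounded mu nu mf mg fM gN).
  by have /measurable_int := integrable_prod_bounded mu nu mf mg fM gN.
rewrite /Rintegral; congr fine.
transitivity (\int[distribution Pr (mpair X Y)]_z (f z.1 * g z.2)%:E)%E.
  rewrite (@integral_distribution _ _ _ _ _ Pr (mpair X Y) (EFin \o (fun z => f z.1 * g z.2)))//.
  apply: (bounded_integrable _ (M := M * N)) => [||w]; first exact: finite_measure_setT.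
    by apply: measurable_funM; [exact: (measurableT_comp mf)|exact: (measurableT_comp mg)].
  by rewrite normrM ler_pM.
apply: eq_measure_integral => A mA _; apply/esym.
by apply: product_measure_unique => // B C mB mC; rewrite -XY.
Qed.

End IndependentIntegrals.

Section CharacteristicFunctions.
Context {R : realType} {n : nat}.
Local Notation V := (n.-tuple R).
Implicit Types (t x : V) (P : probability V R).

Lemma measurable_vdot t : measurable_fun setT (vdot t).
Proof.
apply: measurable_sum => i; apply: measurable_funM => //.
exact: measurable_tnth.
Qed.

Definition angle (t : V * V) (x : V * V) : R := vdot t.1 x.1 + vdot t.2 x.2.

Lemma measurable_angle (t : V * V) : measurable_fun setT (angle t).
Proof.
by apply: measurable_funD; apply: measurableT_comp => //; exact: measurable_vdot.
Qed.

Lemma measurable_cos : measurable_fun setT (@cos R).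
Proof. by apply: continuous_measurable_fun; exact: continuous_cos. Qed.

Lemma measurable_sin : measurable_fun setT (@sin R).
Proof. by apply: continuous_measurable_fun; exact: continuous_sin. Qed.

Lemma cos_bounded (y : R) : `|cos y| <= 1.
Proof. by rewrite ler_norml cos_geN1 cos_le1. Qed.

Lemma sin_bounded (y : R) : `|sin y| <= 1.
Proof. by rewrite ler_norml sin_geN1 sin_le1. Qed.

(** The expectation of exp(i h). A function [h] instead of a vector lets one definition serve
    vectors, pairs of vectors, and scaled or shifted phases. *)
Definition charfun d (T : measurableType d) (mu : {measure set T -> \bar R}) (h : T -> R) : R[i] :=
  (\int[mu]_y cos (h y)) +i* (\int[mu]_y sin (h y)).

Lemma charfun_shift d (T : measurableType d) (mu : {measure set T -> \bar R}) (h : T -> R) (c : R) :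
  (mu setT < +oo)%E -> measurable_fun setT h ->
  \int[mu]_y cos (h y + c) =
    complex.Re (charfun mu h) * cos c - complex.Im (charfun mu h) * sin c.
Proof.
move=> mufin mh /=.
have ic : mu.-integrable setT (EFin \o (fun y => cos (h y))).
  apply: (bounded_integrable mufin (M := 1)) => [|x]; last exact: cos_bounded.
  by apply: measurableT_comp mh; exact: measurable_cos.
have is_ : mu.-integrable setT (EFin \o (fun y => sin (h y))).
  apply: (bounded_integrable mufin (M := 1)) => [|x]; last exact: sin_bounded.
  by apply: measurableT_comp mh; exact: measurable_sin.
rewrite -!RintegralZr// -RintegralB//.
- by apply: eq_Rintegral => x _; rewrite cosD.
- apply: (bounded_integrable mufin (M := 1)) => [|x]; last first.
    by rewrite normrM mulr_ile1 ?cos_bounded.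
  by apply: measurable_funM => //; apply: measurableT_comp mh; exact: measurable_cos.
- apply: (bounded_integrable mufin (M := 1)) => [|x]; last first.
    by rewrite normrM mulr_ile1 ?sin_bounded.
  by apply: measurable_funM => //; apply: measurableT_comp mh; exact: measurable_sin.
Qed.

Definition pair_coord (j : 'I_n + 'I_n) (x : V * V) : R :=
  match j with inl i => tnth x.1 i | inr i => tnth x.2 i end.

Lemma measurable_pair_coord j : measurable_fun setT (pair_coord j).
Proof.
by case: j => i; apply: (measurableT_comp (measurable_tnth i)).
Qed.

(** Boxes with one constraint are preimages of open rays, so each coordinate is measurable for the
    generated sigma-algebra, and hence so is the identity into [V * V]. *)
Lemma pair_coord_generate (A : set (V * V)) : measurable A ->
  <<s range (upper_box pair_coord) >> A.
Proof.
move=> mA; pose S := g_sigma_algebraType (range (upper_box pair_coord)).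
have mcoord j : measurable_fun setT (pair_coord j : S -> R).
  apply: (measurability _ (RGenOInfty.measurableE R)) => _ [_ [a ->] <-].
  rewrite setTI; apply: sub_sigma_algebra; exists [:: (j, a)] => //.
  apply/seteqP; split => x /=.
    by rewrite in_itv/= andbT => h; exact: (h (j, a) (mem_head _ _)).
  by rewrite in_itv/= andbT => h p; rewrite inE => /eqP ->.
have : measurable_fun setT (fun x : S => ((x : V * V).1, (x : V * V).2)).
  apply: measurable_fun_pair; apply/measurable_fun_tnthP => i.
    exact: (mcoord (inl i)).
  exact: (mcoord (inr i)).
move=> /(_ measurableT A mA); rewrite setTI.
by rewrite (_ : _ @^-1` A = A)//; apply/seteqP; split => -[].
Qed.

Lemma phase_pair_coord (t : 'I_n + 'I_n -> R) (x : V * V) :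
  phase pair_coord t x = angle ([tuple t (inl i) | i < n], [tuple t (inr i) | i < n]) x.
Proof.
rewrite /phase /angle big_sumType /=.
by congr (_ + _); apply: eq_bigr => i _; rewrite tnth_mktuple.
Qed.

Lemma charfun_unique (mu nu : {measure set (V * V) -> \bar R}) :
  (mu setT < +oo)%E -> (nu setT < +oo)%E ->
  (forall t : V * V, charfun mu (angle t) = charfun nu (angle t)) -> same_law mu nu.
Proof.
move=> mufin nufin E A mA.
apply: (fourier_unique measurable_pair_coord mufin nufin pair_coord_generate _ mA).
move=> t c.
under eq_Rintegral do rewrite phase_pair_coord.
under [RHS]eq_Rintegral do rewrite phase_pair_coord.
by rewrite !charfun_shift//; [rewrite E|exact: measurable_angle|exact: measurable_angle].
Qed.

Lemma indep_charfun d d1 d2 (Omega : measurableType d) (T1 : measurableType d1)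
    (T2 : measurableType d2) (Pr : probability Omega R)
    (X : {mfun Omega >-> T1}) (Y : {mfun Omega >-> T2})
    (mu : probability T1 R) (nu : probability T2 R) (h : T1 -> R) (k : T2 -> R) :
  (forall A B, measurable A -> measurable B ->
    Pr (X @^-1` A `&` Y @^-1` B) = (mu A * nu B)%E) ->
  measurable_fun setT h -> measurable_fun setT k ->
  charfun Pr (fun w => h (X w) + k (Y w)) = charfun mu h * charfun nu k.
Proof.
move=> XY mh mk.
have mch := measurableT_comp measurable_cos mh; have msh := measurableT_comp measurable_sin mh.
have mck := measurableT_comp measurable_cos mk; have msk := measurableT_comp measurable_sin mk.
have bc d' (T : measurableType d') (f : T -> R) (y : T) : `|(cos \o f) y| <= 1 by exact: cos_bounded.
have bs d' (T : measurableType d') (f : T -> R) (y : T) : `|(sin \o f) y| <= 1 by exact: sin_bounded.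
have I (f : T1 -> R) (g : T2 -> R) : measurable_fun setT f -> measurable_fun setT g ->
    (forall y, `|f y| <= 1) -> (forall y, `|g y| <= 1) ->
    Pr.-integrable setT (EFin \o (fun w => f (X w) * g (Y w))).
  move=> mf mg f1 g1; apply: (bounded_integrable _ (M := 1)).
  - exact: finite_measure_setT.
  - by apply: measurable_funM; [exact: (measurableT_comp mf)|exact: (measurableT_comp mg)].
  - by move=> w; rewrite normrM mulr_ile1.
rewrite /charfun; apply/eqP; rewrite eq_complex /=; apply/andP; split; apply/eqP.
  under eq_Rintegral do rewrite cosD.
  rewrite RintegralB//; last 2 first.
    by apply: (I (cos \o h) (cos \o k)).
    by apply: (I (sin \o h) (sin \o k)).
  rewrite (indep_Rintegral XY mch mck (bc _ _ _) (bc _ _ _)).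
  by rewrite (indep_Rintegral XY msh msk (bs _ _ _) (bs _ _ _)).
under eq_Rintegral do rewrite sinD.
rewrite RintegralD//; last 2 first.
  by apply: (I (sin \o h) (cos \o k)).
  by apply: (I (cos \o h) (sin \o k)).
rewrite (indep_Rintegral XY msh mck (bs _ _ _) (bc _ _ _)).
by rewrite (indep_Rintegral XY mch msk (bc _ _ _) (bs _ _ _)) addrC.
Qed.

End CharacteristicFunctions.

(** * Characteristic function of the observations *)

Section ObservationCharfun.
Context (R : realType) (l n : nat) (disp : measure_display)
  (Omega : measurableType disp) (Pr : probability Omega R)
  (Z : nat -> {RV Pr >-> l.-tuple R}) (g : {mfun l.-tuple R >-> n.-tuple R})
  (eps : nat -> {RV Pr >-> n.-tuple R}) (P : probability (n.-tuple R) R).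
Hypothesis model : noisy_stationary_model Z eps P.
Local Notation V := (n.-tuple R).

Lemma noise_pair_law (A B : set V) : measurable A -> measurable B ->
  Pr (eps 0%N @^-1` A `&` eps 1%N @^-1` B) = (P A * P B)%E.
Proof.
move=> mA mB; have [_ [ind law] _] := model.
have := ind [:: 0%N; 1%N] (fun i => if i is 0%N then A else B).
rewrite !big_cons big_nil mule1 => /(_ isT).
rewrite -(law 0%N A mA) -(law 1%N B mB) /distribution /pushforward => <-; last by case.
congr (Pr _); apply/seteqP; split => w /=.
  by move=> [h1 h2] [|[|k]] //=; rewrite !inE.
by move=> h; split; [exact: (h 0%N)|exact: (h 1%N)].
Qed.

Lemma noise_in_sigma (B : set (V * V)) : measurable B ->
  sigma_process eps (mpair (eps 0%N) (eps 1%N) @^-1` B).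
Proof.
move=> mB.
pose S := g_sigma_algebraType (\bigcup_i preimage_set_system setT (eps i) (@measurable _ V)).
have meps i : measurable_fun setT (eps i : S -> V).
  move=> _ C mC; apply: sub_sigma_algebra; exists i => //.
  by exists C.
have : measurable_fun setT (fun w : S => (eps 0%N w, eps 1%N w)) by exact: measurable_fun_pair.
by move=> /(_ measurableT B mB); rewrite setTI.
Qed.

Lemma signal_in_sigma (B : set (V * V)) : measurable B ->
  sigma_process Z (mpair (signal Z g 0) (signal Z g 1) @^-1` B).
Proof.
move=> mB.
pose S := g_sigma_algebraType (\bigcup_i preimage_set_system setT (Z i) (@measurable _ (l.-tuple R))).
have mZ i : measurable_fun setT (Z i : S -> l.-tuple R).
  move=> _ C mC; apply: sub_sigma_algebra; exists i => //.
  by exists C.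
have : measurable_fun setT (fun w : S => (g (Z 0%N w), g (Z 1%N w))).
  by apply: measurable_fun_pair; apply: (measurableT_comp (measurable_funPT g)).
by move=> /(_ measurableT B mB); rewrite setTI.
Qed.

Lemma vdotDr (t x y : V) : vdot t (vadd x y) = vdot t x + vdot t y.
Proof.
by rewrite /vdot -big_split /=; apply: eq_bigr => i _; rewrite tnth_mktuple mulrDr.
Qed.

Lemma charfun_distribution d (T : measurableType d) (X : {mfun Omega >-> T}) (h : T -> R) :
  measurable_fun setT h -> charfun (distribution Pr X) h = charfun Pr (fun w => h (X w)).
Proof.
move=> mh; have I (f : R -> R) : measurable_fun setT f -> (forall x, `|f x| <= 1) ->
    \int[distribution Pr X]_x f (h x) = \int[Pr]_w f (h (X w)).
  move=> mf f1; rewrite /Rintegral (@integral_distribution _ _ _ _ _ Pr X (fun x => (f (h x))%:E))//.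
    by apply/measurable_EFinP; exact: measurableT_comp mf mh.
  apply: (bounded_integrable _ (M := 1)) => [||w]; last exact: f1.
  - exact: finite_measure_setT.
  - by apply: (measurableT_comp mf); exact: (measurableT_comp mh).
rewrite /charfun !I//.
- exact: measurable_sin.
- exact: sin_bounded.
- exact: measurable_cos.
- exact: cos_bounded.
Qed.

(** The angle is additive: independence of the two processes splits off the pair of noises, and
    independence of [eps 0] and [eps 1] then splits that pair. *)
Lemma charfun_observation (t : V * V) :
  charfun (observation_law2 Z g eps) (angle t) =
  charfun (signal_law2 Z g) (angle t) * (charfun P (vdot t.1) * charfun P (vdot t.2)).
Proof.
have [_ _ ind] := model.
rewrite charfun_distribution; last exact: measurable_angle.
have -> : (fun w => angle t (mpair (observation Z g eps 0) (observation Z g eps 1) w)) =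
  (fun w => angle t (mpair (signal Z g 0) (signal Z g 1) w) +
            angle t (mpair (eps 0%N) (eps 1%N) w)).
  by apply/funext => w; rewrite /angle /= !vdotDr addrACA.
rewrite (@indep_charfun _ _ _ _ _ _ _ Pr (mpair (signal Z g 0) (signal Z g 1)) (mpair (eps 0%N) (eps 1%N))
  (signal_law2 Z g) (distribution Pr (mpair (eps 0%N) (eps 1%N)))).
- congr (_ * _); rewrite charfun_distribution; last exact: measurable_angle.
  rewrite /angle (@indep_charfun _ _ _ _ _ _ _ Pr (eps 0%N) (eps 1%N) P P)//.
  + exact: noise_pair_law.
  + exact: measurable_vdot.
  + exact: measurable_vdot.
- move=> A B mA mB; rewrite setIC ind 1?muleC//; first exact: noise_in_sigma.
  exact: signal_in_sigma.
- exact: measurable_angle.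
- exact: measurable_angle.
Qed.

End ObservationCharfun.

(** * Laplace transforms *)

Section ComplexExponential.
Context {R : realType}.
Implicit Types (x y : R) (v w : R[i]).

Lemma expR_sub1_le x : expR x - 1 <= x * expR x.
Proof.
have := @expR_ge1Dx R (- x); rewrite expRN => h.
have := ler_wpM2r (expR_ge0 x) h; rewrite mulVf ?gt_eqF ?expR_gt0//; lra.
Qed.

Lemma abs_expR_sub1 x : `|expR x - 1| <= `|x| * expR `|x|.
Proof.
have h1 := expR_sub1_le x; have h2 := @expR_ge1Dx R x.
have h3 : 1 <= expR `|x| by rewrite -expR0 ler_expR.
rewrite ler_norml; apply/andP; split.
  have : - x <= `|x| by rewrite -normrN ler_norm.
  by have := normr_ge0 x; nra.
rewrite (le_trans h1)//; apply: (@le_trans _ _ (`|x| * expR x)).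
  by rewrite ler_wpM2r ?expR_ge0 ?ler_norm.
by rewrite ler_wpM2l// ler_expR ler_norm.
Qed.

Lemma expR_sub1x_le x : 0 <= expR x - 1 - x <= x ^+ 2 * expR `|x|.
Proof.
have h1 := expR_sub1_le x; have h2 := @expR_ge1Dx R x.
apply/andP; split; first lra.
apply: (@le_trans _ _ (x * (expR x - 1))); first lra.
rewrite (le_trans (ler_norm _))// normrM -(real_normK (num_real x)) expr2 -mulrA.
by rewrite ler_wpM2l// abs_expR_sub1.
Qed.

Lemma abs_sin_le y : `|sin y| <= `|y|.
Proof.
wlog y0 : y / 0 <= y.
  move=> h; have [/h//|/ltW] := leP 0 y.
  by rewrite -oppr_ge0 => /h; rewrite sinN !normrN.
have [c _] : exists2 c, c \in `[0, y] & sin y - sin 0 = cos c * (y - 0).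
  apply: (@MVT_segment R sin cos); first exact: y0.
  by apply: continuous_subspaceT => z; exact: continuous_sin.
rewrite sin0 !subr0 => ->; rewrite normrM ler_piMl// ler_norml.
by rewrite cos_geN1 cos_le1.
Qed.

Lemma one_sub_cos_le y : 0 <= 1 - cos y <= y ^+ 2.
Proof.
rewrite subr_ge0 cos_le1/=.
have -> : cos y = cos (y / 2 *+ 2) by congr cos; rewrite -mulr_natr divfK ?pnatr_eq0.
rewrite cos_mulr2n cos2sin2.
have h : sin (y / 2) ^+ 2 <= (y / 2) ^+ 2.
  by rewrite -real_normK ?num_real// -[leRHS]real_normK ?num_real// lerXn2r ?nnegrE// abs_sin_le.
have : 0 <= y ^+ 2 by rewrite sqr_ge0.
move: h; rewrite expr_div_n -[(1 - _) *+ 2]mulr_natr; lra.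
Qed.

Lemma sin_sub_le y : `|sin y - y| <= y ^+ 2.
Proof.
wlog y0 : y / 0 <= y.
  move=> h; have [/h//|/ltW] := leP 0 y.
  by rewrite -oppr_ge0 => /h; rewrite sinN sqrrN -opprD normrN.
have [c] : exists2 c, c \in `[0, y] & sin y - sin 0 = cos c * (y - 0).
  apply: (@MVT_segment R sin cos); first exact: y0.
  by apply: continuous_subspaceT => z; exact: continuous_sin.
rewrite in_itv/= => /andP[c0 cy]; rewrite sin0 !subr0 => ->.
rewrite -[X in _ - X]mul1r -mulrBl normrM expr2 (ger0_norm y0) ler_wpM2r//.
have /andP[h1 _] := one_sub_cos_le c.
have -> : `|cos c - 1| = 2 * sin (c / 2) ^+ 2.
  rewrite distrC ger0_norm//.
  have -> : cos c = cos (c / 2 *+ 2) by congr cos; rewrite -mulr_natr divfK ?pnatr_eq0.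
  by rewrite cos_mulr2n cos2sin2 -mulr_natr; ring.
have s1 : `|sin (c / 2)| <= 1 by exact: sin_bounded.
have s2 := abs_sin_le (c / 2); rewrite (@ger0_norm _ (c / 2)) ?divr_ge0// in s2.
rewrite -[X in 2 * X]ger0_norm ?sqr_ge0// normrX expr2.
have := normr_ge0 (sin (c / 2)); nra.
Qed.

Lemma cexpD v w : cexp (v + w) = cexp v * cexp w.
Proof.
case: v w => [a b] [c d]; rewrite /cexp /= expRD cosD sinD.
by apply/eqP; rewrite eq_complex /=; apply/andP; split; apply/eqP; ring.
Qed.

Lemma cexp0 : cexp (0 : R[i]) = 1.
Proof. by rewrite /cexp /= expR0 cos0 sin0 mulr1 mulr0. Qed.

Lemma cexpMn w n : cexp (n%:R * w) = cexp w ^+ n.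
Proof.
elim: n => [|n ih]; first by rewrite mul0r cexp0 expr0.
by rewrite -natr1 mulrDl mul1r cexpD ih exprSr.
Qed.

Lemma modc_cexp w : modc (cexp w) = expR (complex.Re w).
Proof.
rewrite modcE /= !exprMn -mulrDr cos2Dsin2 mulr1 sqrtr_sqr ger0_norm//.
Qed.

Lemma modc_cexp_le w : modc (cexp w) <= expR (modc w).
Proof. by rewrite modc_cexp ler_expR (le_trans (ler_norm _))// Re_modc. Qed.

Lemma cexp_real x : cexp x%:C = (expR x)%:C.
Proof. by rewrite /cexp /= cos0 sin0 mulr1 mulr0. Qed.

Lemma cexp_imag y : cexp (0 +i* y) = cos y +i* sin y.
Proof. by rewrite /cexp /= expR0 !mul1r. Qed.

Lemma modc_cexp_sub1x w : modc (cexp w - 1 - w) <= 4 * modc w ^+ 2 * expR (modc w).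
Proof.
case: w => a b; set m := modc (a +i* b).
have am : `|a| <= m := Re_modc (a +i* b).
have bm : `|b| <= m := Im_modc (a +i* b).
have m0 : 0 <= m := modc_ge0 _.
have em : expR `|a| <= expR m by rewrite ler_expR.
have e1 : 1 <= expR m by rewrite -expR0 ler_expR.
have a2 : a ^+ 2 <= m ^+ 2 by rewrite -real_normK ?num_real// lerXn2r.
have b2 : b ^+ 2 <= m ^+ 2 by rewrite -real_normK ?num_real// lerXn2r.
have m2 : 0 <= m ^+ 2 by rewrite sqr_ge0.
apply: (le_trans (modc_ReIm _)); rewrite /cexp /= subr0.
have re : `|expR a * cos b - 1 - a| <= 2 * m ^+ 2 * expR m.
  have -> : expR a * cos b - 1 - a = (expR a - 1 - a) - expR a * (1 - cos b) by ring.
  rewrite (le_trans (ler_normB _ _))//.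
  have /andP[h1 h2] := expR_sub1x_le a; have /andP[h3 h4] := one_sub_cos_le b.
  rewrite ger0_norm// ger0_norm ?mulr_ge0 ?expR_ge0//.
  have h5 : a ^+ 2 * expR `|a| <= m ^+ 2 * expR m by rewrite ler_pM ?sqr_ge0 ?expR_ge0.
  have h6 : expR a * (1 - cos b) <= expR m * m ^+ 2.
    rewrite ler_pM ?expR_ge0 ?(le_trans h4)// ler_expR (le_trans (ler_norm _))//.
  lra.
have im : `|expR a * sin b - 0 - b| <= 2 * m ^+ 2 * expR m.
  have -> : expR a * sin b - 0 - b = (expR a - 1) * sin b + (sin b - b) by ring.
  rewrite (le_trans (ler_normD _ _))// normrM.
  have h1 : `|expR a - 1| * `|sin b| <= (m * expR m) * m.
    rewrite ler_pM ?(le_trans (abs_sin_le b))// (le_trans (abs_expR_sub1 a))//.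
    by rewrite ler_pM ?expR_ge0.
  have h2 := sin_sub_le b.
  have h3 : m ^+ 2 <= m ^+ 2 * expR m by rewrite ler_peMr.
  lra.
by rewrite subr0 in im; lra.
Qed.

Lemma subrX_modc_le v w x n : modc v <= x -> modc w <= x ->
  modc (v ^+ n.+1 - w ^+ n.+1) <= n.+1%:R * x ^+ n * modc (v - w).
Proof.
move=> vx wx; have x0 : 0 <= x := le_trans (modc_ge0 _) vx.
rewrite subrXX modcM mulrC ler_wpM2r ?modc_ge0// (le_trans (modc_sum _ _ _))//.
rewrite mulr_natl -[n.+1 in leRHS]card_ord -sumr_const ler_sum// => i _.
have iE : n = ((n - i) + i)%N by rewrite subnK// -ltnS.
rewrite modcM !modcX /=; have -> : x ^+ n = x ^+ (n - i) * x ^+ i by rewrite -exprD -iE.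
rewrite ler_pM ?exprn_ge0 ?modc_ge0//.
  by rewrite lerXn2r ?nnegrE ?modc_ge0.
by rewrite lerXn2r ?nnegrE ?modc_ge0.
Qed.

Lemma sqr_le_expR x : 0 <= x -> x ^+ 2 <= 4 * expR x.
Proof.
move=> x0; have h := @expR_ge1Dx R (x / 2).
have -> : expR x = expR (x / 2) * expR (x / 2) by rewrite -expRD -splitr.
have : 0 <= 1 + x / 2 by lra.
by nra.
Qed.

(** With [v = w / n.+1], the bases [cexp v] and [1 + v] differ by a multiple of [|v|^2], and their
    powers by about [n.+1] times as much. The remaining [|w|^2] is absorbed by [4 * expR |w|], hence
    16 and the doubled exponent. *)
Lemma cexp_approx w n :
  modc (cexp w - (1 + w / n.+1%:R) ^+ n.+1) <= 16 * expR (2 * modc w) / n.+1%:R.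
Proof.
pose v := w / n.+1%:R; have n0 : n.+1%:R != 0 :> R[i] by rewrite pnatr_eq0.
have wE : w = n.+1%:R * v by rewrite mulrC divfK.
have -> : cexp w = cexp v ^+ n.+1 by rewrite wE cexpMn.
have mv : modc v = modc w / n.+1%:R by rewrite modcM modcV modc_nat.
have h1 : modc (1 + v) <= expR (modc v).
  by rewrite (le_trans (modcD _ _))// modc1 expR_ge1Dx.
apply: (le_trans (subrX_modc_le n (modc_cexp_le v) h1)).
rewrite opprD addrA.
apply: (@le_trans _ _ (n.+1%:R * expR (modc v) ^+ n * (4 * modc v ^+ 2 * expR (modc v)))).
  by rewrite ler_wpM2l ?modc_cexp_sub1x// mulr_ge0// exprn_ge0// expR_ge0.
have -> : n.+1%:R * expR (modc v) ^+ n * (4 * modc v ^+ 2 * expR (modc v)) =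
    4 * n.+1%:R * modc v ^+ 2 * expR (modc v) ^+ n.+1.
    by rewrite mulrACA -exprSr [n.+1%:R * (4 * _)]mulrA [n.+1%:R * 4]mulrC.
have -> : expR (modc v) ^+ n.+1 = expR (modc w).
  by rewrite -expRM_natl mv -[in LHS]mulr_natl mulrC divfK// pnatr_eq0.
have -> : 4 * n.+1%:R * modc v ^+ 2 * expR (modc w) = 4 * modc w ^+ 2 * expR (modc w) / n.+1%:R.
  have N0 : n.+1%:R != 0 :> R by rewrite pnatr_eq0.
  by rewrite mv; move: (n.+1%:R) N0 => N N0; field.
have -> : expR (2 * modc w) = expR (modc w) * expR (modc w) by rewrite -expRD mulr_natl.
rewrite ler_wpM2r ?invr_ge0// mulrA ler_wpM2r ?expR_ge0//.
have := sqr_le_expR (modc_ge0 w); lra.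
Qed.

End ComplexExponential.

(** * Integrals of complex-valued functions *)

Section ComplexIntegral.
Context d (T : measurableType d) (R : realType) (mu : {measure set T -> \bar R}).
Implicit Types (f g : T -> R[i]) (h : T -> R) (c : R[i]).

Definition cmeasurable f := measurable_fun setT (fun x => complex.Re (f x)) /\
  measurable_fun setT (fun x => complex.Im (f x)).

Definition cintegrable f := mu.-integrable setT (EFin \o (fun x => complex.Re (f x))) /\
  mu.-integrable setT (EFin \o (fun x => complex.Im (f x))).

Lemma cmeasurable_cst c : cmeasurable (fun=> c).
Proof. by split; exact: measurable_cst. Qed.

Lemma cmeasurableD f g : cmeasurable f -> cmeasurable g -> cmeasurable (fun x => f x + g x).
Proof.
move=> [f1 f2] [g1 g2]; split.
  by under eq_fun do rewrite ReD; exact: measurable_funD.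
by under eq_fun do rewrite ImD; exact: measurable_funD.
Qed.

Lemma ReM (v w : R[i]) : complex.Re (v * w) =
  complex.Re v * complex.Re w - complex.Im v * complex.Im w.
Proof. by case: v w => [a b] [a' b']. Qed.

Lemma ImM (v w : R[i]) : complex.Im (v * w) =
  complex.Re v * complex.Im w + complex.Im v * complex.Re w.
Proof. by case: v w => [a b] [a' b']. Qed.

Lemma cmeasurableM f g : cmeasurable f -> cmeasurable g -> cmeasurable (fun x => f x * g x).
Proof.
move=> [f1 f2] [g1 g2]; split.
  by under eq_fun do rewrite ReM; apply: measurable_funB; exact: measurable_funM.
by under eq_fun do rewrite ImM; apply: measurable_funD; exact: measurable_funM.
Qed.

Lemma cmeasurableX f n : cmeasurable f -> cmeasurable (fun x => f x ^+ n).
Proof.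
move=> mf; elim: n => [|n ih]; first exact: cmeasurable_cst.
by under eq_fun do rewrite exprS; exact: cmeasurableM.
Qed.

Lemma cmeasurable_cexp f : cmeasurable f -> cmeasurable (fun x => cexp (f x)).
Proof.
move=> [f1 f2]; split => /=; apply: measurable_funM.
- exact: (measurableT_comp (@measurable_expR R)).
- exact: (measurableT_comp measurable_cos).
- exact: (measurableT_comp (@measurable_expR R)).
- exact: (measurableT_comp measurable_sin).
Qed.

Lemma measurable_modc f : cmeasurable f -> measurable_fun setT (fun x => modc (f x)).
Proof.
move=> [f1 f2]; under eq_fun do rewrite modcE.
have ms : measurable_fun setT (@Num.sqrt R).
  by apply: continuous_measurable_fun => x; exact: sqrt_continuous.
exact: (measurableT_comp ms (measurable_funD (measurable_funX 2 f1) (measurable_funX 2 f2))).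
Qed.

Lemma integrable_le h h' : measurable_fun setT h -> mu.-integrable setT (EFin \o h') ->
  (forall x, `|h x| <= h' x) -> mu.-integrable setT (EFin \o h).
Proof.
move=> mh ih' hh; apply: le_integrable ih' => //; first exact/measurable_EFinP.
by move=> x _; rewrite /= lee_fin (le_trans (hh x))// ler_norm.
Qed.

Lemma cintegrable_le f h : cmeasurable f -> mu.-integrable setT (EFin \o h) ->
  (forall x, modc (f x) <= h x) -> cintegrable f.
Proof.
move=> [f1 f2] ih fh; split.
  by apply: (integrable_le f1 ih) => x; rewrite (le_trans (Re_modc _)).
by apply: (integrable_le f2 ih) => x; rewrite (le_trans (Im_modc _)).
Qed.

Lemma complex_ext (v w : R[i]) : complex.Re v = complex.Re w ->
  complex.Im v = complex.Im w -> v = w.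
Proof. by case: v w => [a b] [a' b'] /= -> ->. Qed.

Lemma cintegralD f g : cintegrable f -> cintegrable g ->
  cintegral mu (fun x => f x + g x) = cintegral mu f + cintegral mu g.
Proof.
move=> [f1 f2] [g1 g2]; apply: complex_ext => /=.
  by under eq_Rintegral do rewrite ReD; rewrite RintegralD.
by under eq_Rintegral do rewrite ImD; rewrite RintegralD.
Qed.

Lemma cintegrableD f g : cintegrable f -> cintegrable g -> cintegrable (fun x => f x + g x).
Proof.
move=> [f1 f2] [g1 g2]; split.
  under eq_fun do rewrite ReD; exact: (integrableD measurableT f1 g1).
under eq_fun do rewrite ImD; exact: (integrableD measurableT f2 g2).
Qed.

Lemma integrable_scale (k : R) h : mu.-integrable setT (EFin \o h) ->
  mu.-integrable setT (EFin \o (fun x => k * h x)).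
Proof. by move=> ih; exact: (integrableZl measurableT k ih). Qed.

Lemma cintegrableZ c f : cintegrable f -> cintegrable (fun x => c * f x).
Proof.
move=> [f1 f2]; split.
  under eq_fun do rewrite ReM.
  exact: (integrableB measurableT (integrable_scale _ f1) (integrable_scale _ f2)).
under eq_fun do rewrite ImM.
exact: (integrableD measurableT (integrable_scale _ f2) (integrable_scale _ f1)).
Qed.

Lemma cintegralZ c f : cintegrable f ->
  cintegral mu (fun x => c * f x) = c * cintegral mu f.
Proof.
move=> [f1 f2]; apply: complex_ext.
  rewrite ReM /=; under eq_Rintegral do rewrite ReM.
  by rewrite RintegralB ?RintegralZl//; exact: integrable_scale.
rewrite ImM /=; under eq_Rintegral do rewrite ImM.
by rewrite RintegralD ?RintegralZl//; exact: integrable_scale.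
Qed.

Lemma cintegral_sum (n : nat) (F : 'I_n -> T -> R[i]) : (forall i, cintegrable (F i)) ->
  cintegrable (fun x => \sum_(i < n) F i x) /\
  cintegral mu (fun x => \sum_(i < n) F i x) = \sum_(i < n) cintegral mu (F i).
Proof.
elim: n F => [|n ih] F iF.
  under eq_fun do rewrite big_ord0.
  split; first by split => /=; exact: integrable0.
  by rewrite big_ord0 /cintegral /Rintegral /= integral0.
have [h1 h2] := ih (fun i => F (lift ord0 i)) (fun i => iF _).
have E : (fun x => \sum_(i < n.+1) F i x) = (fun x => F ord0 x + \sum_(i < n) F (lift ord0 i) x).
  by apply/funext => x; rewrite big_ord_recl.
rewrite E; split; first exact: cintegrableD.
by rewrite cintegralD// big_ord_recl h2.
Qed.

Lemma modc_cintegral_le f h : cintegrable f -> mu.-integrable setT (EFin \o h) ->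
  (forall x, modc (f x) <= h x) -> modc (cintegral mu f) <= 2 * \int[mu]_x h x.
Proof.
move=> [f1 f2] ih fh.
have bound k : mu.-integrable setT (EFin \o k) -> (forall x, `|k x| <= h x) ->
    `|\int[mu]_x k x| <= \int[mu]_x h x.
  move=> ik kh; rewrite (le_trans (le_normr_Rintegral measurableT ik))//.
  apply: le_Rintegral => //; exact: integrable_norm.
rewrite (le_trans (modc_ReIm _))//= mulr_natl mulr2n lerD//.
  by apply: bound => // x; exact: le_trans (Re_modc _) (fh x).
by apply: bound => // x; exact: le_trans (Im_modc _) (fh x).
Qed.

End ComplexIntegral.

(** * Laplace transforms are entire *)

Section LaplaceEntire.
Context d (T : measurableType d) (R : realType) (mu : {measure set T -> \bar R}).
Variables (a b : T -> R[i]).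
Hypotheses (ma : cmeasurable a) (mb : cmeasurable b).
Hypothesis exp_int : forall r : R, 0 <= r ->
  mu.-integrable setT (EFin \o (fun x => expR (r * (modc (a x) + modc (b x))))).

Let w (s : R[i]) x := a x + s * b x.

Let modc_w (r : R) s x : 0 <= r -> modc s <= r ->
  modc (w s x) <= (1 + r) * (modc (a x) + modc (b x)).
Proof.
move=> r0 sr; rewrite (le_trans (modcD _ _))// modcM mulrDl mul1r mulrDr.
have h1 := modc_ge0 (a x); have h2 := modc_ge0 (b x).
have := ler_wpM2r h2 sr; have := mulr_ge0 r0 h1; lra.
Qed.

Let mw s : cmeasurable (w s).
Proof. by apply: cmeasurableD => //; apply: cmeasurableM => //; exact: cmeasurable_cst. Qed.

Lemma cintegrable_cexp s : cintegrable mu (fun x => cexp (w s x)).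
Proof.
have r0 : 0 <= 1 + modc s by rewrite addr_ge0 ?modc_ge0.
apply: (cintegrable_le (cmeasurable_cexp (mw s)) (exp_int r0)) => x.
by rewrite (le_trans (modc_cexp_le _))// ler_expR modc_w ?modc_ge0.
Qed.

(** Replacing the exponential by [(1 + w / N) ^+ N] makes the integrand a polynomial in [s], which
    can be integrated coefficient by coefficient. By [cexp_approx] the error is an exponential
    moment divided by [N]. *)
Lemma entire_laplace : entire (fun s => cintegral mu (fun x => cexp (w s x))).
Proof.
move=> r0 e e0; pose r := Num.max r0 0.
have r00 : 0 <= r by rewrite le_max lexx orbT.
have K0 : 0 <= 2 * (1 + r) by rewrite mulr_ge0 ?addr_ge0.
pose I := \int[mu]_x expR (2 * (1 + r) * (modc (a x) + modc (b x))).
have [n nI] : exists n : nat, 32 * `|I| / e < n.+1%:R.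
  by exists (Num.truncn (32 * `|I| / e)); rewrite truncnS_gt.
pose N : R[i] := n.+1%:R.
(* The coefficient of [s ^+ k] in the binomial expansion. *)
pose F (k : 'I_n.+2) x : R[i] :=
  'C(n.+1, k)%:R * ((1 + a x / N) ^+ (n.+1 - k) * (b x / N) ^+ k).
have iF k : cintegrable mu (F k).
  apply: cintegrableZ; apply: (cintegrable_le _ (exp_int (ler0n _ n.+1))) => [|x].
    apply: cmeasurableM; apply: cmeasurableX; last first.
      by apply: cmeasurableM => //; exact: cmeasurable_cst.
    apply: cmeasurableD; first exact: cmeasurable_cst.
    by apply: cmeasurableM => //; exact: cmeasurable_cst.
  have divN z : modc (z / N) <= modc z.
    by rewrite modcM modcV modc_nat ler_piMr ?modc_ge0// invf_le1// ler1n.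
  have h1 : modc (1 + a x / N) <= expR (modc (a x) + modc (b x)).
    rewrite (le_trans (modcD _ _))// modc1 (le_trans _ (expR_ge1Dx _))// lerD2l.
    by rewrite (le_trans (divN _))// lerDl modc_ge0.
  have h2 : modc (b x / N) <= expR (modc (a x) + modc (b x)).
    rewrite (le_trans (divN _))// (le_trans _ (expR_ge1Dx _))//.
    by rewrite addrA lerDr addr_ge0 ?modc_ge0.
  have kn : (k <= n.+1)%N by rewrite -ltnS.
  rewrite modcM !modcX expRM_natl.
  set E := expR _ in h1 h2 *.
  have -> : E ^+ n.+1 = E ^+ (n.+1 - k) * E ^+ k by rewrite -exprD subnK.
  by rewrite ler_pM ?exprn_ge0 ?modc_ge0// lerXn2r ?nnegrE ?modc_ge0 ?expR_ge0.
exists (\poly_(k < n.+2) cintegral mu (F (inord k))) => s sr0.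
have sr : modc s <= r by rewrite (le_trans sr0)// le_max lexx.
have pE x : (1 + w s x / N) ^+ n.+1 = \sum_(k < n.+2) s ^+ k * F k x.
  have -> : 1 + w s x / N = (1 + a x / N) + s * (b x / N) by rewrite /w; ring.
  rewrite exprDn; apply: eq_bigr => k _.
  by rewrite /F exprMn -mulr_natl; ring.
have isF (k : 'I_n.+2) : cintegrable mu (fun x => s ^+ k * F k x) by exact: cintegrableZ.
have [ip cp] := cintegral_sum isF.
pose p x := (1 + w s x / N) ^+ n.+1.
have pF : p = fun x => \sum_(k < n.+2) s ^+ k * F k x by apply/funext => x; exact: pE.
have {}ip : cintegrable mu p by rewrite pF.
have -> : (\poly_(k < n.+2) cintegral mu (F (inord k))).[s] = cintegral mu p.
  rewrite horner_poly pF cp; apply: eq_bigr => k _.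
  by rewrite cintegralZ// inord_val mulrC.
have ip' := cintegrableZ (-1) ip.
have -> : cintegral mu (fun x => cexp (w s x)) - cintegral mu p =
    cintegral mu (fun x => cexp (w s x) + (-1) * p x).
  by rewrite cintegralD ?cintegralZ ?mulN1r//; exact: cintegrable_cexp.
have i2 := exp_int K0.
apply: (le_trans (modc_cintegral_le (cintegrableD (cintegrable_cexp s) ip')
  (integrable_scale (16 / n.+1%:R) i2) _)).
  move=> x; rewrite mulN1r (le_trans (cexp_approx _ _))// mulrAC.
  by rewrite ler_pM2l ?divr_gt0// ler_expR -mulrA ler_pM2l// modc_w.
rewrite RintegralZl// -/I.
rewrite ltr_pdivrMr// in nI; have h := ltW nI.
apply: (@le_trans _ _ (32 * `|I| / n.+1%:R)).
  have -> : 2 * (16 / n.+1%:R * I) = 32 * I / n.+1%:R by ring.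
  by rewrite ler_wpM2r ?invr_ge0// ler_pM2l// ler_norm.
by rewrite ler_pdivrMr// [e * _]mulrC.
Qed.

End LaplaceEntire.

(** * Complex lines in C^n *)

Section ComplexVectors.
Context {R : realType} {n : nat}.
Local Notation V := (n.-tuple R).
Local Notation W := (n.-tuple R[i]).
Implicit Types (u x y t m : V) (a b z : W) (s : R[i]).

(** Restriction to such lines reduces functions of several complex variables to entire functions of
    one. *)
Definition cline a b s : W := [tuple tnth a i + s * tnth b i | i < n].
Definition czero : W := [tuple 0 | i < n].
Definition real_vec u : W := [tuple (tnth u i)%:C | i < n].
Definition imag_vec u : W := [tuple 0 +i* tnth u i | i < n].
Definition vscale (k : R) u : V := [tuple k * tnth u i | i < n].
Definition vzero : V := [tuple 0 | i < n].

Lemma cdot_cline a b s x : cdot (cline a b s) x = cdot a x + s * cdot b x.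
Proof.
rewrite /cdot big_distrr -big_split /=; apply: eq_bigr => i _.
by rewrite tnth_mktuple; ring.
Qed.

Lemma cdot_czero x : cdot czero x = 0.
Proof. by rewrite /cdot big1// => i _; rewrite tnth_mktuple mul0r. Qed.

Lemma cdot_real u x : cdot (real_vec u) x = (vdot u x)%:C.
Proof.
rewrite /cdot /vdot rmorph_sum; apply: eq_bigr => i _.
by rewrite tnth_mktuple rmorphM.
Qed.

Lemma cdot_imag u x : cdot (imag_vec u) x = 0 +i* vdot u x.
Proof.
rewrite /cdot /vdot; apply: complex_ext; rewrite ?Re_sum ?Im_sum /=.
  by rewrite big1// => i _; rewrite tnth_mktuple /=; ring.
by apply: eq_bigr => i _; rewrite tnth_mktuple /=; ring.
Qed.

Lemma vdot_vscale (k : R) u x : vdot (vscale k u) x = k * vdot u x.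
Proof.
rewrite /vdot big_distrr /=; apply: eq_bigr => i _.
by rewrite tnth_mktuple mulrA.
Qed.

Lemma vdot_vzero x : vdot vzero x = 0.
Proof. by rewrite /vdot big1// => i _; rewrite tnth_mktuple mul0r. Qed.

Lemma cline_czero_real u (k : R) : cline czero (real_vec u) k%:C = real_vec (vscale k u).
Proof.
by apply: eq_from_tnth => i; rewrite !tnth_mktuple; apply: complex_ext => /=; ring.
Qed.

Lemma cline_czero_imag u (k : R) : cline czero (imag_vec u) k%:C = imag_vec (vscale k u).
Proof.
by apply: eq_from_tnth => i; rewrite !tnth_mktuple; apply: complex_ext => /=; ring.
Qed.

Lemma cline1 a : cline czero a 1 = a.
Proof. by apply: eq_from_tnth => i; rewrite !tnth_mktuple; ring. Qed.

Lemma cline0 a b : cline a b 0 = a.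
Proof. by apply: eq_from_tnth => i; rewrite !tnth_mktuple; ring. Qed.

Lemma cline_cst a s : cline a czero s = a.
Proof. by apply: eq_from_tnth => i; rewrite !tnth_mktuple; ring. Qed.

Lemma cline_real_imag u s : cline czero (real_vec u) s = cline czero (imag_vec u) (s * (0 -i* 1)).
Proof.
apply: eq_from_tnth => i; rewrite !tnth_mktuple; case: s => p q.
by apply: complex_ext => /=; ring.
Qed.

Lemma imag_vec_real u : imag_vec u = cline czero (real_vec u) (0 +i* 1).
Proof.
apply: eq_from_tnth => i; rewrite !tnth_mktuple.
by apply: complex_ext => /=; ring.
Qed.

Lemma imag_vec_zero : imag_vec vzero = czero.
Proof. by apply: eq_from_tnth => i; rewrite !tnth_mktuple. Qed.

(** The line starts at an imaginary vector and has an imaginary direction, so its real parameters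
    give imaginary vectors, while the parameter -i gives [z]. A function null on imaginary vectors
    is thus null at [z] by one continuation. *)
Lemma cvec_decomp z : exists x y, z = cline (imag_vec y) (imag_vec x) (0 -i* 1) /\
  forall k : R, cline (imag_vec y) (imag_vec x) k%:C = imag_vec (vadd y (vscale k x)).
Proof.
exists [tuple complex.Re (tnth z i) | i < n], [tuple complex.Im (tnth z i) | i < n].
split; first by apply: eq_from_tnth => i; rewrite !tnth_mktuple; apply: complex_ext => /=; ring.
move=> k; apply: eq_from_tnth => i; rewrite !tnth_mktuple.
by apply: complex_ext => /=; ring.
Qed.

Lemma modc_cdot z x : modc (cdot z x) <= (\sum_(i < n) modc (tnth z i)) * \sum_(i < n) `|tnth x i|.
Proof.
rewrite (le_trans (modc_sum _ _ _))// big_distrl /= ler_sum// => i _.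
rewrite modcM modc_real ler_wpM2l ?modc_ge0//.
by rewrite (bigD1 i)//= lerDl sumr_ge0.
Qed.

Lemma cmeasurable_cdot d (T : measurableType d) z (f : T -> V) : measurable_fun setT f ->
  cmeasurable (fun w => cdot z (f w)).
Proof.
move=> /measurable_fun_tnthP mf; split.
  under eq_fun do rewrite /cdot Re_sum.
  apply: measurable_sum => i; under eq_fun do rewrite ReM.
  by apply: measurable_funB; apply: measurable_funM => //; exact: mf.
under eq_fun do rewrite /cdot Im_sum.
apply: measurable_sum => i; under eq_fun do rewrite ImM.
by apply: measurable_funD; apply: measurable_funM => //; exact: mf.
Qed.

Lemma vdot_basis (i : 'I_n) (c : R) x :
  vdot [tuple if j == i then c else 0 | j < n] x = c * tnth x i.
Proof.
rewrite /vdot (bigD1 i)//= tnth_mktuple eqxx big1 ?addr0// => j /negPf ji.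
by rewrite tnth_mktuple ji mul0r.
Qed.

Definition norm1 (x : V * V) : R := \sum_j `|pair_coord j x|.

Lemma norm1E (x : V * V) : norm1 x = \sum_(i < n) `|tnth x.1 i| + \sum_(i < n) `|tnth x.2 i|.
Proof. by rewrite /norm1 big_sumType. Qed.

End ComplexVectors.

(** * Exponential moments and entireness of [Phi] along lines *)

Section ExponentialMoments.
Context {R : realType} {n : nat}.
Local Notation V := (n.-tuple R).
Variable Q : probability (V * V)%type R.

Definition exp_moments := forall u : V,
  Q.-integrable setT (EFin \o (fun x => expR (vdot u x.1))) /\
  Q.-integrable setT (EFin \o (fun x => expR (vdot u x.2))).

Hypothesis em : exp_moments.

Lemma measurable_norm1 : measurable_fun setT (@norm1 R n).
Proof.
apply: measurable_sum => j; apply: (measurableT_comp (@normr_measurable R setT)).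
exact: measurable_pair_coord.
Qed.

Lemma integrable_exp_coord j (c : R) :
  Q.-integrable setT (EFin \o (fun x => expR (c * pair_coord j x))).
Proof.
case: j => i /=.
  have [+ _] := em [tuple if j == i then c else 0 | j < n].
  by under eq_fun do rewrite vdot_basis.
have [_] := em [tuple if j == i then c else 0 | j < n].
by under eq_fun do rewrite vdot_basis.
Qed.

(** The l1 norm is at most the number of coordinates times the largest one, and the exponential of
    an absolute value is at most the sum of two exponentials. Joint exponential moments thus follow
    from those of the marginals. *)
Lemma expR_norm1_le (c : R) (x : V * V) : 0 <= c ->
  expR (c * norm1 x) <= 1 + \sum_j (expR (c * (n + n)%:R * pair_coord j x) + expR (- (c * (n + n)%:R) * pair_coord j x)).
Proof.
move=> c0; set N := (n + n)%:R : R.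
(* In dimension 0 there is no coordinate to choose, and the summand 1 carries the bound. *)
have [j0|nJ] := pselect (exists j : 'I_n + 'I_n, True); last first.
  rewrite /norm1 !big1 ?mulr0 ?expR0 ?addr0// => j _; exfalso; apply: nJ; by exists j.
have [j jP] : exists j, norm1 x <= N * `|pair_coord j x|.
  have [//|nj] := pselect (exists j, norm1 x <= N * `|pair_coord j x|).
  exfalso; have lt j : N * `|pair_coord j x| < norm1 x.
    by rewrite ltNge; apply/negP => h; apply: nj; exists j.
  have : \sum_j (N * `|pair_coord j x|) < \sum_(j : 'I_n + 'I_n) norm1 x.
    have [j _] := j0; rewrite (bigD1 j)//= [ltRHS](bigD1 j)//=.
    by apply: ltr_leD => //; apply: ler_sum => k _; exact: ltW.
  by rewrite -big_distrr /= -/(norm1 x) sumr_const card_sum !card_ord -mulr_natl ltxx.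
apply: (@le_trans _ _ (expR (c * N * `|pair_coord j x|))).
  by rewrite ler_expR -mulrA ler_wpM2l.
rewrite ler_wpDl// (bigD1 j)//= ler_wpDr//.
  by apply: sumr_ge0 => k _; rewrite addr_ge0 ?expR_ge0.
have [h|h] := ger0P (pair_coord j x).
  by rewrite lerDl expR_ge0.
by rewrite mulNr mulrN lerDr expR_ge0.
Qed.

Lemma integrable_exp_norm1 (c : R) : 0 <= c ->
  Q.-integrable setT (EFin \o (fun x => expR (c * norm1 x))).
Proof.
move=> c0; set k := c * (n + n)%:R.
apply: (@integrable_le _ _ _ _ _
  (fun x => 1 + \sum_j (expR (k * pair_coord j x) + expR (- k * pair_coord j x)))).
- apply: (measurableT_comp (@measurable_expR R)).
  by apply: measurable_funM => //; exact: measurable_norm1.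
- have i1 : Q.-integrable setT (EFin \o (fun _ : V * V => 1 : R)).
    apply: (bounded_integrable _ (M := 1)) => [||x]; last by rewrite normr1.
      exact: finite_measure_setT.
    exact: measurable_cst.
  have i2 : Q.-integrable setT (fun x => \sum_(j : 'I_n + 'I_n)
      ((EFin \o (fun x => expR (k * pair_coord j x))) \+ (EFin \o (fun x => expR (- k * pair_coord j x)))) x)%E.
    apply: integrable_sum => // j _; apply: integrableD => //; exact: integrable_exp_coord.
  have := integrableD measurableT i1 i2.
  apply: eq_integrable => // x _ /=.
  by rewrite EFinD -sumEFin; congr (_ + _)%E; apply: eq_bigr.
- by move=> x; rewrite ger0_norm ?expR_ge0// expR_norm1_le.
Qed.

Lemma Phi_lines_entire (a1 b1 a2 b2 : n.-tuple R[i]) :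
  entire (fun s => Phi Q (cline a1 b1 s) (cline a2 b2 s)).
Proof.
pose A x := cdot a1 x.1 + cdot a2 x.2; pose B x := cdot b1 x.1 + cdot b2 x.2.
have mAB a b : cmeasurable (fun x : V * V => cdot a x.1 + cdot b x.2).
  by apply: cmeasurableD; apply: cmeasurable_cdot; [exact: measurable_fst|exact: measurable_snd].
have -> : (fun s => Phi Q (cline a1 b1 s) (cline a2 b2 s)) =
    (fun s => cintegral Q (fun x => cexp (A x + s * B x))).
  apply/funext => s; congr cintegral; apply/funext => x; congr cexp.
  by rewrite !cdot_cline /A /B; ring.
apply: entire_laplace => [||r r0]; [exact: mAB|exact: mAB|].
pose S (z : n.-tuple R[i]) := \sum_(i < n) modc (tnth z i).
have S0 z : 0 <= S z by apply: sumr_ge0 => i _; exact: modc_ge0.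
pose K := S a1 + S a2 + (S b1 + S b2).
have K0 : 0 <= K by rewrite !addr_ge0.
have bound a b x : modc (cdot a x.1 + cdot b x.2) <= (S a + S b) * norm1 x.
  rewrite (le_trans (modcD _ _))// (le_trans (lerD (modc_cdot _ _) (modc_cdot _ _)))//.
  rewrite -/(S a) -/(S b) norm1E.
  have h1 : 0 <= \sum_(i < n) `|tnth x.1 i| by apply: sumr_ge0.
  have h2 : 0 <= \sum_(i < n) `|tnth x.2 i| by apply: sumr_ge0.
  have := mulr_ge0 (S0 a) h2; have := mulr_ge0 (S0 b) h1; lra.
apply: (integrable_le _ (integrable_exp_norm1 (mulr_ge0 r0 K0))).
  apply: (measurableT_comp (@measurable_expR R)); apply: measurable_funM => //.
  by apply: measurable_funD; apply: measurable_modc; exact: mAB.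
move=> x; rewrite ger0_norm ?expR_ge0// ler_expR -mulrA ler_wpM2l//.
rewrite /K mulrDl; apply: lerD; exact: bound.
Qed.

Lemma Phi0 : Phi Q czero czero = 1.
Proof.
rewrite /Phi; under [X in cintegral _ X]eq_fun do rewrite !cdot_czero addr0 cexp0.
rewrite /cintegral /=; apply: complex_ext => /=.
  rewrite Rintegral_cst// mul1r -[RHS]/(fine 1%E); congr fine.
  exact: probability_setT.
by rewrite Rintegral_cst// mul0r.
Qed.

Lemma Phi_charfun (t1 t2 : V) : Phi Q (imag_vec t1) (imag_vec t2) = charfun Q (angle (t1, t2)).
Proof.
rewrite /Phi /charfun; under [X in cintegral _ X]eq_fun do rewrite !cdot_imag.
by apply: complex_ext => /=; apply: eq_Rintegral => x _; rewrite addr0 expR0 mul1r.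
Qed.

Lemma Phi_real (u : V) (k : R) : Phi Q (cline czero (real_vec u) k%:C) czero =
  (\int[Q]_x expR (k * vdot u x.1))%:C.
Proof.
rewrite /Phi.
under [X in cintegral _ X]eq_fun do rewrite cline_czero_real cdot_czero addr0 cdot_real cexp_real vdot_vscale.
by apply: complex_ext => //=; rewrite Rintegral_cst// mul0r.
Qed.

Lemma modc_Phi_le (u : V) (s : R[i]) :
  modc (Phi Q (cline czero (real_vec u) s) czero) <= 2 * \int[Q]_x expR (complex.Re s * vdot u x.1).
Proof.
have i1 : Q.-integrable setT (EFin \o (fun x => expR (complex.Re s * vdot u x.1))).
  by have [+ _] := em (vscale (complex.Re s) u); under eq_fun do rewrite vdot_vscale.
have bound (x : V * V) : modc (cexp (cdot (cline czero (real_vec u) s) x.1 + cdot czero x.2)) <=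
    expR (complex.Re s * vdot u x.1).
  rewrite modc_cexp cdot_cline !cdot_czero cdot_real add0r addr0 ler_expR.
  by case: (s) => p q /=; rewrite mulr0 subr0.
apply: (modc_cintegral_le _ i1 bound).
apply: (cintegrable_le _ i1 bound); apply: cmeasurable_cexp.
by apply: cmeasurableD; apply: cmeasurable_cdot; [exact: measurable_fst|exact: measurable_snd].
Qed.

End ExponentialMoments.

(** * Deconvolution *)

Section EntireIdentities.
Context {R : realType}.
Implicit Types (A B : R[i] -> R[i]).

Lemma entire_real_zero A : entire A -> (forall x : R, A x%:C = 0) -> forall s, A s = 0.
Proof. by move=> eA A0; apply: (identity_theorem eA ltr01) => x _. Qed.

(** By continuity [B] has no zero near 0, so [A] vanishes on a short real interval. Later
    cancellations of entire factors rest on this. *)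
Lemma entire_mul_eq0 A B : entire A -> entire B -> (forall s, A s * B s = 0) ->
  B 0 != 0 -> forall s, A s = 0.
Proof.
move=> eA eB AB B0; have B00 : 0 < modc (B 0) / 2 by rewrite divr_gt0// modc_gt0.
have [d d0 dP] := entire_continuous 0 eB B00.
apply: (identity_theorem eA d0) => x /andP[x0 xd].
have /eqP := AB x%:C; rewrite mulf_eq0 => /orP[/eqP//|/eqP Bx].
have := dP x%:C; rewrite subr0 modc_real gtr0_norm// => /(_ (ltW xd)).
by rewrite Bx sub0r modcN; rewrite -modc_gt0 in B0; move=> h; exfalso; lra.
Qed.

Lemma entire_cexp (k : R[i]) : entire (fun s => cexp (k * s)).
Proof.
move=> r e e0; set K := 16 * expR (2 * (modc k * `|r|)).
have [n nK] : exists n : nat, K / e < n.+1%:R.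
  by exists (Num.truncn (K / e)); rewrite truncnS_gt.
exists ((1 + (k / n.+1%:R)%:P * 'X) ^+ n.+1) => s sr.
have -> : ((1 + (k / n.+1%:R)%:P * 'X) ^+ n.+1).[s] = (1 + k * s / n.+1%:R) ^+ n.+1.
  by rewrite horner_exp !hornerE mulrAC.
rewrite (le_trans (cexp_approx _ _))// ler_pdivrMr//.
rewrite ltr_pdivrMr// in nK; rewrite [leRHS]mulrC (le_trans _ (ltW nK))//.
rewrite ler_pM2l// ler_expR ler_pM2l// modcM ler_wpM2l ?modc_ge0//.
by rewrite (le_trans sr)// ler_norm.
Qed.

End EntireIdentities.

Section CharfunContinuity.
Context d (T : measurableType d) (R : realType) (P : probability T R).
Variable h : T -> R.
Hypothesis mh : measurable_fun setT h.

(** Dominated convergence is a statement about sequences, so a failure of continuity is first turned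
    into points within [1 / (n + 1)] of [s0]. *)
Lemma charfun_scale_continuous (s0 e : R) : 0 < e -> exists2 r : R, 0 < r &
  forall s, `|s - s0| <= r ->
    modc (charfun P (fun x => s * h x) - charfun P (fun x => s0 * h x)) <= e.
Proof.
move=> e0; have [//|nr] := pselect (exists2 r : R, 0 < r & forall s, `|s - s0| <= r ->
    modc (charfun P (fun x => s * h x) - charfun P (fun x => s0 * h x)) <= e).
exfalso.
have /choice[s sP] : forall n : nat, exists s, `|s - s0| <= n.+1%:R^-1 /\
    e < modc (charfun P (fun x => s * h x) - charfun P (fun x => s0 * h x)).
  move=> n; have [//|ns] := pselect (exists s, `|s - s0| <= n.+1%:R^-1 /\
    e < modc (charfun P (fun x => s * h x) - charfun P (fun x => s0 * h x))).
  exfalso; apply: nr; exists (n.+1%:R^-1); first by rewrite invr_gt0.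
  by move=> s sn; rewrite leNgt; apply/negP => es; apply: ns; exists s.
have ss0 : s n @[n --> \oo] --> s0.
  apply/cvgrPdist_le => r r0; exists (Num.truncn r^-1) => // n /= rn.
  have [+ _] := sP n; rewrite distrC => /le_trans; apply.
  rewrite -[leRHS]invrK lef_pV2 ?posrE ?invr_gt0//.
  by rewrite (le_trans (ltW (truncnS_gt _)))// ler_nat ltnS.
have lim (f : R -> R) : continuous f -> (forall y, `|f y| <= 1) ->
    (\int[P]_x f (s n * h x)) @[n --> \oo] --> \int[P]_x f (s0 * h x).
  move=> cf f1; apply: (bounded_cvg_Rintegral _ (M := 1)).
  - exact: finite_measure_setT.
  - move=> n; apply: (measurableT_comp (continuous_measurable_fun cf)).
    by apply: measurable_funM.
  - by move=> n x; exact: f1.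
  - move=> x; have hx : s n * h x @[n --> \oo] --> s0 * h x by apply: cvgMl.
    exact: (cvg_comp _ _ hx (cf _)).
have e20 : 0 < e / 2 by rewrite divr_gt0.
have /cvgrPdist_le/(_ _ e20)[N1 _ h1] := lim cos (@continuous_cos R) cos_bounded.
have /cvgrPdist_le/(_ _ e20)[N2 _ h2] := lim sin (@continuous_sin R) sin_bounded.
have [_] := sP (maxn N1 N2); apply/negP; rewrite -leNgt (le_trans (modc_ReIm _))//=.
rewrite (splitr e) lerD//.
  by rewrite distrC; apply: h1; rewrite /= leq_maxl.
by rewrite distrC; apply: h2; rewrite /= leq_maxr.
Qed.

End CharfunContinuity.

(** * The cross identity and the comparison of zeros *)

Section Deconvolution.
Context {R : realType} {n : nat}.
Local Notation V := (n.-tuple R).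

Definition same_observations (Q : probability (V * V)%type R) (P : probability V R)
    (Q' : probability (V * V)%type R) (P' : probability V R) :=
  forall t : V * V,
    charfun Q (angle t) * (charfun P (vdot t.1) * charfun P (vdot t.2)) =
    charfun Q' (angle t) * (charfun P' (vdot t.1) * charfun P' (vdot t.2)).

Section Cross.
Variables (Q Q' : probability (V * V)%type R) (P P' : probability V R).
Hypotheses (em : exp_moments Q) (em' : exp_moments Q').
Hypothesis obs : same_observations Q P Q' P'.
Implicit Types (t u : V) (z : n.-tuple R[i]).

Lemma Phi_entire_l a b c : entire (fun s => Phi Q (cline a b s) c).
Proof.
have := Phi_lines_entire em a b c czero.
by under [X in entire X -> _]eq_fun do rewrite cline_cst.
Qed.

Lemma charfun_vdot0 (p : probability V R) : charfun p (vdot vzero) = 1.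
Proof.
rewrite /charfun; apply: complex_ext => /=.
  under eq_Rintegral do rewrite vdot_vzero cos0.
  rewrite Rintegral_cst// mul1r -[RHS]/(fine 1%E); congr fine.
  exact: probability_setT.
under eq_Rintegral do rewrite vdot_vzero sin0.
by rewrite Rintegral_cst// mul0r.
Qed.

Lemma charfun_nonzero_near (p : probability V R) t : exists2 r : R, 0 < r &
  forall s : R, `|s| <= r -> charfun p (vdot (vscale s t)) != 0.
Proof.
have half : 0 < 2^-1 :> R by rewrite invr_gt0.
have [r r0 rP] := charfun_scale_continuous p (measurable_vdot t) 0 half.
exists r => // s sr; have := rP s; rewrite subr0 => /(_ sr).
have -> : (fun x => s * vdot t x) = vdot (vscale s t).
  by apply/funext => x; rewrite vdot_vscale.
have -> : (fun x => 0 * vdot t x) = vdot vzero.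
  by apply/funext => x; rewrite mul0r vdot_vzero.
rewrite charfun_vdot0; apply: contraTneq => ->.
by rewrite sub0r modcN modc1 -ltNge invf_lt1// ltr1n.
Qed.

Lemma obs_marginal t :
  Phi Q (imag_vec t) czero * charfun P (vdot t) = Phi Q' (imag_vec t) czero * charfun P' (vdot t).
Proof.
have := obs (t, vzero); rewrite /= !charfun_vdot0 !mulr1.
by rewrite -!Phi_charfun imag_vec_zero.
Qed.

End Cross.

Section CrossZeros.
Variables (Q Q' : probability (V * V)%type R) (P P' : probability V R).
Hypotheses (em : exp_moments Q) (em' : exp_moments Q').
Hypothesis obs : same_observations Q P Q' P'.
Implicit Types (t u : V) (z : n.-tuple R[i]).

(** Along small real multiples of [t1] and [t2] the characteristic function of [P'] is nonzero and
    can be divided out. The resulting identity is entire in the multiplier, hence holds at 1, where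
    the noise may vanish. *)
Lemma cross_imag t1 t2 :
  Phi Q (imag_vec t1) (imag_vec t2) * (Phi Q' (imag_vec t1) czero * Phi Q' (imag_vec t2) czero) =
  Phi Q' (imag_vec t1) (imag_vec t2) * (Phi Q (imag_vec t1) czero * Phi Q (imag_vec t2) czero).
Proof.
have [r1 r10 p1] := charfun_nonzero_near P' t1.
have [r2 r20 p2] := charfun_nonzero_near P' t2.
pose L t s : n.-tuple R[i] := cline czero (imag_vec t) s.
pose H s := Phi Q (L t1 s) (L t2 s) * (Phi Q' (L t1 s) czero * Phi Q' (L t2 s) czero) -
  Phi Q' (L t1 s) (L t2 s) * (Phi Q (L t1 s) czero * Phi Q (L t2 s) czero).
have eH : entire H.
  apply: entireB; apply: entireM.
  - exact: Phi_lines_entire.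
  - by apply: entireM; exact: Phi_entire_l.
  - exact: Phi_lines_entire.
  - by apply: entireM; exact: Phi_entire_l.
suff H0 : forall s, H s = 0.
  by apply/eqP; rewrite -subr_eq0; have := H0 1; rewrite /H /L !cline1 => ->.
have r0 : 0 < Num.min r1 r2 by rewrite lt_min r10.
apply: (identity_theorem eH r0) => x /andP[x0]; rewrite lt_min => /andP[x1 x2].
have {}p1 : charfun P' (vdot (vscale x t1)) != 0 by apply: p1; rewrite gtr0_norm// ltW.
have {}p2 : charfun P' (vdot (vscale x t2)) != 0 by apply: p2; rewrite gtr0_norm// ltW.
rewrite /H /L !cline_czero_imag.
have := obs (vscale x t1, vscale x t2); rewrite -!Phi_charfun /=.
have := obs_marginal obs (vscale x t1); have := obs_marginal obs (vscale x t2).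
move: p1 p2.
set c1 := charfun P _; set c2 := charfun P _; set d1 := charfun P' _; set d2 := charfun P' _.
set F2 := Phi Q _ _; set G2 := Phi Q' _ _; set F1 := Phi Q _ _; set G1 := Phi Q' _ _.
set F := Phi Q _ _; set G := Phi Q' _ _.
move=> d10 d20 E2 E1 E12; apply/eqP; rewrite subr_eq0; apply/eqP.
apply: (mulIf (mulf_neq0 d10 d20)).
transitivity (F * ((G1 * d1) * (G2 * d2))); first by ring.
rewrite -E1 -E2.
transitivity ((F * (c2 * c1)) * (F1 * F2)); first by ring.
by rewrite E12; ring.
Qed.

(** The condition on null sections is a disjunction over the two arguments, so both orders have to
    be refuted; the boolean treats them together. *)
Definition Phi_swap (b : bool) (q : probability (V * V)%type R) z1 z2 :=
  if b then Phi q z1 z2 else Phi q z2 z1.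

Lemma Phi_swap_lines_entire b q a1 b1 a2 b2 : exp_moments q ->
  entire (fun s => Phi_swap b q (cline a1 b1 s) (cline a2 b2 s)).
Proof. by case: b => eq; exact: Phi_lines_entire. Qed.

Lemma Phi_swap_entire_l b q a1 b1 c : exp_moments q ->
  entire (fun s => Phi_swap b q (cline a1 b1 s) c).
Proof.
move=> eq; have := Phi_swap_lines_entire b a1 b1 c czero eq.
by under [X in entire X -> _]eq_fun do rewrite cline_cst.
Qed.

Lemma Phi_swap_entire_r b q a1 b1 c : exp_moments q ->
  entire (fun s => Phi_swap b q c (cline a1 b1 s)).
Proof.
move=> eq; have := Phi_swap_lines_entire b c czero a1 b1 eq.
by under [X in entire X -> _]eq_fun do rewrite cline_cst.
Qed.

(** Only the first argument is continued here, after a rotation of the parameter by -i that makes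
    the direction imaginary. The second stays imaginary until a zero on the line has been fixed. *)
Lemma cross_line b u t s :
  Phi_swap b Q (cline czero (real_vec u) s) (imag_vec t) *
    (Phi Q' (cline czero (real_vec u) s) czero * Phi Q' (imag_vec t) czero) =
  Phi_swap b Q' (cline czero (real_vec u) s) (imag_vec t) *
    (Phi Q (cline czero (real_vec u) s) czero * Phi Q (imag_vec t) czero).
Proof.
rewrite cline_real_imag; move: (s * _) => {}s.
apply/eqP; rewrite -subr_eq0; apply/eqP; move: s; apply: entire_real_zero.
  apply: entireB; apply: entireM.
  - exact: Phi_swap_entire_l.
  - by apply: entireM; [exact: Phi_entire_l|exact: entire_cst].
  - exact: Phi_swap_entire_l.
  - by apply: entireM; [exact: Phi_entire_l|exact: entire_cst].
move=> x; rewrite cline_czero_imag; apply/eqP; rewrite subr_eq0; apply/eqP.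
case: b => /=; first exact: cross_imag.
by rewrite mulrC [_ * Phi Q' _ czero]mulrC mulrC cross_imag [Phi Q _ czero * _]mulrC.
Qed.

Let f (q : probability (V * V)%type R) u s := Phi q (cline czero (real_vec u) s) czero.

(** Once the common factor [zpoly l] is cancelled from the cross identity, its right side still
    carries [f1] and its left side [g1]. At a zero of [f1] where [g1] is nonzero, the section of
    [Phi Q] times the marginal of [Q'] vanishes on imaginary vectors. That marginal is 1 at 0, so
    the section itself is null, in both orders. *)
Lemma zeros_below_Phi u : nowhere_null_sections Q -> zeros_below (f Q u) (f Q' u).
Proof.
move=> nnQ l f1 g1 ef1 eg1 fE gE a fa0.
apply/eqP/negPn/negP => ga0.
pose z0 := cline czero (real_vec u) a.
(* The transform is 1 at 0, so none of the divided zeros is 0, and [zpoly l] can be cancelled. *)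
have l0 : zpoly l 0 != 0.
  have := fE 0; rewrite /f cline0 Phi0 => h.
  by apply: contraTneq isT => l0; move/eqP: h; rewrite l0 mul0r oner_eq0.
suff null b z : Phi_swap b Q z0 z = 0.
  by have [] := nnQ z0; apply; apply/funext => z; [exact: (null true)|exact: (null false)].
have prod0 t : Phi_swap b Q z0 (imag_vec t) * Phi Q' (imag_vec t) czero = 0.
  pose W s := Phi_swap b Q (cline czero (real_vec u) s) (imag_vec t) * (g1 s * Phi Q' (imag_vec t) czero) -
    Phi_swap b Q' (cline czero (real_vec u) s) (imag_vec t) * (f1 s * Phi Q (imag_vec t) czero).
  have eW : entire W.
    apply: entireB; apply: entireM.
    - exact: Phi_swap_entire_l.
    - by apply: entireM => //; exact: entire_cst.
    - exact: Phi_swap_entire_l.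
    - by apply: entireM => //; exact: entire_cst.
  have W0 s : W s = 0.
    move: s; apply: (entire_mul_eq0 eW (entire_zpoly l)) => // s.
    have := cross_line b u t s; rewrite -/(f Q u s) -/(f Q' u s) fE gE => /eqP.
    by rewrite -subr_eq0 => /eqP <-; rewrite /W; ring.
  have := W0 a; rewrite /W fa0 mul0r mulr0 subr0 -/z0 => /eqP.
  rewrite mulrCA mulf_eq0 => /orP[/eqP ga|/eqP//].
  by rewrite ga eqxx in ga0.
(* The marginal factor may vanish at [t] itself; it is cancelled along the line from 0 to
   [imag_vec t]. *)
have zero_imag t : Phi_swap b Q z0 (imag_vec t) = 0.
  rewrite -[imag_vec t]cline1.
  apply: (@entire_mul_eq0 _ (fun s => Phi_swap b Q z0 (cline czero (imag_vec t) s))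
    (fun s => Phi Q' (cline czero (imag_vec t) s) czero)).
  - exact: Phi_swap_entire_r.
  - exact: Phi_entire_l.
  - apply: entire_real_zero.
      by apply: entireM; [exact: Phi_swap_entire_r|exact: Phi_entire_l].
    by move=> x; rewrite cline_czero_imag prod0.
  - by rewrite cline0 Phi0 oner_eq0.
have [x [y [-> zE]]] := cvec_decomp z.
apply: (@entire_real_zero _ (fun s => Phi_swap b Q z0 (cline (imag_vec y) (imag_vec x) s))).
  exact: Phi_swap_entire_r.
by move=> k; rewrite zE zero_imag.
Qed.

End CrossZeros.

End Deconvolution.

(** * The real Laplace transform near 0 and the mean *)

Section LaplaceMean.
Context {R : realType} {n : nat}.
Local Notation V := (n.-tuple R).
Variable Q : probability (V * V)%type R.
Hypothesis em : exp_moments Q.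
Implicit Types (u : V) (k : R).

Definition laplace1 u k : R := \int[Q]_x expR (k * vdot u x.1).
Definition mean1 : V := [tuple \int[Q]_x (tnth x.1 i) | i < n].

Lemma integrable_exp_vdot u k : Q.-integrable setT (EFin \o (fun x => expR (k * vdot u x.1))).
Proof. by have [+ _] := em (vscale k u); under eq_fun do rewrite vdot_vscale. Qed.

Lemma integrable_vdot u : Q.-integrable setT (EFin \o (fun x : V * V => vdot u x.1)).
Proof.
have ih : Q.-integrable setT (EFin \o (fun x : V * V => expR (1 * vdot u x.1) + expR (-1 * vdot u x.1))).
  exact: (integrableD measurableT (integrable_exp_vdot u 1) (integrable_exp_vdot u (-1))).
apply: (integrable_le _ ih).
  by apply: measurableT_comp => //; exact: measurable_vdot.
move=> x; rewrite mul1r mulN1r; set y := vdot u x.1.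
have h1 := @expR_ge1Dx R y; have h2 := @expR_ge1Dx R (- y).
have := expR_ge0 y; have := expR_ge0 (- y).
by rewrite ler_norml => ? ?; apply/andP; split; lra.
Qed.

Lemma integrable_coord1 i : Q.-integrable setT (EFin \o (fun x : V * V => tnth x.1 i)).
Proof.
have := integrable_vdot [tuple if j == i then 1 else 0 | j < n].
by under [X in EFin \o X]eq_fun do rewrite vdot_basis mul1r.
Qed.

Lemma Rintegral_vdot u : \int[Q]_x vdot u x.1 = vdot u mean1.
Proof.
rewrite /vdot /Rintegral; under eq_integral do rewrite -sumEFin.
rewrite integral_sum//; last by move=> i; exact: integrable_scale (integrable_coord1 i).
rewrite -sum_fine; last first.
  by move=> i _; apply: integrable_fin_num => //; exact: integrable_scale (integrable_coord1 i).
apply: eq_bigr => i _; rewrite tnth_mktuple -RintegralZl//.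
exact: integrable_coord1.
Qed.

Lemma integrable_cst (c : R) : Q.-integrable setT (EFin \o (fun _ : V * V => c)).
Proof.
by apply: (bounded_integrable _ (M := `|c|)) => //; exact: finite_measure_setT.
Qed.

Lemma Rintegral_prob_cst (c : R) : \int[Q]_x c = c.
Proof.
rewrite Rintegral_cst// -[RHS]mulr1; congr (_ * _); rewrite -[RHS]/(fine 1%E); congr fine.
exact: probability_setT.
Qed.

(* Jensen's inequality, from the tangent line of [expR] at the mean. *)
Lemma laplace1_ge u k : expR (k * vdot u mean1) <= laplace1 u k.
Proof.
set c := vdot u mean1.
have i1 := integrable_scale (k * expR (k * c)) (integrable_vdot u).
have i2 := integrable_cst (expR (k * c) * (1 - k * c)).
apply: (@le_trans _ _ (\int[Q]_x (expR (k * c) * (1 - k * c) + k * expR (k * c) * vdot u x.1))).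
  rewrite RintegralD// Rintegral_prob_cst RintegralZl//; last exact: integrable_vdot.
  by rewrite Rintegral_vdot -/c le_eqVlt; apply/orP; left; apply/eqP; ring.
apply: le_Rintegral => //; first exact: (integrableD measurableT i2 i1).
  exact: integrable_exp_vdot.
move=> x _; set y := vdot u x.1.
have -> : k * y = k * c + k * (y - c) by ring.
rewrite expRD; have -> : expR (k * c) * (1 - k * c) + k * expR (k * c) * y =
  expR (k * c) * (1 + k * (y - c)) by ring.
by rewrite ler_wpM2l ?expR_ge0// expR_ge1Dx.
Qed.

Lemma laplace1_gt0 u k : 0 < laplace1 u k.
Proof. exact: lt_le_trans (expR_gt0 _) (laplace1_ge u k). Qed.

(** A second-order Taylor bound whose remainder is dominated by the moments at [2 * u] and
    [- 2 * u], since [y^2] is at most [4 * expR |y|]. Together with [laplace1_ge] it replaces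
    differentiation at 0. *)
Lemma laplace1_le u : exists K : R, forall k, `|k| <= 1 ->
  laplace1 u k <= 1 + k * vdot u mean1 + k ^+ 2 * K.
Proof.
pose h (x : V * V) := 4 * (expR (2 * vdot u x.1) + expR (- 2 * vdot u x.1)).
have ih : Q.-integrable setT (EFin \o h).
  apply: integrable_scale.
  exact: (integrableD measurableT (integrable_exp_vdot u 2) (integrable_exp_vdot u (- 2))).
exists (\int[Q]_x h x) => k k1.
have i1 := integrable_scale k (integrable_vdot u).
have i2 := integrable_cst 1.
have i3 := integrable_scale (k ^+ 2) ih.
apply: (@le_trans _ _ (\int[Q]_x (1 + k * vdot u x.1 + k ^+ 2 * h x))); last first.
  rewrite le_eqVlt; apply/orP; left; apply/eqP.
  rewrite RintegralD//; last exact: (integrableD measurableT i2 i1).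
  rewrite RintegralD// Rintegral_prob_cst; congr (_ + _ + _).
    by rewrite RintegralZl ?Rintegral_vdot//; exact: integrable_vdot.
  by rewrite RintegralZl.
apply: le_Rintegral => //; first exact: integrable_exp_vdot.
  exact: (integrableD measurableT (integrableD measurableT i2 i1) i3).
move=> x _; rewrite /h; set y := vdot u x.1.
have /andP[_ h1] := expR_sub1x_le (k * y).
have h2 : expR `|k * y| <= expR `|y|.
  by rewrite ler_expR normrM ler_piMl.
have h3 := sqr_le_expR (normr_ge0 y); rewrite real_normK ?num_real// in h3.
have h4 : expR `|y| * expR `|y| <= expR (2 * y) + expR (- 2 * y).
  rewrite -expRD; have [y0|y0] := ger0P y.
    by rewrite (_ : y + y = 2 * y) ?lerDl ?expR_ge0//; ring.
  by rewrite (_ : - y - y = - 2 * y) ?lerDr ?expR_ge0//; ring.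
have e0 := expR_ge0 `|y|.
have h5 : y ^+ 2 * expR `|y| <= 4 * (expR (2 * y) + expR (- 2 * y)).
  rewrite (le_trans (ler_wpM2r e0 h3))// -mulrA ler_pM2l//.
have h6 : (k * y) ^+ 2 * expR `|k * y| <= k ^+ 2 * (4 * (expR (2 * y) + expR (- 2 * y))).
  rewrite exprMn -mulrA ler_wpM2l ?sqr_ge0// (le_trans _ h5)//.
  by rewrite ler_wpM2l ?sqr_ge0.
by lra.
Qed.

End LaplaceMean.

(** * Identification of the translation *)

Section DeconvolutionUnique.
Context {R : realType} {n : nat}.
Local Notation V := (n.-tuple R).
Implicit Types (t u x m : V).

Lemma vdot_vsub t x m : vdot t (vsub x m) = vdot t x - vdot t m.
Proof.
rewrite /vdot -sumrB; apply: eq_bigr => i _.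
by rewrite tnth_mktuple mulrBr.
Qed.

Lemma charfun_addc d (T : measurableType d) (mu : {measure set T -> \bar R}) (h : T -> R) (c : R) :
  (mu setT < +oo)%E -> measurable_fun setT h ->
  charfun mu (fun y => h y + c) = charfun mu h * cexp (0 +i* c).
Proof.
move=> mufin mh; rewrite cexp_imag; apply: complex_ext.
  by rewrite ReM /= -charfun_shift.
rewrite ImM /=; under eq_Rintegral do rewrite -cosBpihalf -addrA.
by rewrite charfun_shift// cosBpihalf sinBpihalf /=; ring.
Qed.

Lemma charfun_prod (P : probability V R) (t : V * V) :
  charfun (P \x P)%E (angle t) = charfun P (vdot t.1) * charfun P (vdot t.2).
Proof.
pose X : {mfun (V * V)%type >-> V} := mfun_Sub (mem_set (@measurable_fst _ _ V V)).
pose Y : {mfun (V * V)%type >-> V} := mfun_Sub (mem_set (@measurable_snd _ _ V V)).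
apply: (@indep_charfun _ _ _ _ _ _ _ (P \x P)%E X Y P P); last 2 first.
- exact: measurable_vdot.
- exact: measurable_vdot.
move=> A B mA mB; rewrite -product_measure1E//; congr ((P \x P)%E _).
Qed.

Lemma linear_coef_eq0 (D K : R) : (forall k : R, `|k| <= 1 -> D * k <= k ^+ 2 * K) -> D = 0.
Proof.
move=> h; apply/eqP/negPn/negP => D0.
(* With S the denominator, the inequality at this point amounts to [S <= K], whereas [S > |K|]. The
   term [|D|] in S ensures [|k| <= 1]. *)
pose k := D / (`|D| + `|K| + 1).
have d0 : 0 < `|D| by rewrite normr_gt0.
have s0 : 0 < `|D| + `|K| + 1 by rewrite ltr_wpDl// addr_ge0.
have k1 : `|k| <= 1.
  rewrite normrM normfV (gtr0_norm s0) ler_pdivrMr// mul1r -addrA lerDl.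
  by rewrite addr_ge0.
have := h k k1; rewrite {1 2}/k expr_div_n mulrA -expr2.
rewrite -subr_ge0; apply/negP; rewrite -ltNge subr_lt0.
have D2 : 0 < D ^+ 2 by rewrite exprn_even_gt0.
rewrite mulrAC ltr_pdivrMr ?exprn_gt0//.
rewrite (_ : D ^+ 2 / _ * _ = D ^+ 2 * (`|D| + `|K| + 1)); last first.
  by rewrite expr2; field; rewrite gt_eqF.
rewrite ltr_pM2l// (le_lt_trans (ler_norm K))//; lra.
Qed.

Variables (Q Q' : probability (V * V)%type R) (P P' : probability V R).
Hypotheses (em : exp_moments Q) (em' : exp_moments Q').
Hypothesis obs : same_observations Q P Q' P'.
Hypotheses (nn : nowhere_null_sections Q) (nn' : nowhere_null_sections Q').
Hypothesis ord : forall u, order_below_two (fun s => Phi Q (cline czero (real_vec u) s) czero).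
Hypothesis ord' : forall u, order_below_two (fun s => Phi Q' (cline czero (real_vec u) s) czero).

Let m := vsub (mean1 Q) (mean1 Q').

(** The quotient is an exponential of unknown slope [c]. Jensen's lower bound for [Q'] and the
    quadratic upper bound for [Q] give [(c - vdot u m) * x <= K * x^2] for small [x] of both signs,
    which forces the slope. *)
Lemma laplace1_ratio u k : laplace1 Q u k = expR (vdot u m * k) * laplace1 Q' u k.
Proof.
have obs' : same_observations Q' P' Q P by move=> t; rewrite obs.
have [||||c cP] := entire_ratio_expR (Phi_entire_l em czero (real_vec u) czero)
  (Phi_entire_l em' czero (real_vec u) czero) _ _
  (zeros_below_Phi em em' obs nn) (zeros_below_Phi em' em obs' nn')
  (ord u) (ord' u) (laplace1_gt0 em u) (laplace1_gt0 em' u).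
- by rewrite cline0 Phi0.
- by rewrite cline0 Phi0.
- by move=> x; rewrite Phi_real.
- by move=> x; rewrite Phi_real.
rewrite cP; congr (expR (_ * k) * _).
apply/eqP; rewrite -subr_eq0 /m vdot_vsub; apply/eqP.
have [K KP] := laplace1_le em u.
apply: (@linear_coef_eq0 _ K) => x x1.
have h1 := KP x x1; rewrite cP in h1.
have h2 := laplace1_ge em' u x.
have h3 : expR (c * x) * expR (x * vdot u (mean1 Q')) <= 1 + x * vdot u (mean1 Q) + x ^+ 2 * K.
  by rewrite (le_trans _ h1)// ler_wpM2l ?expR_ge0.
rewrite -expRD in h3.
have := @expR_ge1Dx R (c * x + x * vdot u (mean1 Q')).
lra.
Qed.

(** Both sides are entire along the direction [t] and agree at real parameters; the claim is their
    equality at the parameter i. *)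
Lemma Phi_imag_ratio t : Phi Q (imag_vec t) czero =
  cexp (0 +i* vdot t m) * Phi Q' (imag_vec t) czero.
Proof.
rewrite imag_vec_real.
have -> : 0 +i* vdot t m = (vdot t m)%:C * (0 +i* 1) by apply: complex_ext => /=; ring.
move: (0 +i* 1) => s; apply/eqP; rewrite -subr_eq0; apply/eqP; move: s.
apply: entire_real_zero.
  apply: entireB; first exact: Phi_entire_l.
  by apply: entireM; [exact: entire_cexp|exact: Phi_entire_l].
move=> k; rewrite !Phi_real -rmorphM cexp_real -rmorphM -rmorphB.
by rewrite -/(laplace1 Q t k) laplace1_ratio subrr.
Qed.

(** Inserting the ratio of the marginals into the cross identity leaves the product of the marginals
    of [Q'] as a common factor. It is entire in a common multiplier of [t1] and [t2] and equals 1 at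
    0, so it cancels. *)
Lemma signal_charfun_shift t1 t2 : charfun Q (angle (t1, t2)) =
  cexp (0 +i* (vdot t1 m + vdot t2 m)) * charfun Q' (angle (t1, t2)).
Proof.
pose c := vdot t1 m + vdot t2 m.
pose L t s : n.-tuple R[i] := cline czero (imag_vec t) s.
pose A s := Phi Q (L t1 s) (L t2 s) - cexp ((0 +i* c) * s) * Phi Q' (L t1 s) (L t2 s).
pose B s := Phi Q' (L t1 s) czero * Phi Q' (L t2 s) czero.
have eA : entire A.
  apply: entireB; first exact: Phi_lines_entire.
  by apply: entireM; [exact: entire_cexp|exact: Phi_lines_entire].
have eB : entire B by apply: entireM; exact: Phi_entire_l.
have : A 1 = 0.
  apply: (entire_mul_eq0 eA eB); last by rewrite /B /L !cline0 !Phi0 mulr1 oner_eq0.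
  apply: entire_real_zero; first exact: entireM.
  move=> x; rewrite /A /B /L !cline_czero_imag.
  have := cross_imag em em' obs (vscale x t1) (vscale x t2).
  rewrite !Phi_imag_ratio !vdot_vscale.
  have -> : cexp ((0 +i* c) * x%:C) = cexp (0 +i* (x * vdot t1 m)) * cexp (0 +i* (x * vdot t2 m)).
    by rewrite -cexpD; congr cexp; apply: complex_ext; rewrite /= /c; ring.
  by move=> /eqP; rewrite -subr_eq0 => /eqP <-; ring.
rewrite /A /L !cline1 mulr1 !Phi_charfun => /eqP.
by rewrite subr_eq0 => /eqP.
Qed.

(** The marginal identity yields the relation only where [Phi Q'] is nonzero. If the two sides
    differed at [t], continuity would keep them apart at nearby multiples of [t]. Then [Phi Q']
    would vanish on an interval of that line, hence all along it, against its value 1 at 0. *)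
Lemma noise_charfun_shift t : charfun P' (vdot t) = cexp (0 +i* vdot t m) * charfun P (vdot t).
Proof.
have scaleE s : vdot (vscale s t) = fun x => s * vdot t x.
  by apply/funext => x; rewrite vdot_vscale.
have shiftE s : cexp (0 +i* vdot (vscale s t) m) * charfun P (vdot (vscale s t)) =
    charfun P (fun x => s * (vdot t x + vdot t m)).
  rewrite mulrC -charfun_addc; last exact: measurable_vdot.
    by congr charfun; apply/funext => x; rewrite !vdot_vscale mulrDr.
  exact: finite_measure_setT.
have vscale1 : t = vscale 1 t by apply: eq_from_tnth => i; rewrite tnth_mktuple mul1r.
apply/eqP; rewrite -subr_eq0; apply/negPn/negP => D0.
set D := _ - _ in D0; have D1 : 0 < modc D / 4 by rewrite divr_gt0// modc_gt0.
have [r1 r10 h1] := charfun_scale_continuous P' (measurable_vdot t) 1 D1.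
have mh : measurable_fun setT (fun x : V => vdot t x + vdot t m).
  by apply: measurable_funD => //; exact: measurable_vdot.
have [r2 r20 h2] := charfun_scale_continuous P mh 1 D1.
have r0 : 0 < Num.min r1 r2 by rewrite lt_min r10.
(* The shift by 1 brings the multiples near [t] to parameters near 0; the origin of the line is then
   the parameter -1. *)
pose g s := Phi Q' (cline czero (imag_vec t) (s + 1)) czero.
have eg : entire g.
  exact: (entire_shift 1 (Phi_entire_l em' czero (imag_vec t) czero)).
have g0 : forall s, g s = 0.
  apply: (identity_theorem eg r0) => x /andP[x0]; rewrite lt_min => /andP[x1 x2].
  have xr1 : `|x + 1 - 1| <= r1 by rewrite addrK gtr0_norm// ltW.
  have xr2 : `|x + 1 - 1| <= r2 by rewrite addrK gtr0_norm// ltW.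
  have {}h1 := h1 _ xr1; have {}h2 := h2 _ xr2.
  rewrite -!scaleE -!shiftE -vscale1 in h1 h2.
  rewrite /g -(rmorph1 (real_complex R)) -rmorphD cline_czero_imag.
  have := obs_marginal obs (vscale (x + 1) t).
  rewrite Phi_imag_ratio; set G := Phi Q' _ _.
  set p := charfun P' (vdot (vscale _ _)) in h1 *.
  set q := _ * charfun P (vdot (vscale _ _)) in h2 *.
  move=> E; have : G * (p - q) = 0.
    by rewrite mulrBr -E /q; ring.
  move=> /eqP; rewrite mulf_eq0 => /orP[/eqP//|].
  rewrite subr_eq0 => /eqP pq; exfalso.
  have DE : D = (q - cexp (0 +i* vdot t m) * charfun P (vdot t)) - (p - charfun P' (vdot t)).
    by rewrite pq /D; ring.
  have : modc D <= modc D / 4 + modc D / 4.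
    by rewrite {1}DE (le_trans (modcB _ _))// lerD.
  have : 0 < modc D by rewrite modc_gt0.
  lra.
have := g0 (-1); rewrite /g addNr cline0 Phi0 => /eqP.
by rewrite oner_eq0.
Qed.

Lemma deconvolution_unique : equal_up_to_translation Q P Q' P'.
Proof.
exists m; split.
- have mX : measurable_fun setT (fun x : V * V => (vsub x.1 m, vsub x.2 m)).
    have ms (h : V * V -> V) : measurable_fun setT h -> measurable_fun setT (fun w => vsub (h w) m).
      move=> /measurable_fun_tnthP mh; apply/measurable_fun_tnthP => i.
      rewrite (_ : _ \o _ = fun w => tnth (h w) i - tnth m i); last first.
        by apply/funext => w /=; rewrite tnth_mktuple.
      by apply: measurable_funB => //; exact: mh.
    by apply: measurable_fun_pair; apply: ms.
  pose X : {mfun (V * V)%type >-> (V * V)%type} := mfun_Sub (mem_set mX).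
  apply: (@charfun_unique _ _ (distribution Q X) Q').
  + exact: finite_measure_setT.
  + exact: finite_measure_setT.
  move=> [t1 t2]; rewrite charfun_distribution; last exact: measurable_angle.
  have -> : (fun w => angle (t1, t2) (X w)) =
      (fun w => angle (t1, t2) w + - (vdot t1 m + vdot t2 m)).
    by apply/funext => w; rewrite /angle /= !vdot_vsub; ring.
  rewrite charfun_addc; last exact: measurable_angle.
    rewrite signal_charfun_shift mulrAC -cexpD.
    have -> : 0 +i* (vdot t1 m + vdot t2 m) + 0 +i* (- (vdot t1 m + vdot t2 m)) = 0 :> R[i].
      by apply: complex_ext => /=; ring.
    by rewrite cexp0 mul1r.
  exact: finite_measure_setT.
- have mX : measurable_fun setT (fun x : V * V => (vadd x.1 m, vadd x.2 m)).
    by apply: measurable_fun_pair; apply: measurable_vadd.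
  pose X : {mfun (V * V)%type >-> (V * V)%type} := mfun_Sub (mem_set mX).
  apply: (@charfun_unique _ _ (distribution (P \x P)%E X) (P' \x P')%E).
  + exact: finite_measure_setT.
  + exact: prod_measure_setT.
  move=> [t1 t2]; rewrite charfun_distribution; last exact: measurable_angle.
  have -> : (fun w => angle (t1, t2) (X w)) =
      (fun w => angle (t1, t2) w + (vdot t1 m + vdot t2 m)).
    by apply/funext => w; rewrite /angle /= !vdotDr; ring.
  rewrite charfun_addc; last exact: measurable_angle.
    rewrite !charfun_prod /= !noise_charfun_shift.
    have -> : 0 +i* (vdot t1 m + vdot t2 m) = 0 +i* vdot t1 m + 0 +i* vdot t2 m :> R[i].
      by apply: complex_ext => /=; ring.
    by rewrite cexpD; ring.
  exact: prod_measure_setT.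
Qed.

End DeconvolutionUnique.

(** * Moments and growth of the signal in the model *)

Section ModelHypotheses.
Context {R : realType}.

Lemma powR_dominated (rho C e : R) : rho < 2 -> 0 <= C -> 0 < e ->
  exists r0 : R, forall r, r0 <= r -> C * r `^ rho <= e * r ^+ 2.
Proof.
move=> rho2 C0 e0; have s0 : 0 < 2 - rho by rewrite subr_gt0.
(* Beyond this radius [r] to the power [2 - rho] is at least [C / e]; the added 1 keeps [r]
   positive. *)
exists (1 + (C / e) `^ (2 - rho)^-1) => r rr.
have h0 : 0 <= (C / e) `^ (2 - rho)^-1 by rewrite powR_ge0.
have r0 : 0 < r by lra.
have -> : r ^+ 2 = r `^ rho * r `^ (2 - rho).
  rewrite -powRD; last by apply/implyP => _; rewrite gt_eqF.
  by rewrite subrKC powR_mulrn// ltW.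
rewrite mulrCA mulrC ler_wpM2l ?powR_ge0//.
rewrite -ler_pdivrMl// mulrC.
have -> : C / e = ((C / e) `^ (2 - rho)^-1) `^ (2 - rho).
  by rewrite -powRrM mulVf ?gt_eqF// powRr1// divr_ge0// ltW.
apply: ge0_ler_powR; rewrite ?nnegrE ?(ltW s0)//; lra.
Qed.

Context {n : nat}.
Local Notation V := (n.-tuple R).

Lemma vnorm_vscale (k : R) (u : V) : vnorm (vscale k u) = `|k| * vnorm u.
Proof.
rewrite /vnorm -sqrtr_sqr -sqrtrM ?sqr_ge0// big_distrr /=; congr Num.sqrt.
by apply: eq_bigr => i _; rewrite tnth_mktuple exprMn.
Qed.

Context (l : nat) (disp : measure_display)
  (Omega : measurableType disp) (Pr : probability Omega R)
  (Z : nat -> {RV Pr >-> l.-tuple R}) (g : {mfun l.-tuple R >-> V})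
  (eps : nat -> {RV Pr >-> V}) (P : probability V R) (rho : R).
Hypothesis model : noisy_stationary_model Z eps P.
Hypothesis rho2 : 0 < rho < 2.
Hypothesis Mrho : Mclass rho (signal_law1 Z g).

(** [Mclass] is assumed for the first signal; stationarity with a window of length 1 and a shift of
    1 carries its exponential moments to the second. *)
Lemma stationary_signal (A : set V) : measurable A ->
  Pr (signal Z g 1 @^-1` A) = Pr (signal Z g 0 @^-1` A).
Proof.
move=> mA; have [st _ _] := model.
have mB : measurable ((fun t : 1.-tuple (l.-tuple R) => g (tnth t ord0)) @^-1` A).
  have mf : measurable_fun setT (fun t : 1.-tuple (l.-tuple R) => g (tnth t ord0)).
    by apply: measurableT_comp => //; exact: measurable_tnth.
  by rewrite -[X in measurable X]setTI; exact: mf.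
have := st 1%N 1%N _ mB; rewrite /pushforward.
have E k : (fun w => [tuple Z (k + i)%N w | i < 1]) @^-1`
    ((fun t : 1.-tuple (l.-tuple R) => g (tnth t ord0)) @^-1` A) = signal Z g k @^-1` A.
  by apply/seteqP; split => w /=; rewrite tnth_mktuple addn0.
by rewrite E (E 0%N).
Qed.

Lemma measurable_exp_vdot (u : V) : measurable_fun setT (fun x : V => (expR (vdot u x))%:E).
Proof.
apply/measurable_EFinP; apply: measurableT_comp => //; exact: measurable_vdot.
Qed.

Lemma integral_exp_signal (u : V) :
  (\int[signal_law2 Z g]_x (expR (vdot u x.1))%:E = \int[signal_law1 Z g]_x (expR (vdot u x))%:E)%E /\
  (\int[signal_law2 Z g]_x (expR (vdot u x.2))%:E = \int[signal_law1 Z g]_x (expR (vdot u x))%:E)%E.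
Proof.
have mu := measurable_exp_vdot u.
split.
  rewrite !ge0_integral_distribution//.
  exact: (measurableT_comp mu measurable_fst).
rewrite ge0_integral_distribution//; last first.
  exact: (measurableT_comp mu measurable_snd).
transitivity (\int[distribution Pr (signal Z g 1)]_x (expR (vdot u x))%:E)%E.
  by rewrite ge0_integral_distribution// => x; rewrite lee_fin expR_ge0.
apply: eq_measure_integral => A mA _.
exact: stationary_signal.
Qed.

Lemma exp_moments_signal : exp_moments (signal_law2 Z g).
Proof.
have [A [B [A0 B0 AB]]] := Mrho.
move=> u; have [E1 E2] := integral_exp_signal u.
have fin (h : V * V -> V) : measurable_fun setT h ->
   (\int[signal_law2 Z g]_x (expR (vdot u (h x)))%:E = \int[signal_law1 Z g]_x (expR (vdot u x))%:E)%E ->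
   (signal_law2 Z g).-integrable setT (EFin \o (fun x => expR (vdot u (h x)))).
  move=> mh E; apply/integrableP; split; first exact: (measurableT_comp (measurable_exp_vdot u) mh).
  under eq_integral do rewrite /= ger0_norm ?expR_ge0//.
  by rewrite E (le_lt_trans (AB u))// ltry.
by split; [exact: (fin fst)|exact: (fin snd)].
Qed.

(** Only the real part of [s] affects the modulus of the exponential, so the transform is bounded by
    a real exponential moment of the first signal, which [Mclass] controls. *)
Lemma order_below_two_signal (u : V) :
  order_below_two (fun s => Phi (signal_law2 Z g) (cline czero (real_vec u) s) czero).
Proof.
have [A [B [A0 B0 AB]]] := Mrho; have /andP[rho0 rho_2] := rho2.
move=> e e0; have e20 : 0 < e / 2 by rewrite divr_gt0.
have C0 : 0 <= B * vnorm u `^ rho by rewrite mulr_ge0 ?powR_ge0// ltW.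
have [r1 h1] := powR_dominated rho_2 C0 e20.
(* Half of [e] absorbs the power [rho], and the other half the constant [2 * A], which is at most
   [e / 2 * r^2] once [r >= 1] and [r >= 4 * A / e]. *)
exists (Num.max r1 (Num.max 1 (4 * A / e))) => r.
rewrite !ge_max => /and3P[rr1 r1' rA] s sr.
have r0 : 0 <= r by lra.
rewrite (le_trans (modc_Phi_le exp_moments_signal u s))//.
have bound : \int[signal_law2 Z g]_x expR (complex.Re s * vdot u x.1) <=
    A * expR (B * vnorm u `^ rho * r `^ rho).
  rewrite /Rintegral; under eq_integral do rewrite -vdot_vscale.
  have [-> _] := integral_exp_signal (vscale (complex.Re s) u).
  have AB' := AB (vscale (complex.Re s) u).
  rewrite -lee_fin fineK; last first.
    rewrite ge0_fin_numE ?(le_lt_trans AB') ?ltry//.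
    by apply: integral_ge0 => x _; rewrite lee_fin expR_ge0.
  rewrite (le_trans AB')// lee_fin ler_pM2l// ler_expR vnorm_vscale.
  rewrite powRM ?sqrtr_ge0// mulrCA [leRHS]mulrC ler_wpM2r//.
  apply: ge0_ler_powR; rewrite ?nnegrE ?(ltW rho0)//.
  exact: le_trans (Re_modc s) sr.
have A1 : 2 * A <= expR (2 * A) by have := @expR_ge1Dx R (2 * A); lra.
apply: (@le_trans _ _ (expR (2 * A) * expR (B * vnorm u `^ rho * r `^ rho))).
  rewrite (le_trans (ler_wpM2l _ bound))// mulrA ler_wpM2r ?expR_ge0//.
rewrite -expRD ler_expR.
have h2 := h1 r rr1.
rewrite ler_pdivrMr// in rA.
have h3 : e * r <= e * r ^+ 2 by rewrite ler_pM2l// expr2 ler_peMl.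
lra.
Qed.

End ModelHypotheses.

(** The exponents [rho] and [rho'] may differ: each yields exponential moments and growth o(r^2) for
    its own model, and the comparison is made at that level. *)
Theorem corollary1 (R : realType) (d : nat)
    (* the first model, with (R, P) = (signal_law2 Z g, P) *)
    (l : nat) (disp : measure_display) (Omega : measurableType disp)
    (Pr : probability Omega R)
    (Z : nat -> {RV Pr >-> l.-tuple R}) (g : {mfun l.-tuple R >-> d.-tuple R})
    (eps : nat -> {RV Pr >-> d.-tuple R}) (P : probability (d.-tuple R) R)
    (rho : R)
    (* the second model *)
    (l' : nat) (disp' : measure_display) (Omega' : measurableType disp')
    (Pr' : probability Omega' R)
    (Z' : nat -> {RV Pr' >-> l'.-tuple R})
    (g' : {mfun l'.-tuple R >-> d.-tuple R})
    (eps' : nat -> {RV Pr' >-> d.-tuple R}) (P' : probability (d.-tuple R) R)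
    (rho' : R) :
  noisy_stationary_model Z eps P ->
  0 < rho < 2 -> Mclass rho (signal_law1 Z g) ->
  nowhere_null_sections (signal_law2 Z g) ->
  noisy_stationary_model Z' eps' P' ->
  0 < rho' < 2 -> Mclass rho' (signal_law1 Z' g') ->
  nowhere_null_sections (signal_law2 Z' g') ->
  same_law (observation_law2 Z g eps) (observation_law2 Z' g' eps') ->
  equal_up_to_translation (signal_law2 Z g) P (signal_law2 Z' g') P'.
Proof.
move=> model rho2 Mrho nn model' rho2' Mrho' nn' same.
apply: deconvolution_unique => //.
- exact: exp_moments_signal model Mrho.
- exact: exp_moments_signal model' Mrho'.
- move=> t; rewrite -(charfun_observation g model) -(charfun_observation g' model').
  have E (f : d.-tuple R * d.-tuple R -> R) :
      \int[observation_law2 Z g eps]_x f x = \int[observation_law2 Z' g' eps']_x f x.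
    by rewrite /Rintegral; congr fine; apply: eq_measure_integral => A mA _; exact: same.
  by rewrite /charfun !E.
- by move=> u; exact: order_below_two_signal model rho2 Mrho u.
- by move=> u; exact: order_below_two_signal model' rho2' Mrho' u.
Qed.
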